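(* Assume $n=1$, $\delta_1\in[0,1/2)$ and $\delta_1'\in[1/2,1)$. Then there is $\kappa\in(0,1]$ and, for each $R>0$, there is $\lambda_R>0$ such that \[ \int_{B(x;r)}\Gamma(\varphi)(y)\,dy\ \ge\ \lambda_R\,r^{-2}\int_{B(x;\kappa r)}\big(\varphi(y)-\langle\varphi\rangle_B\big)^2dy \] for all $x\in\mathbb R^{1+m}$, all $r\in(0,R]$ and all $\varphi\in C^1(\mathbb R^{1+m})$, where $\langle\varphi\rangle_B=|B(x;\kappa r)|^{-1}\int_{B(x;\kappa r)}\varphi$.
   Context: Let $m\ge1$, $x=(x_1,x_2)\in\mathbb R\times\mathbb R^m$, $|\cdot|$ Euclidean norms. For $a\ge0$, $a^{(\alpha,\alpha')}=a^\alpha$ if $a\le1$ and $a^{\alpha'}$ if $a\ge1$. Fix $\delta_1,\delta_1'\in[0,1)$, $\delta_2,\delta_2'\ge0$. Let $C_\delta(x)=|x_1|^{(2\delta_1,2\delta_1')}\oplus|x_1|^{(2\delta_2,2\delta_2')}I_m$ and let $C=(c_{ij})$ be a real symmetric measurable matrix function with $a\,C_\delta\le C\le a'\,C_\delta$ a.e. for some $a,a'>0$. $\Gamma(\varphi)=\sum c_{ij}\partial_i\varphi\,\partial_j\varphi$. The distance is $d(x;y)=\sup\{\psi(x)-\psi(y):\psi\in C^1(\mathbb R^{1+m}),\ \Gamma(\psi)\le1\}$, $B(x;r)=\{y:d(x;y)<r\}$, $|B|$ Lebesgue measure. *)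

(* Defs.v *)
From HB Require Import structures.
From mathcomp Require Import all_boot all_order all_algebra.
From mathcomp Require Import all_classical all_reals all_analysis.
Unset Printing Implicit Defensive.
Import Order.TTheory GRing.Theory Num.Theory.
Import numFieldNormedType.Exports.
Local Open Scope classical_set_scope.
Local Open Scope ring_scope.

Section defs.
Variable R : realType.

Definition V (n : nat) := 'rV[R]_n.

Definition box n (a b : 'I_n -> R) : set (V n) :=
  [set x | forall i, a i <= x ord0 i < b i].
Definition boxvol n (a b : 'I_n -> R) : R := \prod_(i < n) Num.max (b i - a i) 0.

Definition lebo n (A : set (V n)) : \bar R :=
  ereal_inf [set S | exists a b : nat -> 'I_n -> R,
     A `<=` \bigcup_k box n (a k) (b k) /\
     S = (\sum_(0 <= k <oo) (boxvol n (a k) (b k))%:E)%E].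

Definition LebGen n : set (set (V n)) := [set A | open A \/ lebo n A = 0%E].
Definition Leb n := g_sigma_algebraType (LebGen n).

Definition Lint n (B : set (V n)) (f : V n -> \bar R) : \bar R :=
  @integral _ (Leb n) R (lebo n : set (Leb n) -> \bar R) B f.

Definition ae n (P : V n -> Prop) : Prop :=
  exists N : set (V n), lebo n N = 0%E /\ forall x, ~ N x -> P x.

Definition partial n (i : 'I_n) (f : V n -> R) (x : V n) : R :=
  derive f x (delta_mx 0 i : V n).

Definition C1 n (f : V n -> R) : Prop :=
  forall i : 'I_n, (forall x, derivable f x (delta_mx 0 i : V n)) /\
                   continuous (partial n i f).

Definition Gam n (C : V n -> 'M[R]_n) (f : V n -> R) (y : V n) : R :=
  \sum_(i < n) \sum_(j < n) C y i j * partial n i f y * partial n j f y.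

Definition bipow (a al al' : R) : R := if a <= 1 then a `^ al else a `^ al'.

Definition Cdelta m (d1 d1' d2 d2' : R) (x : V (1 + m)) : 'M[R]_(1 + m) :=
  \matrix_(i, j) (if i == j then
      (if (i : nat) == 0%N then bipow `|x 0 0| (2 * d1) (2 * d1')
       else bipow `|x 0 0| (2 * d2) (2 * d2'))
    else 0).

Definition qf n (M : 'M[R]_n) (xi : 'I_n -> R) : R :=
  \sum_(i < n) \sum_(j < n) xi i * M i j * xi j.

Definition dist n (C : V n -> 'M[R]_n) (x y : V n) : \bar R :=
  ereal_sup [set (psi x - psi y)%:E | psi in
     [set psi : V n -> R | C1 n psi /\ ae n (fun z => Gam n C psi z <= 1)]].

Definition Ball n (C : V n -> 'M[R]_n) (x : V n) (r : R) : set (V n) :=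
  [set y | (dist n C x y < r%:E)%E].

Definition avg n (B : set (V n)) (f : V n -> R) : R :=
  fine (Lint n B (fun y => (f y)%:E)) / fine (lebo n B).
End defs.

(* Main.v *)
Require Import Defs.
From HB Require Import structures.
From mathcomp Require Import all_boot all_order all_algebra.
From mathcomp Require Import all_classical all_reals all_analysis.
From mathcomp Require Import measurable_realfun ring lra.
Import Order.TTheory GRing.Theory Num.Theory.
Import numFieldNormedType.Exports.
Set Implicit Arguments.
Unset Strict Implicit.
Local Open Scope classical_set_scope.
Local Open Scope ring_scope.

(** A C^1 function [psi] with [Gam psi <= 1] almost everywhere satisfies pointwise bounds on
    its partial derivatives, and cut-offs of a regularised coordinate
    [s / (|s|^d1 + |s|^d1')] are admissible. Hence [Ball x (kappa r)] is contained in a box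
    [Q = [p, q] x cube], and [Q] in [Ball x r], where [p] and [q] lie at horizontal distance
    [rho = c r] from [x_1] and the side of the cube is [rho] times the square root of the
    vertical weight at the end point farther from the singular hyperplane.

    On [Q] the Poincare inequality is obtained by tensorisation. A one-dimensional weighted
    inequality, whose constant is finite because [|s|^(-2 d1)] is integrable for [d1 < 1/2],
    moves every slice [x_1 = s] to one slice [x_1 = t]; there the unweighted cube inequality is
    applied. The slice [t] is chosen by averaging over the quarter of [p, q] farthest from [0],
    where the vertical weight is comparable to its maximum over the box. When the box is far
    from the singular hyperplane, the horizontal weight is also comparable to a constant, and
    this is where the restriction [r <= R] fixes the threshold between the two regimes. The
    average minimises the quadratic deviation, so the inequality passes to [Ball x (kappa r)]. *)

(** * Coordinates and boxes *)

(** The radius must be bounded because of boxes that meet the singular hyperplane at a large scale.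
    If M is the larger of |p| and |q|, then q - p is comparable to M and rho to M^(1 - d1'), so a
    constant uniform in rho would force the integral of 1/U over [p, q], U being the horizontal
    weight, to be at most a multiple of M^(1 - 2 d1'). For d1' > 1/2 that power tends to 0 while the
    integral does not; for d1' = 1/2 the integral grows like a logarithm. The inclusions between
    boxes and balls are scale free, so kappa is fixed before R.

    The vertical side is measured at the farther end point because vertical motion is cheapest
    there: a point can be carried to that slice, moved vertically and carried back.

    The form Gamma has merely Lebesgue measurable coefficients and is controlled only almost
    everywhere. It is replaced by a continuous energy before any slicing, so that Tonelli is applied
    to Borel integrands, for a measure built as an iterated product and identified with the covering
    outer measure. *)

Section consv.
Variable R : realType.
Local Notation box := (@Defs.box _ _).
Local Notation boxvol := (@Defs.boxvol _ _).

Definition consv n (t : R) (y : V R n) : V R n.+1 :=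
  \row_i oapp (fun j => y ord0 j) t (unlift ord0 i).
Definition tailv n (z : V R n.+1) : V R n := \row_j z ord0 (lift ord0 j).

Lemma consv0 n t (y : V R n) : consv t y ord0 ord0 = t.
Proof. by rewrite mxE unlift_none. Qed.

Lemma consvS n t (y : V R n) j : consv t y ord0 (lift ord0 j) = y ord0 j.
Proof. by rewrite mxE liftK. Qed.

Lemma tailvE n (z : V R n.+1) j : tailv z ord0 j = z ord0 (lift ord0 j).
Proof. by rewrite mxE. Qed.

Lemma consvK n (z : V R n.+1) : consv (z ord0 ord0) (tailv z) = z.
Proof.
apply/rowP => i; case: (unliftP ord0 i) => [j|] ->.
  by rewrite consvS tailvE.
by rewrite consv0.
Qed.

Lemma tailv_consv n t (y : V R n) : tailv (consv t y) = y.
Proof. by apply/rowP => j; rewrite tailvE consvS. Qed.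

Lemma continuous_row (T : topologicalType) n (f : T -> V R n) (x : T) :
  (forall i, (fun t => f t ord0 i) @ x --> f x ord0 i) -> f @ x --> f x.
Proof.
move=> fc; apply/cvg_ballP => e e0.
have : \forall t \near x, forall i, ball (f x ord0 i) e (f t ord0 i).
  apply: filter_forall => i.
  by have := fc i => /cvg_ballP; apply.
by apply: filterS => t H; split=> // i j; rewrite ord1.
Qed.

Lemma box_consv n (a b : 'I_n.+1 -> R) t (y : V R n) :
  box a b (consv t y) <->
  a ord0 <= t < b ord0 /\ box (fun j => a (lift ord0 j)) (fun j => b (lift ord0 j)) y.
Proof.
split=> [H|[H0 HS] i].
  split; first by have := H ord0; rewrite consv0.
  by move=> j; have := H (lift ord0 j); rewrite consvS.
case: (unliftP ord0 i) => [j|] ->; last by rewrite consv0.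
by rewrite consvS; exact: HS.
Qed.

Lemma boxvolS n (a b : 'I_n.+1 -> R) :
  boxvol a b = Num.max (b ord0 - a ord0) 0 *
    boxvol (fun j => a (lift ord0 j)) (fun j => b (lift ord0 j)).
Proof. by rewrite /Defs.boxvol big_ord_recl. Qed.

Lemma boxvol_ge0 n (a b : 'I_n -> R) : 0 <= boxvol a b.
Proof. by apply: prodr_ge0 => i _; rewrite le_max lexx orbT. Qed.

(** Countability comes from rational corners: [unpickle] enumerates pairs of rational corner
    vectors, and [P] keeps the indices whose box lies in [U]. *)
Lemma open_boxes n (U : set (V R n)) : open U ->
  exists (a b : nat -> 'I_n -> R) (P : set nat),
    U = \bigcup_(k in P) box (a k) (b k).
Proof.
move=> oU.
pose dec k := odflt ([ffun=> 0], [ffun=> 0])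
  (unpickle k : option ({ffun 'I_n -> rat} * {ffun 'I_n -> rat})).
pose a k i : R := ratr ((dec k).1 i).
pose b k i : R := ratr ((dec k).2 i).
exists a, b, [set k | box (a k) (b k) `<=` U].
apply/seteqP; split=> [x Ux|x [k kU]]; last exact: kU.
have := open_nbhs_nbhs (conj oU Ux); rewrite -nbhs_ballE => -[e /= e0 eU].
have ra i : {q : rat | x ord0 i - e < ratr q < x ord0 i}.
  by apply: cid; have [|q] := @rat_in_itvoo R (x ord0 i - e) (x ord0 i);
    [rewrite ltrBlDr ltrDl | rewrite in_itv; exists q].
have rb i : {q : rat | x ord0 i < ratr q < x ord0 i + e}.
  by apply: cid; have [|q] := @rat_in_itvoo R (x ord0 i) (x ord0 i + e);
    [rewrite ltrDl | rewrite in_itv; exists q].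
pose p := ([ffun i => sval (ra i)], [ffun i => sval (rb i)]).
have dp : dec (pickle p) = p by rewrite /dec pickleK.
have xb : box (a (pickle p)) (b (pickle p)) x.
  move=> i; rewrite /a /b dp /= !ffunE.
  case: (ra i) => q /= /andP[_ /ltW ->]; case: (rb i) => q' /= /andP[-> _].
  by [].
exists (pickle p) => //= y yb; apply: eU; split=> // i j.
rewrite ord1; have := yb j; rewrite /a /b dp /= !ffunE.
case: (ra j) => q /= /andP[q1 q2]; case: (rb j) => q' /= /andP[q3 q4].
move=> /andP[y1 y2]; rewrite /ball /= ltr_distlC; apply/andP; split.
  exact: lt_le_trans y1.
exact: lt_trans q4.
Qed.

(** Slicing is done on Borel sets: [consv] is measurable from a product of Borel spaces to this
    sigma-algebra, but not to [Leb], which also contains every null set. *)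
Definition Bo n := g_sigma_algebraType [set A : set (V R n) | open A].

Lemma open_measurable_Bo n (A : set (V R n)) : open A -> measurable (A : set (Bo n)).
Proof. by move=> oA; exact: sub_gen_smallest. Qed.

Lemma closed_measurable_Bo n (A : set (V R n)) :
  closed A -> measurable (A : set (Bo n)).
Proof.
move=> cA; rewrite -(setCK A); apply: measurableC; apply: open_measurable_Bo.
exact: closed_openC.
Qed.

Lemma box_measurable n (a b : 'I_n -> R) : measurable (box a b : set (Bo n)).
Proof.
have -> : box a b = \bigcap_(i in [set: 'I_n])
    ([set x : V R n | a i <= x ord0 i] `&` [set x : V R n | x ord0 i < b i]).
  apply/seteqP; split=> x /=.
    by move=> H i _; have /andP[] := H i.
  by move=> H i; apply/andP; have [] := H i I.
apply: fin_bigcap_measurable => // i _; apply: measurableI.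
  apply: closed_measurable_Bo.
  apply: (preimage_closed _ (@closed_ge _ (a i))) => x _.
  exact: coord_continuous.
apply: open_measurable_Bo.
apply: (open_comp _ (@open_lt _ (b i))) => x _.
exact: coord_continuous.
Qed.

Lemma continuous_measurable_Bo n (f : V R n -> R) :
  continuous f -> measurable_fun setT (f : Bo n -> R).
Proof.
move=> fc; apply: (measurability _ (RGenOpens.measurableE R)).
move=> _ [_ [x [y ->] <-]]; rewrite setTI; apply: open_measurable_Bo.
apply: open_comp; last exact: interval_open.
by move=> z _; exact: fc.
Qed.

(** The preimage of a box is a measurable rectangle, and an open set is a countable union of
    boxes. *)
Lemma measurable_consv n :
  measurable_fun setT (fun p : R * Bo n => consv p.1 p.2 : Bo n.+1).
Proof.
apply: (@measurability _ _ _ (Bo n.+1) setT _ [set A : set (V R n.+1) | open A] erefl).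
move=> _ [U oU <-]; rewrite setTI.
have [a [b [P ->]]] := open_boxes oU.
rewrite preimage_bigcup; apply: bigcup_measurable => k _.
rewrite (_ : _ @^-1` _ = `[a k ord0, b k ord0[%classic `*`
  box (fun j => a k (lift ord0 j)) (fun j => b k (lift ord0 j))).
  by apply: measurableX; [exact: measurable_itv|exact: box_measurable].
by apply/seteqP; split=> -[t y] /=; rewrite in_itv /= box_consv.
Qed.

End consv.

(** * Lebesgue measure on row vectors by iterated products *)

Section nu.
Variable R : realType.
Local Notation box := (@Defs.box _ _).
Local Notation boxvol := (@Defs.boxvol _ _).
Local Notation mu := (@lebesgue_measure R).
Local Open Scope ereal_scope.

Section step.
Variables (n : nat) (m : {sigma_finite_measure set (Bo R n) -> \bar R}).
Let consp (p : R * Bo R n) : Bo R n.+1 := consv p.1 p.2.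

Definition nuS : set (Bo R n.+1) -> \bar R := pushforward (mu \x m) consp.

Let nuS0 : nuS set0 = 0.
Proof. by rewrite /nuS /pushforward preimage_set0 measure0. Qed.

Let mconsp : measurable_fun setT consp.
Proof. exact: measurable_consv. Qed.

Let nuS_ge0 A : 0 <= nuS A.
Proof. exact: measure_ge0. Qed.

Let nuS_sa : semi_sigma_additive nuS.
Proof.
move=> F mF tF mUF; rewrite /nuS /pushforward preimage_bigcup.
apply: measure_semi_sigma_additive.
- by move=> k; rewrite -[X in measurable X]setTI; exact: mconsp.
- apply/trivIsetP => /= i j _ _ ij; rewrite -preimage_setI.
  by move/trivIsetP : tF => /(_ _ _ _ _ ij) ->//; rewrite preimage_set0.
- by rewrite -preimage_bigcup -[X in measurable X]setTI; exact: mconsp.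
Qed.

HB.instance Definition _ := isMeasure.Build _ _ _ nuS nuS0 nuS_ge0 nuS_sa.

Lemma nuS_box : (forall a b, m (box a b) = (boxvol a b)%:E) ->
  forall a b, nuS (box a b) = (boxvol a b)%:E.
Proof.
move=> mbox a b; rewrite /nuS /pushforward.
rewrite (_ : _ @^-1` _ = `[a ord0, b ord0[%classic `*`
    box (fun j => a (lift ord0 j)) (fun j => b (lift ord0 j))); last first.
  by apply/seteqP; split=> -[t y] /=; rewrite in_itv /= /consp box_consv.
rewrite product_measure1E; [|exact: measurable_itv|exact: box_measurable].
rewrite mbox boxvolS EFinM; congr (_ * _).
rewrite /= lebesgue_measure_itv /= lte_fin; case: ltP => ab.
  by rewrite -EFinD; congr (_%:E); apply/esym/max_idPl; rewrite subr_ge0 ltW.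
by congr (_%:E); apply/esym/max_idPr; rewrite subr_le0.
Qed.

Lemma nuS_fubini (f : Bo R n.+1 -> \bar R) : measurable_fun setT f ->
  (forall x, 0 <= f x) ->
  \int[nuS]_x f x = \int[mu]_t \int[m]_y f (consv t y).
Proof.
move=> mf f0; rewrite /nuS ge0_integral_pushforward//.
rewrite preimage_setT fubini_tonelli1 //.
- exact: measurableT_comp.
- by move=> ? /=.
Qed.

End step.

Lemma cover_boxes n : [set: V R n] = \bigcup_k box (fun=> - k%:R)%R (fun=> k%:R)%R.
Proof.
apply/seteqP; split=> // x _.
pose M := (1 + \sum_i `|x ord0 i|)%R.
have [k Mk] : exists k : nat, (M <= k%:R)%R.
  exists (Num.bound M); apply/ltW/archi_boundP.
  by apply: addr_ge0 => //; apply: sumr_ge0.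
exists k => // i.
have xi : (`|x ord0 i| < k%:R)%R.
  apply: lt_le_trans Mk; rewrite /M (bigD1 i) //= addrCA ltrDl.
  by apply: ltr_pwDl => //; apply: sumr_ge0.
by move: xi; rewrite ltr_norml => /andP[/ltW -> ->].
Qed.

Lemma box_sigma_finite n (m : {measure set (Bo R n) -> \bar R}) :
  (forall a b, m (box a b) = (boxvol a b)%:E) -> sigma_finite setT m.
Proof.
move=> mbox; exists (fun k => box (fun=> - k%:R)%R (fun=> k%:R)%R).
  exact: cover_boxes.
by move=> k; split; [exact: box_measurable | rewrite mbox ltry].
Qed.

(** The value on boxes travels with the measure because it yields the sigma-finiteness required by
    the next product. *)
Definition boxmeas n := {m : {sigma_finite_measure set (Bo R n) -> \bar R} |
  forall a b, m (box a b) = (boxvol a b)%:E}.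

Lemma boxmeas_step n (m : boxmeas n) : exists m' : boxmeas n.+1,
  forall f, measurable_fun setT f -> (forall x, 0 <= f x) ->
  \int[sval m']_x f x = \int[mu]_t \int[sval m]_y f (consv t y).
Proof.
case: m => m mbox /=.
have sf := box_sigma_finite (nuS_box mbox).
pose m0 : {sigma_finite_measure set (Bo R n.+1) -> \bar R} :=
  HB.pack (nuS m) (Measure_isSigmaFinite.Build _ _ _ (nuS m) sf).
unshelve eexists (exist _ m0 _) => /=; first exact: nuS_box.
by move=> f mf f0; exact: nuS_fubini.
Qed.

(* The recursion starts in dimension 0 from a Dirac mass, and [lebo] is identified with the
   resulting measure only in positive dimension: in dimension 0 every box has content 1, hence
   [lebo set0 = +oo]. *)
Lemma boxmeas0 : boxmeas 0.
Proof.
have h a b : (@dirac _ (Bo R 0) 0%R R) (box a b) = (boxvol a b)%:E.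
  rewrite diracE /Defs.boxvol big_ord0 mem_set //.
  by move=> -[].
pose m0 : {sigma_finite_measure set (Bo R 0) -> \bar R} :=
  HB.pack (@dirac _ (Bo R 0) 0%R R)
  (Measure_isSigmaFinite.Build _ _ _ (@dirac _ (Bo R 0) 0%R R) (box_sigma_finite h)).
by exists m0.
Qed.

Fixpoint nub n : boxmeas n :=
  match n with 0%N => boxmeas0 | k.+1 => sval (cid (boxmeas_step (nub k))) end.

Definition nu n := sval (nub n).

Lemma nu_box n a b : nu n (box a b) = (boxvol a b)%:E.
Proof. exact: (svalP (nub n)). Qed.

Lemma nu_fubini n f : measurable_fun setT f -> (forall x, 0 <= f x) ->
  \int[nu n.+1]_x f x = \int[mu]_t \int[nu n]_y f (consv t y).
Proof. exact: (svalP (cid (boxmeas_step (nub n)))). Qed.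

Lemma measurable_nu_slice n (f : Bo R n.+1 -> \bar R) : measurable_fun setT f ->
  (forall x, 0 <= f x) ->
  measurable_fun setT (fun t => \int[nu n]_y f (consv t y)).
Proof.
move=> mf f0.
apply: (@measurable_fun_fubini_tonelli_F _ _ _ _ _ (nu n)
  (fun p : R * Bo R n => f (consv p.1 p.2))) => //.
exact: (measurableT_comp mf (@measurable_consv R n)).
Qed.

End nu.

(** * Comparison with the covering outer measure *)

Section lebo.
Variables (R : realType) (k : nat).
Local Notation box := (@Defs.box _ _).
Local Notation boxvol := (@Defs.boxvol _ _).
Local Notation n := k.+1.
Local Notation nu := (@nu R n).
Local Notation lebo := (Defs.lebo R n).
Local Notation Leb := (Defs.Leb R n).
Local Open Scope ereal_scope.

Definition isbox (X : set (V R n)) := exists a b, X = box a b.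

(* With content [+oo] outside boxes, the outer measure [mu_ext] only sees covers by boxes. *)
Definition boxcontent (X : set (V R n)) : \bar R :=
  if `[< isbox X >] then nu X else +oo.

Lemma boxcontentE a b : boxcontent (box a b) = (boxvol a b)%:E.
Proof. by rewrite /boxcontent asboolT ?nu_box //; exists a, b. Qed.

Lemma box00 : box (fun=> 0%R : R) (fun=> 0%R) = set0 :> set (V R n).
Proof.
by apply/seteqP; split=> // x /(_ ord0) /andP[/le_lt_trans /[apply]]; rewrite ltxx.
Qed.

Lemma boxcontent0 : boxcontent set0 = 0.
Proof.
rewrite /boxcontent asboolT ?measure0 //.
by exists (fun=> 0%R), (fun=> 0%R); rewrite box00.
Qed.

Lemma boxcontent_ge0 X : 0 <= boxcontent X.
Proof. by rewrite /boxcontent; case: ifP => // _; rewrite leey. Qed.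

Local Notation T := (g_sigma_algebraType [set: set (V R n)]).

(** Transfers to [lebo] the laws of an outer measure known for [mu_ext]. Every set is measurable in
    [T], so the measurability that [mu_ext] asks of a cover costs nothing. *)
Lemma lebo_mu_ext : lebo = @mu_ext _ T R boxcontent.
Proof.
apply/funext => A; apply/eqP; rewrite eq_le; apply/andP; split.
  apply: le_ereal_inf_tmp => _ [F [mF AF] <-].
  have [[i Fi]|Fb] := pselect (exists i, ~ isbox (F i)).
    rewrite (@eseries_pinfty _ _ xpredT i) ?leey //.
      by move=> j _; rewrite gt_eqF // (lt_le_trans _ (boxcontent_ge0 _)).
    by rewrite /boxcontent asboolF.
  have {}Fb i : {ab | F i = box ab.1 ab.2}.
    apply: cid; have : isbox (F i) by apply: contrapT => H; apply: Fb; exists i.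
    by move=> [a [b ->]]; exists (a, b).
  apply: ereal_inf_lbound; exists (fun i => (sval (Fb i)).1), (fun i => (sval (Fb i)).2).
  split; first by move=> x /AF [i _ Fix]; exists i => //; rewrite -(svalP (Fb i)).
  by apply: eq_eseriesr => i _; rewrite -boxcontentE; congr boxcontent; exact: (svalP (Fb i)).
apply: le_ereal_inf_tmp => _ [a [b [Aab ->]]].
apply: ereal_inf_lbound; exists (fun i => box (a i) (b i)).
  split=> // i; exact: sub_gen_smallest.
by apply: eq_eseriesr => i _; rewrite boxcontentE.
Qed.

Let lebo0 : lebo set0 = 0.
Proof. by rewrite lebo_mu_ext; apply: mu_ext0; [exact: boxcontent0|exact: boxcontent_ge0]. Qed.

Let lebo_ge0 A : 0 <= lebo A.
Proof. by rewrite lebo_mu_ext; apply: mu_ext_ge0; exact: boxcontent_ge0. Qed.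

Let le_lebo : {homo lebo : A B / A `<=` B >-> A <= B}.
Proof. by move=> A B AB; rewrite lebo_mu_ext; exact: (@le_mu_ext _ T R boxcontent A B AB). Qed.

Let lebo_sigma_subadditive : sigma_subadditive lebo.
Proof.
rewrite lebo_mu_ext; apply: (@mu_ext_sigma_subadditive _ T); exact: boxcontent_ge0.
Qed.

HB.instance Definition _ := isOuterMeasure.Build R (V R n) lebo
  lebo0 lebo_ge0 le_lebo lebo_sigma_subadditive.

Lemma lebo_le_cover (A : set (V R n)) (a b : nat -> 'I_n -> R) :
  A `<=` \bigcup_i box (a i) (b i) -> lebo A <= \sum_(i <oo) (boxvol (a i) (b i))%:E.
Proof. by move=> H; apply: ereal_inf_lbound; exists a, b. Qed.

Definition setc (f : 'I_n -> R) i c : 'I_n -> R := fun j => if j == i then c else f j.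

Lemma box_below a b i c : box a b `&` [set x : V R n | (x ord0 i < c)%R] =
  box a (setc b i (Num.min (b i) c)).
Proof.
apply/seteqP; split=> x /=.
  move=> [H xc] j; rewrite /setc; case: eqP => [->|_]; last exact: H.
  by have /andP[-> xb] := H i; rewrite lt_min xb.
move=> H; split; last by have := H i; rewrite /setc eqxx lt_min => /and3P[].
by move=> j; have := H j; rewrite /setc; case: eqP => [->|//]; rewrite lt_min => /and3P[-> ->].
Qed.

Lemma box_above a b i c : box a b `&` ~` [set x : V R n | (x ord0 i < c)%R] =
  box (setc a i (Num.max (a i) c)) b.
Proof.
apply/seteqP; split=> x /=.
  move=> [H /negP xc] j; rewrite /setc; case: eqP => [->|_]; last exact: H.
  by have /andP[xa ->] := H i; rewrite ge_max xa leNgt xc.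
move=> H; split; last by have := H i; rewrite /setc eqxx ge_max => /andP[/andP[_]];
  rewrite leNgt => /negP.
by move=> j; have := H j; rewrite /setc; case: eqP => [->|//];
  rewrite ge_max => /andP[/andP[-> _] ->].
Qed.

Lemma lt_measurable_Bo i c : measurable ([set x | (x ord0 i < c)%R] : set (Bo R n)).
Proof.
apply: open_measurable_Bo.
apply: (open_comp _ (@open_lt _ c)) => x _.
exact: coord_continuous.
Qed.

(** A coordinate half-space cuts each box of a cover into two boxes, and the additivity of [nu] says
    that their volumes add up. *)
Lemma caratheodory_halfspace i c :
  lebo.-caratheodory [set x : V R n | (x ord0 i < c)%R].
Proof.
apply: le_caratheodory_measurable => X.
apply: le_ereal_inf_tmp => _ [a [b [Xab ->]]].
set H := [set x | _].
rewrite (@eq_eseriesr _ _ (fun j =>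
  (boxvol (a j) (setc (b j) i (Num.min (b j i) c)))%:E +
  (boxvol (setc (a j) i (Num.max (a j i) c)) (b j))%:E)); last first.
  move=> j _; rewrite -!nu_box -box_below -box_above -/H.
  rewrite -measureU; [|apply: measurableI|apply: measurableI|].
  - by rewrite -setIUr setUCr setIT.
  - exact: box_measurable.
  - exact: lt_measurable_Bo.
  - exact: box_measurable.
  - by apply: measurableC; exact: lt_measurable_Bo.
  - by rewrite setIACA setICr setI0.
rewrite nneseriesD; try by move=> *; rewrite lee_fin boxvol_ge0.
apply: leeD; apply: lebo_le_cover.
  move=> x [Xx Hx]; have [j _ xj] := Xab _ Xx; exists j => //.
  by rewrite -box_below.
move=> x [Xx Hx]; have [j _ xj] := Xab _ Xx; exists j => //.
by rewrite -box_above.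
Qed.

Local Notation Ca := (caratheodory_type lebo).

Lemma caratheodory_box a b : measurable (box a b : set Ca).
Proof.
have -> : box a b = \bigcap_(i in [set: 'I_n])
    (~` [set x : V R n | (x ord0 i < a i)%R] `&` [set x : V R n | (x ord0 i < b i)%R]).
  apply/seteqP; split=> x /=.
    by move=> H i _; have /andP[ax bx] := H i; split=> //; apply/negP; rewrite -leNgt.
  by move=> H i; have [/negP + xb] := H i I; rewrite -leNgt => ->.
apply: fin_bigcap_measurable => // i _; apply: measurableI.
  by apply: measurableC; exact: caratheodory_halfspace.
exact: caratheodory_halfspace.
Qed.

Lemma caratheodory_open (A : set (V R n)) : open A -> measurable (A : set Ca).
Proof.
move=> /open_boxes[a [b [P ->]]].
by apply: bigcup_measurable => i _; exact: caratheodory_box.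
Qed.

(** Both kinds of generators are Caratheodory measurable: open sets through boxes, null sets by
    monotonicity. Hence [lebo] is a measure on [Leb]. *)
Lemma Leb_caratheodory (A : set (V R n)) :
  measurable (A : set Leb) -> measurable (A : set Ca).
Proof.
apply: smallest_sub.
  split=> //; first by move=> X mX; rewrite setTD; exact: measurableC.
  by move=> F mF; exact: bigcupT_measurable.
move=> X [oX|X0]; first exact: caratheodory_open.
apply: le_caratheodory_measurable => Y.
have YX0 : lebo (Y `&` X) = 0.
  by apply/eqP; rewrite eq_le lebo_ge0 andbT -X0; apply: le_lebo; exact: subIsetr.
by rewrite /= YX0 add0e; apply: le_lebo; exact: subIsetl.
Qed.

Let lebo_sa : semi_sigma_additive (lebo : set Leb -> \bar R).
Proof.
move=> F mF tF mUF.
apply: (@caratheodory_measure_sigma_additive R (V R n) lebo F) => //.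
  by move=> i; apply: Leb_caratheodory.
exact: Leb_caratheodory.
Qed.

HB.instance Definition _ := isMeasure.Build _ Leb R (lebo : set Leb -> \bar R)
  lebo0 lebo_ge0 lebo_sa.

Lemma Bo_Leb (A : set (V R n)) : measurable (A : set (Bo R n)) -> measurable (A : set Leb).
Proof.
move: A; apply: smallest_sub; first exact: (@sigma_algebra_measurable _ Leb).
by move=> X oX; apply: sub_gen_smallest; left.
Qed.

Lemma lebo_null_measurable (A : set (V R n)) : lebo A = 0 -> measurable (A : set Leb).
Proof. by move=> A0; apply: sub_gen_smallest; right. Qed.

(** The lower bound, usually a compactness argument, is the countable subadditivity of the measure
    [nu], which has the same values on boxes. *)
Lemma lebo_box a b : lebo (box a b) = (boxvol a b)%:E.
Proof.
apply/eqP; rewrite eq_le; apply/andP; split.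
  (* The one-box cover is padded with empty boxes, whose volume is 0 because the dimension is
     positive. *)
  have := @lebo_le_cover (box a b) (fun i => if i is 0%N then a else fun=> 0%R)
    (fun i => if i is 0%N then b else fun=> 0%R).
  rewrite nneseries_recl //; last by move=> *; rewrite lee_fin boxvol_ge0.
  rewrite [X in _ + X]eseries0 ?adde0; last first.
    move=> [//|j] _ _; congr (_%:E).
    by apply: EFin_inj; rewrite -nu_box box00 measure0.
  by apply=> x xab; exists 0%N.
apply: le_ereal_inf_tmp => _ [a' [b' [H ->]]].
rewrite -nu_box.
rewrite (eq_eseriesr (g := fun j => nu (box (a' j) (b' j)))); last first.
  by move=> j _; rewrite nu_box.
apply: measure_sigma_subadditive => //; first by move=> ?; exact: box_measurable.
exact: box_measurable.
Qed.

(** The same set function on the smaller sigma-algebra, so that uniqueness of measures can compare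
    it with [nu]. *)
Definition leboB : set (Bo R n) -> \bar R := lebo.

Let leboB_sa : semi_sigma_additive leboB.
Proof.
move=> F mF tF mUF; apply: lebo_sa => //; first by move=> i; exact: Bo_Leb.
exact: Bo_Leb.
Qed.

HB.instance Definition _ := isMeasure.Build _ (Bo R n) R leboB
  lebo0 lebo_ge0 leboB_sa.

Lemma measurable_Bo_boxes (A : set (V R n)) : measurable (A : set (Bo R n)) ->
  <<s isbox >> A.
Proof.
move: A; apply: smallest_sub.
  exact: (@sigma_algebra_measurable _ (g_sigma_algebraType isbox)).
move=> U /open_boxes[a [b [P ->]]].
apply: (@bigcup_measurable _ (g_sigma_algebraType isbox)) => i _.
by apply: sub_gen_smallest; exists (a i), (b i).
Qed.

(** Boxes are stable under intersection, generate the Borel sets and exhaust the space with finite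
    measure; the two measures agree on them. *)
Lemma leboB_nu (A : set (V R n)) : measurable (A : set (Bo R n)) -> lebo A = nu A.
Proof.
move=> mA.
apply: (@g_sigma_algebra_measure_unique _ _ (Bo R n) isbox _
  (fun j => box (fun=> - j%:R)%R (fun=> j%:R)%R) _ _ leboB nu) => //.
- by move=> _ [a [b ->]]; exact: box_measurable.
- by move=> j; eexists; eexists.
- by rewrite -cover_boxes.
- move=> _ _ [a [b ->]] [a' [b' ->]].
  exists (fun i => Num.max (a i) (a' i)), (fun i => Num.min (b i) (b' i)).
  apply/seteqP; split=> x /=.
    by move=> [H H'] i; have /andP[a1 b1] := H i; have /andP[a2 b2] := H' i;
      rewrite ge_max lt_min a1 a2 b1 b2.
  by move=> H; split=> i; have := H i; rewrite ge_max lt_min => /andP[/andP[a1 a2] /andP[b1 b2]];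
    rewrite ?a1 ?a2 ?b1 ?b2.
- by move=> _ [a [b ->]]; exact: (etrans (lebo_box a b) (esym (nu_box a b))).
- by move=> j; exact: (eq_ind_r (fun z => z < +oo) (ltry _)
    (lebo_box (fun=> - j%:R)%R (fun=> j%:R)%R)).
- exact: measurable_Bo_boxes.
Qed.

Lemma measurable_Bo_Leb d (U : measurableType d) (B : set (V R n)) (f : V R n -> U) :
  measurable_fun (B : set (Bo R n)) (f : Bo R n -> U) ->
  measurable (B : set (Bo R n)) -> measurable_fun (B : set Leb) (f : Leb -> U).
Proof. by move=> mf mB _ Y mY; apply: Bo_Leb; exact: mf. Qed.

(** The change of sigma-algebra is a pushforward under the identity from [Leb] to [Bo]. *)
Lemma Lint_nu (B : set (V R n)) (f : V R n -> \bar R) :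
  measurable (B : set (Bo R n)) -> measurable_fun (B : set (Bo R n)) (f : Bo R n -> \bar R) ->
  (forall x, B x -> 0 <= f x) ->
  Defs.Lint R n B f = \int[nu]_(x in B) f x.
Proof.
move=> mB mf f0.
have mid : measurable_fun setT (id : Leb -> Bo R n).
  by move=> _ A mA; rewrite setTI; exact: Bo_Leb.
rewrite -(@eq_measure_integral _ _ _ _ nu leboB); last first.
  by move=> A mA _; exact: leboB_nu.
have := @ge0_integral_pushforward _ _ _ _ R _ mid (lebo : set Leb -> \bar R) B f mB mf.
by move=> H; apply/esym; apply: H => x /[!inE]; exact: f0.
Qed.

End lebo.

(** * A weighted inequality on an interval *)

Section onedim.
Variable R : realType.
Local Notation mu := (@lebesgue_measure R).
Implicit Types f g G W w : R -> R.

Lemma derivable_is_derive f s : derivable f s 1 -> is_derive s 1 f ((derive1 f) s).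
Proof. by move=> df; rewrite derive1E; apply: derivableP. Qed.

Lemma is_derive_derive1 f (s d : R) : is_derive s 1 f d -> (derive1 f) s = d.
Proof. by move=> df; rewrite derive1E; apply: derive_val. Qed.

Lemma ger0_derive_le f p q : p <= q -> {within `[p, q], continuous f} ->
  (forall s, p < s < q -> derivable f s 1 /\ 0 <= (derive1 f) s) -> f p <= f q.
Proof.
rewrite le_eqVlt => /predU1P[->//|pq] fc df.
have [|c + fE] := MVT pq _ fc (df := (derive1 f)).
  by move=> s; rewrite in_itv /= => /df[ds _]; exact: derivable_is_derive.
rewrite in_itv /= => /df[_ c0].
by rewrite -subr_ge0 fE mulr_ge0 // subr_ge0 ltW.
Qed.

(** The powers of |s| used below may fail to be differentiable at 0; the interval is split there. *)
Lemma ger0_derive_le_off0 f p q : p <= q -> {within `[p, q], continuous f} ->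
  (forall s, p < s < q -> s != 0 -> derivable f s 1 /\ 0 <= (derive1 f) s) -> f p <= f q.
Proof.
move=> pq fc df; have [/andP[p0 q0]|n0] := boolP (p < 0 < q).
  apply: (@le_trans _ _ (f 0)); apply: ger0_derive_le; try exact: ltW.
  - apply: continuous_subspaceW fc => x /=; rewrite !in_itv /= => /andP[-> x0].
    by rewrite (le_trans x0) // ltW.
  - move=> s /andP[ps s0]; apply: df; last by rewrite lt_eqF.
    by rewrite ps (lt_trans s0).
  - apply: continuous_subspaceW fc => x /=; rewrite !in_itv /= => /andP[x0 ->].
    by rewrite (le_trans (ltW p0)).
  - move=> s /andP[s0 sq]; apply: df; last by rewrite gt_eqF.
    by rewrite sq (lt_trans p0).
apply: ger0_derive_le => // s /[dup] psq /df; apply.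
by apply: contraNneq n0 => <-.
Qed.

(** Both [G - g] and [G + g] are nondecreasing. *)
Lemma derive_dominated_le g G p q : p <= q ->
  {within `[p, q], continuous g} -> {within `[p, q], continuous G} ->
  (forall s, p < s < q -> s != 0 ->
    [/\ derivable g s 1, derivable G s 1 & `|(derive1 g) s| <= (derive1 G) s]) ->
  `|g q - g p| <= G q - G p.
Proof.
move=> pq gc Gc H.
have h1 : (G - g) p <= (G - g) q.
  apply: ger0_derive_le_off0 => //.
    by move=> x; apply: cvgB; [exact: Gc|exact: gc].
  move=> s sI s0; have [dg dG] := H _ sI s0; rewrite ler_norml => /andP[_ h].
  have := is_deriveB (derivable_is_derive dG) (derivable_is_derive dg).
  by move=> d; split; [exact: ex_derive|rewrite (is_derive_derive1 d) subr_ge0].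
have h2 : (G + g) p <= (G + g) q.
  apply: ger0_derive_le_off0 => //.
    by move=> x; apply: cvgD; [exact: Gc|exact: gc].
  move=> s sI s0; have [dg dG] := H _ sI s0; rewrite ler_norml => /andP[h _].
  have := is_deriveD (derivable_is_derive dG) (derivable_is_derive dg).
  by move=> d; split; [exact: ex_derive|rewrite (is_derive_derive1 d); lra].
move: h1 h2; rewrite !fctE => h1 h2; rewrite ler_norml; apply/andP; split; lra.
Qed.

(* Cauchy-Schwarz for the integral of [g'] in the form of Young's inequality
   [2 |g'| <= e w g'^2 + W' / e], which only requires comparing derivatives. *)
Lemma young_derive_le g W w p q s t (e : R) : 0 < e -> p <= s -> s < t -> t <= q ->
  continuous w -> (forall x, 0 <= w x) ->
  continuous W -> (forall x, p < x < q -> x != 0 -> derivable W x 1 /\ 1 <= w x * (derive1 W) x) ->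
  (forall x, derivable g x 1) -> continuous (derive1 g) ->
  `|g t - g s| <= e / 2 * \int[mu]_(x in `[p, q]) (w x * (derive1 g) x ^+ 2)
    + (W q - W p) / (2 * e).
Proof.
move=> e0 ps st tq wc w0 Wc dW dg gc.
pose h x := w x * (derive1 g) x ^+ 2.
have hc : continuous h.
  move=> x; apply: cvgM; first exact: wc.
  apply: (@continuous_comp _ _ _ (derive1 g) (fun y => y ^+ 2)); first exact: gc.
  exact: exprn_continuous.
have h0 x : 0 <= h x by rewrite mulr_ge0 // sqr_ge0.
have hi a b : mu.-integrable `[a, b] (EFin \o h).
  apply: continuous_compact_integrable; first exact: segment_compact.
  exact: continuous_subspaceT.
pose I x := parameterized_integral mu p x h.
have pq : p < q by exact: le_lt_trans (lt_le_trans st tq).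
have Wnd a b : p <= a -> a <= b -> b <= q -> W a <= W b.
  move=> pa ab bq; apply: ger0_derive_le_off0 => //; first exact: continuous_subspaceT.
  move=> x /andP[ax xb] x0; have [|//|? H] := dW x.
    by rewrite (le_lt_trans pa ax) (lt_le_trans xb bq).
  split=> //; rewrite leNgt; apply/negP => W0.
  by have := mulr_ge0_le0 (w0 x) (ltW W0); rewrite leNgt (lt_le_trans ltr01).
pose G := (e / 2) \*: I + (2 * e)^-1 \*: W : R -> R.
have gs x : {for x, continuous g}.
  by apply: differentiable_continuous; exact/derivable1_diffP.
have Ic : {within `[p, q], continuous I}.
  by apply: parameterized_integral_continuous; [exact: ltW|exact: hi].
apply: (@le_trans _ _ (G t - G s)); last first.
  have GE x : G x = e / 2 * I x + (2 * e)^-1 * W x by [].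
  rewrite !GE.
  have It : I t <= \int[mu]_(x in `[p, q]) (w x * (derive1 g) x ^+ 2).
    have -> : I t = \int[mu]_(x in `[p, t]) h x by [].
    apply: fine_le; [exact: (integrable_fin_num _ (hi p t))|
      exact: (integrable_fin_num _ (hi p q))|].
    apply: ge0_subset_integral => //.
    - by have /integrableP[] := hi p q.
    - by move=> x _; rewrite lee_fin.
    - by move=> x /=; rewrite !in_itv /= => /andP[-> xt]; exact: le_trans tq.
  have Is : 0 <= I s.
    by apply: fine_ge0; apply: integral_ge0 => x _; rewrite lee_fin.
  have Wt := Wnd t q (ltW (le_lt_trans ps st)) tq (lexx _).
  have Ws := Wnd p s (lexx _) ps (ltW (lt_le_trans st tq)).
  have e2 : 0 < (2 * e)^-1 by rewrite invr_gt0 mulr_gt0.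
  have e3 : 0 < e / 2 by rewrite divr_gt0.
  have := ler_pM2l e3 (I t) (\int[mu]_(x in `[p, q]) (w x * (derive1 g) x ^+ 2)).
  rewrite It => h1.
  have h2 := mulr_ge0 (ltW e3) Is.
  have h3 : 0 <= (2 * e)^-1 * ((W q - W p) - (W t - W s)).
    by apply: mulr_ge0; [exact: ltW|lra].
  move: h1 h2 h3; rewrite [_ / (2 * e)]mulrC.
  by move: (I t) (I s) (\int[mu]_(_ in _) _) => It' Is' In'; move: (2 * e)^-1 => c; lra.
apply: derive_dominated_le; first exact: ltW.
- exact: continuous_subspaceT.
- move=> x; apply: cvgD; apply: cvgZl_tmp.
    apply: (continuous_subspaceW _ Ic) => y /=; rewrite !in_itv /= => /andP[sy yt].
    by rewrite (le_trans ps) // (le_trans yt).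
  by have := @continuous_subspaceT _ _ `[s, t]%classic W Wc x.
move=> x /andP[sx xt] x0.
have px : p < x by exact: le_lt_trans ps _.
have xq : x < q by exact: lt_le_trans tq.
have [dI I'] := @continuous_FTC1_closed _ h p x q xq (hi _ _) px (hc x).
have [|//|dWx H] := dW x; first by rewrite px.
have dI' := derivable_is_derive dI; rewrite I' in dI'.
have dG : is_derive x 1 G ((e / 2) *: h x + (2 * e)^-1 *: (derive1 W) x).
  by apply: is_deriveD; apply: is_deriveZ => //; exact: derivable_is_derive.
split; [exact: dg|exact: ex_derive|].
rewrite (is_derive_derive1 dG).
have wx : 0 < w x.
  by rewrite lt_neqAle w0 andbT; apply: contraTneq H => <-; rewrite mul0r -ltNge.
(* After multiplication by 2 e w, with u = e w |g'|, the claim reads 2 u <= u^2 + w W'. It follows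
   from (u - 1)^2 >= 0 and 1 <= w W'. *)
have -> : (e / 2) *: h x + (2 * e)^-1 *: (derive1 W) x =
  ((e * w x * (derive1 g) x) ^+ 2 + w x * (derive1 W) x) / (2 * e * w x).
  by rewrite /h -[_ *: _]/(_ * _) -[_ *: (derive1 W) x]/(_ * _); field; rewrite !gt_eqF.
rewrite ler_pdivlMr ?mulr_gt0 //.
have -> : `|derive1 g x| * (2 * e * w x) = 2 * (e * w x * `|derive1 g x|) by ring.
have -> : (e * w x * derive1 g x) ^+ 2 = (e * w x * `|derive1 g x|) ^+ 2.
  by rewrite -[LHS]ger0_norm ?sqr_ge0 // normrX !normrM (gtr0_norm e0) (gtr0_norm wx).
have := sqr_ge0 (e * w x * `|derive1 g x| - 1).
move: (e * w x * `|derive1 g x|) (w x * derive1 W x) H => u v; rewrite sqrrB; lra.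
Qed.

(** The choice e = A / D gives D <= (A X / D + D) / 2. For A = 0 that choice is not positive, and e
    = D / (X + 1) contradicts D > 0. *)
Lemma sqr_le_mul_of_young (D A X : R) : 0 <= D -> 0 <= A -> 0 <= X ->
  (forall e, 0 < e -> D <= e / 2 * X + A / (2 * e)) -> D ^+ 2 <= A * X.
Proof.
move=> D0 A0 X0 H.
have [->|Dn0] := eqVneq D 0; first by rewrite expr0n /= mulr_ge0.
have {Dn0}Dp : 0 < D by rewrite lt_neqAle eq_sym Dn0.
have [A00|An0] := eqVneq A 0.
  exfalso; have := H (D / (X + 1)) (divr_gt0 Dp (ltr_wpDl X0 ltr01)).
  rewrite A00 mul0r addr0.
  have X1 : 0 < X + 1 by exact: ltr_wpDl.
  have -> : D / (X + 1) / 2 * X = D * (X / (X + 1)) / 2 by field; rewrite gt_eqF.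
  have : X / (X + 1) <= 1 by rewrite ler_pdivrMr // mul1r lerDl.
  move=> h1 h2; have := ler_pM2l Dp (X / (X + 1)) 1; rewrite h1 => h3.
  lra.
have Ap : 0 < A by rewrite lt_neqAle eq_sym An0.
have := H (A / D) (divr_gt0 Ap Dp).
have -> : A / D / 2 * X + A / (2 * (A / D)) = (A * X / D + D) / 2.
  by field; rewrite !gt_eqF.
move=> h1; have : D <= A * X / D by lra.
by rewrite ler_pdivlMr // -expr2.
Qed.

(** [W] stands for a primitive of 1/w; asking only for 1 <= w W' leaves room for the two different
    choices made in [interval_weight]. *)
Lemma weighted_poincare1 g W w p q s t : p <= s <= q -> p <= t <= q ->
  continuous w -> (forall x, 0 <= w x) ->
  continuous W -> (forall x, p < x < q -> x != 0 -> derivable W x 1 /\ 1 <= w x * (derive1 W) x) ->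
  (forall x, derivable g x 1) -> continuous (derive1 g) ->
  (((g s - g t) ^+ 2)%:E <=
   (W q - W p)%:E * \int[mu]_(x in `[p, q]) (w x * (derive1 g) x ^+ 2)%:E)%E.
Proof.
wlog st : s t / s <= t.
  move=> H sI tI; have [st|/ltW ts] := leP s t; first exact: H.
  have -> : (g s - g t) ^+ 2 = (g t - g s) ^+ 2 by rewrite -sqrrN opprB.
  exact: H.
move=> /andP[ps _] /andP[_ tq] wc w0 Wc dW dg gc.
have hc : continuous (fun x => w x * (derive1 g) x ^+ 2).
  move=> x; apply: cvgM; first exact: wc.
  apply: (@continuous_comp _ _ _ (derive1 g) (fun y => y ^+ 2)); first exact: gc.
  exact: exprn_continuous.
have hi a b : mu.-integrable `[a, b] (EFin \o (fun x => w x * (derive1 g) x ^+ 2)).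
  apply: continuous_compact_integrable; first exact: segment_compact.
  exact: continuous_subspaceT.
have pq : p <= q by exact: le_trans (le_trans st tq).
have X0 : (0 <= \int[mu]_(x in `[p, q]) (w x * (derive1 g) x ^+ 2)%:E)%E.
  by apply: integral_ge0 => x _; rewrite lee_fin mulr_ge0 // sqr_ge0.
have A0 : 0 <= W q - W p.
  rewrite subr_ge0; apply: ger0_derive_le_off0 => //; first exact: continuous_subspaceT.
  move=> x xI x0; have [//|//|? H] := dW x.
  split=> //; rewrite leNgt; apply/negP => W0.
  by have := mulr_ge0_le0 (w0 x) (ltW W0); rewrite leNgt (lt_le_trans ltr01).
move: st; rewrite le_eqVlt => /predU1P[->|st].
  by rewrite subrr expr0n /= mule_ge0 // lee_fin.
rewrite -(fineK (integrable_fin_num _ (hi p q))) //= -EFinM lee_fin.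
have -> : (g s - g t) ^+ 2 = `|g t - g s| ^+ 2.
  by rewrite -normrX ger0_norm ?sqr_ge0 // -sqrrN opprB.
apply: sqr_le_mul_of_young => //; first exact: fine_ge0.
by move=> e e0; exact: young_derive_le.
Qed.

End onedim.

(** * C^1 functions of several variables *)

Section C1.
Variable R : realType.
Local Notation C1 := (@Defs.C1 R _).
Local Notation partial := (@Defs.partial R _).

Lemma consv_shift0 n (h t : R) (y : V R n) :
  h *: delta_mx ord0 ord0 + consv t y = consv (h + t) y.
Proof.
apply/rowP => i; rewrite [LHS]mxE.
case: (unliftP ord0 i) => [j|] ->.
  by rewrite !consvS !mxE eqxx /= mulr0 add0r.
by rewrite !consv0 !mxE !eqxx mulr1.
Qed.

Lemma consv_shiftS n (h t : R) (y : V R n) j :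
  h *: delta_mx ord0 (lift ord0 j) + consv t y = consv t (h *: delta_mx ord0 j + y).
Proof.
apply/rowP => i; rewrite [LHS]mxE.
case: (unliftP ord0 i) => [k|] ->.
  by rewrite !consvS !mxE eqxx /= (inj_eq lift_inj).
by rewrite !consv0 !mxE eqxx /= mulr0 add0r.
Qed.

Lemma derivable_slice0 n (f : V R n.+1 -> R) t y :
  derivable f (consv t y) (delta_mx ord0 ord0 : V R n.+1) =
  derivable (fun s => f (consv s y)) t (1 : R).
Proof.
rewrite /derivable; apply: (f_equal (fun F : R -> R => cvg (F @ 0^'))); apply/funext => h /=.
by rewrite consv_shift0 -[h *: 1]/(h * 1) mulr1.
Qed.

Lemma derive1_slice0 n (f : V R n.+1 -> R) t y :
  derive1 (fun s => f (consv s y)) t = partial ord0 f (consv t y).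
Proof.
rewrite derive1E /Defs.partial /derive; apply: (f_equal (fun F : R -> R => lim (F @ 0^')));
  apply/funext => h /=.
by rewrite consv_shift0 -[h *: 1]/(h * 1) mulr1.
Qed.

Lemma derivable_sliceS n (f : V R n.+1 -> R) t y j :
  derivable (fun z => f (consv t z)) y (delta_mx ord0 j : V R n) =
  derivable f (consv t y) (delta_mx ord0 (lift ord0 j) : V R n.+1).
Proof.
rewrite /derivable; apply: (f_equal (fun F : R -> R => cvg (F @ 0^'))); apply/funext => h /=.
by rewrite consv_shiftS.
Qed.

Lemma partial_sliceS n (f : V R n.+1 -> R) t y j :
  partial j (fun z => f (consv t z)) y = partial (lift ord0 j) f (consv t y).
Proof.
rewrite /Defs.partial /derive; apply: (f_equal (fun F : R -> R => lim (F @ 0^')));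
  apply/funext => h /=.
by rewrite consv_shiftS.
Qed.

Lemma continuous_slice n (T : topologicalType) (f : V R n.+1 -> T) t :
  continuous f -> continuous (fun z : V R n => f (consv t z)).
Proof.
move=> fc z; apply: (@continuous_comp _ _ _ (fun z => consv t z) f); last exact: fc.
apply: continuous_row => i; case: (unliftP ord0 i) => [j|] ->.
  by rewrite consvS; under eq_fun do rewrite consvS; exact: coord_continuous.
by rewrite consv0; under eq_fun do rewrite consv0; exact: cst_continuous.
Qed.

Lemma continuous_slice0 n (T : topologicalType) (f : V R n.+1 -> T) y :
  continuous f -> continuous (fun t : R => f (consv t y)).
Proof.
move=> fc z; apply: (@continuous_comp _ _ _ (fun z => consv z y) f); last exact: fc.
apply: continuous_row => i; case: (unliftP ord0 i) => [j|] ->.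
  by rewrite consvS; under eq_fun do rewrite consvS; exact: cvg_cst.
by rewrite consv0; under eq_fun do rewrite consv0; exact: cvg_id.
Qed.

Lemma continuous_tailv n : continuous (@tailv R n).
Proof.
move=> z; apply: continuous_row => i.
rewrite tailvE; under eq_fun do rewrite tailvE.
exact: coord_continuous.
Qed.

Lemma C1_slice n (f : V R n.+1 -> R) t : C1 f -> C1 (fun z => f (consv t z)).
Proof.
move=> fC j; split=> [y|]; first by rewrite derivable_sliceS; exact: (fC _).1.
rewrite (_ : partial j _ = fun y => partial (lift ord0 j) f (consv t y)).
  exact/continuous_slice/(fC _).2.
by apply/funext => y; rewrite partial_sliceS.
Qed.

Lemma C1_slice0 n (f : V R n.+1 -> R) y : C1 f ->
  (forall t, derivable (fun s => f (consv s y)) t (1 : R)) /\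
  continuous (derive1 (fun s => f (consv s y))).
Proof.
move=> fC; split=> [t|]; first by rewrite -derivable_slice0; exact: (fC _).1.
rewrite (_ : derive1 _ = fun t => partial ord0 f (consv t y)).
  exact/continuous_slice0/(fC _).2.
by apply/funext => t; rewrite derive1_slice0.
Qed.

Lemma derivable1_continuous (f : R -> R) : (forall t, derivable f t 1) -> continuous f.
Proof. by move=> df x; apply: differentiable_continuous; exact/derivable1_diffP. Qed.

Lemma derive1_bounded_lipschitz (f : R -> R) (K : R) s t :
  (forall x, derivable f x 1) ->
  (forall x, Num.min s t <= x <= Num.max s t -> `|derive1 f x| <= K) ->
  `|f s - f t| <= K * `|s - t|.
Proof.
move=> df; wlog st : s t / s <= t.
  move=> H; have [st|ts] := orP (le_total s t); first exact: H.
  by rewrite minC maxC distrC (distrC s) => ?; exact: H.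
move=> fK; rewrite distrC (distrC s).
have [||c] := @MVT_segment R f (derive1 f) s t st.
- by move=> x _; exact: derivable_is_derive.
- by apply: continuous_subspaceT; exact: derivable1_continuous.
rewrite in_itv /= => cst ->; rewrite normrM ler_wpM2r //.
by apply: fK; rewrite (min_idPl st) (max_idPr st).
Qed.

(** [C1] speaks only of partial derivatives. By induction the slice through z0 is continuous, and
    changing the first coordinate costs at most M |t0 - t|, since the first partial derivative is
    bounded by M near z0. *)
Lemma C1_continuous n (f : 'rV[R]_n -> R) : C1 f -> continuous f.
Proof.
elim: n f => [|n IHn] f fC.
  move=> z0; have : f = cst (f z0) by apply/funext => z; congr f; apply/rowP => -[].
  by move: (f z0) => c ->; exact: cst_continuous.
suff H (z0 : 'rV[R]_n.+1) : f @ z0 --> f z0 by exact: H.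
set t0 := z0 ord0 ord0; set y0 := tailv z0.
have z0E : z0 = consv t0 y0 by rewrite consvK.
have FF := @nbhs_filter _ z0.
apply/cvgrPdist_lt => e e0.
have e2 : 0 < e / 2 by rewrite divr_gt0.
pose M := `|partial ord0 f z0| + 1.
have M0 : 0 < M by rewrite ltr_wpDl.
have hy : \forall z \near z0, `|f z0 - f (consv t0 (tailv z))| < e / 2.
  have := @continuous_comp _ _ _ (@tailv R n) (fun y => f (consv t0 y)) z0
    (@continuous_tailv n z0) (IHn _ (C1_slice t0 fC) _).
  move=> /cvgrPdist_lt /(_ _ e2); apply: filterS => z.
  by rewrite /comp /= -z0E.
have : \forall z \near z0, `|partial ord0 f z| < M.
  have /cvgrPdist_lt /(_ _ ltr01) := (fC ord0).2 z0.
  apply: filterS => z H; rewrite /M.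
  have := ler_normD (partial ord0 f z - partial ord0 f z0) (partial ord0 f z0).
  by rewrite subrK distrC => /le_lt_trans -> //; rewrite addrC ltrD2l.
move=> /nbhs_ballP[d /= d0 dM].
have eM : 0 < e / 2 / M by rewrite divr_gt0.
have ht : \forall z \near z0, `|t0 - (z : 'rV[R]_n.+1) ord0 ord0| < e / 2 / M.
  by have /cvgrPdist_lt /(_ _ eM) := @coord_continuous R 1 n.+1 ord0 ord0 z0.
near=> z.
have zb : ball z0 d z.
  near: z.  exact: (nbhsx_ballx z0 d d0).
have zt : `|t0 - z ord0 ord0| < e / 2 / M.
  by near: z; exact: ht.
have zy : `|f z0 - f (consv t0 (tailv z))| < e / 2 by near: z; exact: hy.
set t := z ord0 ord0 in zt.
have -> : z = consv t (tailv z) by rewrite consvK.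
rewrite -(subrKA (f (consv t0 (tailv z)))) (le_lt_trans (ler_normD _ _)) //.
rewrite (splitr e) ltr_leD //.
have [dg _] := C1_slice0 (tailv z) fC.
apply: (@le_trans _ _ (M * `|t0 - t|)).
  (* Balls of row vectors are cubes, so the horizontal segment from the slice t0 to z stays in the
     ball where the bound M holds. *)
  apply: (derive1_bounded_lipschitz dg) => c cI; rewrite derive1_slice0.
  apply/ltW/dM; split=> // i j; rewrite ord1; case: (unliftP ord0 j) => [k|] ->.
    by rewrite consvS tailvE; exact: zb.2.
  rewrite consv0; have : ball (z0 ord0 ord0) d t by exact: zb.2.
  rewrite /ball /= -/t0; apply: le_lt_trans.
  move: cI; have [tt|tt] := leP t0 t => /andP[c1 c2].
    rewrite ler_distlC; apply/andP; split.
      by rewrite (le_trans _ c1) // gerBl.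
    by rewrite (le_trans c2) // distrC ger0_norm ?subr_ge0 // addrC subrK.
  rewrite ler_distlC; apply/andP; split.
    by rewrite (le_trans _ c1) // gtr0_norm ?subr_gt0 // opprB addrC subrK.
  by rewrite (le_trans c2) // lerDl.
by rewrite mulrC -ler_pdivlMr // ltW.
Unshelve. all: by end_near. Qed.

(** Coordinates are moved one at a time, which is why the l^1 distance appears. *)
Lemma C1_lipschitz n (f : V R n -> R) (K : R) x y : C1 f ->
  (forall i z, `|partial i f z| <= K) ->
  `|f x - f y| <= K * \sum_i `|x ord0 i - y ord0 i|.
Proof.
elim: n f x y => [|n IHn] f x y fC fK.
  have -> : x = y by apply/rowP => -[].
  by rewrite subrr normr0 big_ord0 mulr0.
rewrite -(consvK x) -(consvK y).
set s := x ord0 ord0; set t := y ord0 ord0.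
rewrite -(subrKA (f (consv t (tailv x)))) (le_trans (ler_normD _ _)) //.
rewrite big_ord_recl mulrDr !consv0 lerD //.
  apply: derive1_bounded_lipschitz (C1_slice0 _ fC).1 _ => c _.
  by rewrite derive1_slice0.
under eq_bigr do rewrite !consvS.
apply: (IHn (fun z => f (consv t z))); first exact: C1_slice.
by move=> i z; rewrite partial_sliceS.
Qed.

End C1.

(** * Slabs and tensorisation *)

Section tensor.
Variable R : realType.
Local Notation mu := (@lebesgue_measure R).
Local Notation nu := (@nu R).
Local Notation C1 := (@Defs.C1 R _).
Local Notation partial := (@Defs.partial R _).

Local Open Scope ereal_scope.

(** Otherwise [H] exceeds its mean c at every point, so H - c is positive with integral 0, hence
    zero almost everywhere on an interval of positive length. *)
Lemma exists_le_mean (g0 g1 : R) (H : R -> \bar R) : (g0 < g1)%R ->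
  measurable_fun `[g0, g1] H -> (forall t, 0 <= H t) ->
  exists2 t, (g0 <= t <= g1)%R &
    (g1 - g0)%:E * H t <= \int[mu]_(s in `[g0, g1]) H s.
Proof.
move=> g01 mH H0; set X := \int[mu]_(s in _) _.
have L0 : (0 < g1 - g0)%R by rewrite subr_gt0.
have X0 : 0 <= X by exact: integral_ge0.
apply: contrapT => /forall2NP nH.
have {}nH t : (g0 <= t <= g1)%R -> X < (g1 - g0)%:E * H t.
  by move=> tI; have [//|/negP] := nH t; rewrite -ltNge.
have muG : mu `[g0, g1] = (g1 - g0)%:E.
  by rewrite lebesgue_measure_itv /= lte_fin g01 -EFinD.
have Xfin : X \is a fin_num.
  rewrite ge0_fin_numE //; apply: lt_le_trans (leey _); apply: (nH g0).
  by rewrite lexx ltW.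
have cE : exists2 c : R, (0 <= c)%R & X = (g1 - g0)%:E * c%:E.
  exists (fine X / (g1 - g0))%R; first by rewrite divr_ge0 ?fine_ge0 // ltW.
  by rewrite -EFinM mulrC divfK ?gt_eqF // fineK.
case: cE => c c0 XE.
have Hc t : (g0 <= t <= g1)%R -> c%:E < H t.
  by move=> /nH; rewrite XE lte_pmul2l // lte_fin.
pose f t := H t - c%:E.
have mf : measurable_fun `[g0, g1] f by exact: emeasurable_funB.
have f0 t : `[g0, g1]%classic t -> 0 < f t.
  by rewrite /= in_itv /= => /Hc; rewrite sube_gt0.
have If : \int[mu]_(t in `[g0, g1]) `|f t| = 0.
  have -> : \int[mu]_(t in `[g0, g1]) `|f t| = \int[mu]_(t in `[g0, g1]) f t.
    by apply: eq_integral => t; rewrite inE => tG; rewrite gee0_abs // ltW // f0.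
  have : X = \int[mu]_(t in `[g0, g1]) f t + X.
    rewrite {2}XE [in RHS]muleC -[in RHS]muG -integral_cst // -ge0_integralD //.
    - apply: eq_integral => t _; by rewrite /f subeK.
    - by move=> t /f0 /ltW.
  by move=> XE'; rewrite -[LHS](addeK _ Xfin) -XE' subee.
have [/(_ If) [N [mN N0 GN]] _] := ae_eq_integral_abs mu (measurable_itv `[g0, g1]) mf.
have : mu `[g0, g1] <= mu N.
  apply: (@le_measure _ _ _ mu); rewrite ?inE //.
  move=> t tG; apply: GN => /= /(_ tG) ft0.
  by have := f0 _ tG; rewrite ft0 ltxx.
by rewrite N0 muG lee_fin leNgt L0.
Qed.

Definition slab n (p q : R) (J : set (V R n)) : set (V R n.+1) :=
  [set z : V R n.+1 | (p <= z ord0 ord0 <= q)%R /\ J (tailv z)].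

Lemma measurable_tailv n : measurable_fun setT (@tailv R n : Bo R n.+1 -> Bo R n).
Proof.
apply: (@measurability _ _ _ (Bo R n) setT _ [set A : set (V R n) | open A] erefl).
move=> _ [U oU <-]; rewrite setTI; apply: open_measurable_Bo.
by apply: (open_comp _ oU) => z _; exact: continuous_tailv.
Qed.

Lemma measurable_slab n p q (J : set (V R n)) : measurable (J : set (Bo R n)) ->
  measurable (slab p q J : set (Bo R n.+1)).
Proof.
move=> mJ; apply: (@measurableI _ (Bo R n.+1)
    [set z : V R n.+1 | (p <= z ord0 ord0 <= q)%R] (@tailv R n @^-1` J)); last first.
  by rewrite -[X in measurable X]setTI; exact: measurable_tailv.
apply: closed_measurable_Bo.
apply: (@preimage_closed _ _ (fun z : V R n.+1 => z ord0 ord0) `[p, q]%classic).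
  by move=> z _; exact: coord_continuous.
exact: itv_closed.
Qed.

Lemma patch_slab n p q (J : set (V R n)) (F : V R n.+1 -> \bar R) t y :
  (F \_ (slab p q J)) (consv t y) =
  ((fun s => ((fun z => F (consv s z)) \_ J) y) \_ `[p, q]) t.
Proof.
rewrite !patchE /=; have -> : (consv t y \in slab p q J) = (t \in `[p, q]%classic) && (y \in J).
  apply/idP/andP; rewrite !inE /slab /= consv0 tailv_consv in_itv /=.
    by move=> [].
  by move=> [].
by case: (t \in _); case: (y \in _).
Qed.

Section measurable_integrand.
Variables (n : nat) (p q : R) (J : set (V R n)) (F : V R n.+1 -> \bar R).
Hypothesis mJ : measurable (J : set (Bo R n)).
Hypothesis mF : measurable_fun setT (F : Bo R n.+1 -> \bar R).
Hypothesis F0 : forall z, 0 <= F z.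

Let mP : measurable_fun setT (F \_ (slab p q J) : Bo R n.+1 -> \bar R).
Proof.
by apply: (measurable_restrictT _ _).1; [exact: measurable_slab|exact: measurable_funTS].
Qed.

Let P0 z : 0 <= (F \_ (slab p q J)) z.
Proof. exact: erestrict_ge0. Qed.

Lemma integral_slab : \int[nu n.+1]_(z in slab p q J) F z =
  \int[mu]_(t in `[p, q]) \int[nu n]_(y in J) F (consv t y).
Proof.
rewrite integral_mkcond (nu_fubini mP P0) [in RHS]integral_mkcond.
apply: eq_integral => t _.
under eq_integral do rewrite patch_slab.
rewrite [RHS]patchE; case: ifPn => tI.
  rewrite [RHS]integral_mkcond; apply: eq_integral => y _.
  by rewrite patchE tI.
by rewrite integral0_eq // => y _; rewrite patchE (negbTE tI).
Qed.

Lemma measurable_slice_integral :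
  measurable_fun setT (fun t => \int[nu n]_(y in J) F (consv t y)).
Proof.
have -> : (fun t => \int[nu n]_(y in J) F (consv t y)) =
  (fun t => \int[nu n]_y (F \_ ([set z : V R n.+1 | J (tailv z)])) (consv t y)).
  apply/funext => t; rewrite integral_mkcond; apply: eq_integral => y _.
  rewrite !patchE; congr (if _ then _ else _); apply/idP/idP; rewrite !inE /= tailv_consv //.
apply: (@measurable_nu_slice R n (F \_ ([set z : V R n.+1 | J (tailv z)]))).
  apply: (measurable_restrictT _ _).1; last exact: measurable_funTS.
  by rewrite -[X in measurable X]setTI; exact: measurable_tailv.
exact: erestrict_ge0.
Qed.

(** This order of integration suits the horizontal energy, controlled on each line by the
    one-dimensional inequality; [integral_slab] is the order for slices. *)
Lemma integral_slab_swap : \int[nu n.+1]_(z in slab p q J) F z =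
  \int[nu n]_(y in J) \int[mu]_(t in `[p, q]) F (consv t y).
Proof.
rewrite integral_mkcond (nu_fubini mP P0).
rewrite (fubini_tonelli (m1 := mu) (m2 := nu n) _
  (measurableT_comp mP (@measurable_consv R n)) (fun u => P0 (consv u.1 u.2))).
rewrite [in RHS]integral_mkcond; apply: eq_integral => y _ /=.
under eq_integral do rewrite patch_slab.
rewrite [RHS]patchE; case: ifPn => yJ.
  rewrite [RHS]integral_mkcond; apply: eq_integral => t _.
  by rewrite !patchE yJ.
by rewrite integral0_eq // => t _; rewrite !patchE (negbTE yJ); case: ifP.
Qed.

Lemma measurable_swap_integral :
  measurable_fun setT (fun y : Bo R n => \int[mu]_(t in `[p, q]) F (consv t y)).
Proof.
have -> : (fun y => \int[mu]_(t in `[p, q]) F (consv t y)) =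
  (fun y => \int[mu]_t (F \_ (slab p q setT)) (consv t y)).
  apply/funext => y; rewrite integral_mkcond; apply: eq_integral => t _.
  by rewrite patch_slab !patchE in_setT.
apply: (@measurable_fun_fubini_tonelli_G _ _ _ _ _ mu
  (fun u : R * Bo R n => (F \_ (slab p q setT)) (consv u.1 u.2))).
  apply: (measurableT_comp _ (@measurable_consv R n)).
  by apply: (measurable_restrictT _ _).1; [exact: measurable_slab|exact: measurable_funTS].
by move=> u; exact: erestrict_ge0.
Qed.

End measurable_integrand.

End tensor.

(** * The tensorised inequality and its unweighted case on cubes *)

Section tensor_poincare.
Variable R : realType.
Local Notation mu := (@lebesgue_measure R).
Local Notation nu := (@nu R).
Local Notation C1 := (@Defs.C1 R _).
Local Notation partial := (@Defs.partial R _).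

Local Open Scope ereal_scope.

Definition grad2 n (f : V R n -> R) y : R := (\sum_(j < n) partial j f y ^+ 2)%R.

Lemma grad2_ge0 n (f : V R n -> R) y : (0 <= grad2 f y)%R.
Proof. by apply: sumr_ge0 => j _; exact: sqr_ge0. Qed.

Lemma continuous_sqr (T : topologicalType) (f : T -> R) :
  continuous f -> continuous (fun x => f x ^+ 2)%R.
Proof.
move=> fc x; apply: (@continuous_comp _ _ _ f (fun y => y ^+ 2)%R); first exact: fc.
exact: exprn_continuous.
Qed.

Lemma continuous_sum (T : topologicalType) n (f : 'I_n -> T -> R) :
  (forall i, continuous (f i)) -> continuous (fun x => \sum_(i < n) f i x)%R.
Proof.
move=> fc; elim: n f fc => [|n IHn] f fc.
  rewrite (_ : (fun x => _) = cst 0%R); first by move=> x; exact: cst_continuous.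
  by apply/funext => x; rewrite big_ord0.
rewrite (_ : (fun x => _) = (fun x => f ord0 x + \sum_(i < n) f (lift ord0 i) x)%R).
  by move=> x; apply: cvgD; [exact: fc|exact: (IHn (fun i => f (lift ord0 i)))].
by apply/funext => x; rewrite big_ord_recl.
Qed.

Lemma continuous_sqr_sub (T : topologicalType) (f : T -> R) c :
  continuous f -> continuous (fun x => (f x - c) ^+ 2)%R.
Proof.
move=> fc; apply: continuous_sqr => x; apply: cvgB; first exact: fc.
exact: cst_continuous.
Qed.

Lemma continuous_mul (T : topologicalType) (f g : T -> R) :
  continuous f -> continuous g -> continuous (fun x => f x * g x)%R.
Proof. by move=> fc gc x; apply: cvgM; [exact: fc|exact: gc]. Qed.

Lemma continuous_coord0 n (w : R -> R) :
  continuous w -> continuous (fun z : V R n.+1 => w (z ord0 ord0)).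
Proof.
move=> wc z; move: (@coord_continuous R 1 n.+1 ord0 ord0 z) (wc (z ord0 ord0)).
exact: cvg_comp.
Qed.

Lemma measurable_EFin_continuous n (f : V R n -> R) : continuous f ->
  measurable_fun setT (EFin \o f : Bo R n -> \bar R).
Proof. by move=> fc; apply/measurable_EFinP; exact: continuous_measurable_Bo. Qed.

(* [t] in [[g0, g1]] is chosen so that the vertical energy of its slice is at most the mean;
   [c] is the constant of that slice. *)
Lemma tensor_poincare n (J : set (V R n)) (p q g0 g1 B : R) (W w : R -> R) f :
  measurable (J : set (Bo R n)) ->
  (p <= g0)%R -> (g0 < g1)%R -> (g1 <= q)%R -> (0 <= B)%R ->
  continuous w -> (forall x, 0 <= w x)%R -> continuous W ->
  (forall x, (p < x < q)%R -> x != 0%R -> derivable W x 1 /\ (1 <= w x * derive1 W x)%R) ->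
  C1 f ->
  (forall f' : V R n -> R, C1 f' -> exists c, \int[nu n]_(y in J) ((f' y - c) ^+ 2)%:E <=
     B%:E * \int[nu n]_(y in J) (grad2 f' y)%:E) ->
  exists c, \int[nu n.+1]_(z in slab p q J) ((f z - c) ^+ 2)%:E <=
    (2 * (W q - W p) * (q - p))%:E *
      \int[nu n.+1]_(z in slab p q J) (w (z ord0 ord0) * partial ord0 f z ^+ 2)%:E +
    (2 * B * (q - p) / (g1 - g0))%:E *
      \int[nu n.+1]_(z in slab g0 g1 J) (\sum_(j < n) partial (lift ord0 j) f z ^+ 2)%:E.
Proof.
move=> mJ pg0 g01 g1q B0 wc w0 Wc dW fC HP.
have pq : (p < q)%R by exact: le_lt_trans (lt_le_trans g01 g1q).
have A0 : (0 <= W q - W p)%R.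
  rewrite subr_ge0; apply: (ger0_derive_le_off0 (ltW pq)); first exact: continuous_subspaceT.
  move=> x xI x0; have [//|//|? H] := dW x.
  split=> //; rewrite leNgt; apply/negP => W0.
  by have := mulr_ge0_le0 (w0 x) (ltW W0); rewrite leNgt (lt_le_trans ltr01).
pose F1 (z : V R n.+1) : \bar R := (w (z ord0 ord0) * partial ord0 f z ^+ 2)%:E.
pose F2 (z : V R n.+1) : \bar R := (\sum_(j < n) partial (lift ord0 j) f z ^+ 2)%:E.
have F10 z : 0 <= F1 z by rewrite lee_fin mulr_ge0 ?sqr_ge0.
have F20 z : 0 <= F2 z by rewrite lee_fin sumr_ge0 // => j _; exact: sqr_ge0.
have mF1 : measurable_fun setT (F1 : Bo R n.+1 -> \bar R).
  apply: measurable_EFin_continuous; apply: continuous_mul.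
    exact: continuous_coord0.
  by apply: continuous_sqr; exact: (fC _).2.
have mF2 : measurable_fun setT (F2 : Bo R n.+1 -> \bar R).
  apply: measurable_EFin_continuous; apply: continuous_sum => j.
  by apply: continuous_sqr; exact: (fC _).2.
pose H t := \int[nu n]_(y in J) F2 (consv t y).
have H0 t : 0 <= H t by exact: integral_ge0.
have [|t tG Ht] := exists_le_mean g01 _ H0.
  by apply: measurable_funTS; exact: measurable_slice_integral.
rewrite -/(F2 _) in Ht.
have tI : (p <= t <= q)%R.
  by case/andP: tG => t0 t1; rewrite (le_trans pg0) // (le_trans t1).
have [c Hc] := HP _ (C1_slice t fC).
exists c.
pose Phi y := \int[mu]_(s in `[p, q]) F1 (consv s y).
have Phi0 y : 0 <= Phi y by exact: integral_ge0.
have mPhi : measurable_fun (J : set (Bo R n)) (Phi : Bo R n -> \bar R).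
  by apply: measurable_funTS; exact: measurable_swap_integral.
pose f2 y : \bar R := ((f (consv t y) - c) ^+ 2)%:E.
have mf2 : measurable_fun (J : set (Bo R n)) (f2 : Bo R n -> \bar R).
  apply: measurable_funTS; apply: measurable_EFin_continuous.
  by apply: continuous_sqr_sub; exact: C1_continuous (C1_slice t fC).
have f20 y : 0 <= f2 y by rewrite lee_fin sqr_ge0.
(* [K] bounds the squared deviation from c on every slice, independently of s. The factors 2 come
   from (u - c)^2 <= 2 (u - v)^2 + 2 (v - c)^2, where v is the value on the slice t. *)
pose K := (2 * (W q - W p))%:E * (\int[nu n]_(y in J) Phi y) + 2%:E * \int[nu n]_(y in J) f2 y.
have slice s : (p <= s <= q)%R ->
    \int[nu n]_(y in J) ((f (consv s y) - c) ^+ 2)%:E <= K.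
  move=> sI.
  have A20 : (0 <= 2 * (W q - W p))%R by rewrite mulr_ge0.
  apply: (@le_trans _ _ (\int[nu n]_(y in J) ((2 * (W q - W p))%:E * Phi y + 2%:E * f2 y))).
    apply: ge0_le_integral => //.
    - by move=> y _; rewrite lee_fin sqr_ge0.
    - apply: measurable_funTS; apply: measurable_EFin_continuous.
      by apply: continuous_sqr_sub; exact: C1_continuous (C1_slice s fC).
    - by apply: emeasurable_funD; apply: measurable_funeM.
    move=> y _.
    have [dg gc] := C1_slice0 y fC.
    have := weighted_poincare1 sI tI wc w0 Wc dW dg gc.
    rewrite (_ : \int[mu]_(x in _) _ = Phi y); last first.
      by apply: eq_integral => x _; rewrite derive1_slice0 /F1 consv0.
    move=> h.
    apply: (@le_trans _ _ (2%:E * ((f (consv s y) - f (consv t y)) ^+ 2)%:E + 2%:E * f2 y)).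
      rewrite /f2 -!EFinM -EFinD lee_fin.
      have := sqr_ge0 ((f (consv s y) - f (consv t y)) - (f (consv t y) - c))%R.
      move: (f (consv s y)) (f (consv t y)) => u v; nra.
    rewrite leeD2r // [(2 * (W q - W p))%:E]EFinM -muleA lee_pmul2l //.
  rewrite ge0_integralD //; first last.
  - by apply: measurable_funeM.
  - by move=> y _; rewrite mule_ge0.
  - by apply: measurable_funeM.
  - by move=> y _; rewrite mule_ge0.
  by rewrite !ge0_integralZl // /K.
have KE : K <= (2 * (W q - W p))%:E * \int[nu n.+1]_(z in slab p q J) F1 z
    + (2 * B / (g1 - g0))%:E * \int[nu n.+1]_(z in slab g0 g1 J) F2 z.
  rewrite /K leeD //.
    by rewrite (integral_slab_swap p q mJ mF1 F10).
  rewrite (integral_slab g0 g1 mJ mF2 F20) -/H.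
  have L0 : (0 < g1 - g0)%R by rewrite subr_gt0.
  apply: (@le_trans _ _ (2%:E * (B%:E * H t))).
    have HE : H t = \int[nu n]_(y in J) (grad2 (fun z => f (consv t z)) y)%:E.
      apply: eq_integral => y _; rewrite /grad2 /F2; congr EFin.
      by apply: eq_bigr => j _; rewrite partial_sliceS.
    by rewrite HE; apply: lee_wpmul2l.
  have -> : 2%:E * (B%:E * H t) = (2 * B / (g1 - g0))%:E * ((g1 - g0)%:E * H t).
    by rewrite !muleA -!EFinM divfK // gt_eqF.
  by apply: lee_wpmul2l => //; rewrite lee_fin divr_ge0 ?mulr_ge0 // ltW.
have mS : measurable_fun setT ((fun z => ((f z - c) ^+ 2)%:E) : Bo R n.+1 -> \bar R).
  apply: measurable_EFin_continuous.
  by apply: continuous_sqr_sub; exact: C1_continuous fC.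
have S0 z : 0 <= ((f z - c) ^+ 2)%:E by rewrite lee_fin sqr_ge0.
rewrite (integral_slab p q mJ mS S0).
have K0 : 0 <= K.
  by rewrite /K adde_ge0 // mule_ge0 ?integral_ge0 // lee_fin mulr_ge0.
apply: (@le_trans _ _ (\int[mu]_(s in `[p, q]) cst K s)).
  apply: ge0_le_integral => //.
  - by move=> s _; exact: integral_ge0.
  - exact: (measurable_funTS (measurable_slice_integral mJ mS S0)).
rewrite integral_cst //= lebesgue_measure_itv /= lte_fin pq -EFinD.
apply: (@le_trans _ _ (((2 * (W q - W p))%:E * \int[nu n.+1]_(z in slab p q J) F1 z
    + (2 * B / (g1 - g0))%:E * \int[nu n.+1]_(z in slab g0 g1 J) F2 z) * (q - p)%:E)).
  by apply: lee_wpmul2r => //; rewrite lee_fin subr_ge0 ltW.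
rewrite le_eqVlt; apply/orP; left; apply/eqP.
have I1 : 0 <= \int[nu n.+1]_(z in slab p q J) F1 z by exact: integral_ge0.
have I2 : 0 <= \int[nu n.+1]_(z in slab g0 g1 J) F2 z by exact: integral_ge0.
rewrite ge0_muleDl; last 2 first.
- by rewrite mule_ge0 // lee_fin mulr_ge0.
- by rewrite mule_ge0 // lee_fin divr_ge0 ?mulr_ge0 // subr_ge0 ltW.
congr (_ + _); rewrite muleAC -EFinM //.
by congr (_%:E * _); rewrite mulrAC.
Qed.

Definition cube n (z : V R n) (L : R) : set (V R n) :=
  [set y | forall i, (z ord0 i - L <= y ord0 i <= z ord0 i + L)%R].

Lemma cubeS n (z : V R n.+1) L :
  cube z L = slab (z ord0 ord0 - L) (z ord0 ord0 + L) (cube (tailv z) L).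
Proof.
apply/seteqP; split=> [y H|y [H0 HS] i].
  by split=> [|i]; rewrite ?tailvE; exact: H.
case: (unliftP ord0 i) => [j|] -> //.
by have := HS j; rewrite !tailvE.
Qed.

Lemma measurable_cube n (z : V R n) L : measurable (cube z L : set (Bo R n)).
Proof.
elim: n z => [|n IHn] z; last by rewrite cubeS; exact: measurable_slab.
by rewrite (_ : cube z L = setT) //; apply/seteqP; split=> // y _ [].
Qed.

(** Induction through [tensor_poincare] with w = 1, W = id and averaging over the whole side. Each
    dimension doubles the previous constant, and the new coordinate contributes 2 (2 L)^2 = 8
    L^2. *)
Lemma cube_poincare n (z : V R n) L f : (0 < L)%R -> C1 f ->
  exists c, \int[nu n]_(y in cube z L) ((f y - c) ^+ 2)%:E <=
    (8 * 2 ^+ n * L ^+ 2)%:E * \int[nu n]_(y in cube z L) (grad2 f y)%:E.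
Proof.
move=> L0; elim: n z f => [|n IHn] z f fC.
  exists (f 0%R); rewrite integral0_eq.
    apply: mule_ge0.
      by rewrite lee_fin; apply: mulr_ge0; [apply: mulr_ge0 => //; exact: exprn_ge0|exact: sqr_ge0].
    by apply: integral_ge0 => y _; rewrite lee_fin grad2_ge0.
  by move=> y _; rewrite (_ : y = 0%R) ?subrr ?expr0n //; apply/rowP => -[].
have C0 : (0 <= 8 * 2 ^+ n * L ^+ 2 :> R)%R.
  by apply: mulr_ge0; [apply: mulr_ge0 => //; exact: exprn_ge0|exact: sqr_ge0].
set p := (z ord0 ord0 - L)%R; set q := (z ord0 ord0 + L)%R.
have pq : (p < q)%R by rewrite /p /q; lra.
have wc : continuous (fun _ : R => 1%R : R) by move=> x; exact: cst_continuous.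
have Wc : continuous (@id R) by move=> x; exact: cvg_id.
have dW x : (p < x < q)%R -> x != 0%R ->
    derivable (@id R) x 1 /\ (1 <= 1 * derive1 (@id R) x)%R.
  by move=> _ _; split; [exact: derivable_id|rewrite derive1E derive_id mul1r].
have [c] := tensor_poincare (measurable_cube (tailv z) L) (lexx p) pq (lexx q) C0
  wc (fun=> ler01) Wc dW fC (IHn _).
rewrite -cubeS => h; exists c; apply: (le_trans h).
rewrite mulfK; last by rewrite gt_eqF ?subr_gt0.
have -> : (2 * (q - p) * (q - p) = 8 * L ^+ 2)%R by rewrite /p /q; ring.
set I1 := \int[_]_(_ in _) _; set I2 := \int[_]_(_ in _) _.
have -> : \int[nu n.+1]_(y in cube z L) (grad2 f y)%:E = I1 + I2.
  rewrite /I1 /I2 -ge0_integralD //; first last.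
  - apply: measurable_funTS; apply: measurable_EFin_continuous; apply: continuous_sum => j.
    by apply: continuous_sqr; exact: (fC _).2.
  - by move=> y _; rewrite lee_fin sumr_ge0 // => j _; exact: sqr_ge0.
  - apply: measurable_funTS; apply: measurable_EFin_continuous.
    rewrite (_ : (fun _ => _) = (fun y => partial ord0 f y ^+ 2)%R).
      by apply: continuous_sqr; exact: (fC _).2.
    by apply/funext => y; rewrite mul1r.
  - by move=> y _; rewrite lee_fin mul1r sqr_ge0.
  - exact: measurable_cube.
  by apply: eq_integral => y _; rewrite /grad2 big_ord_recl -EFinD mul1r.
have I10 : 0 <= I1 by apply: integral_ge0 => y _; rewrite lee_fin mul1r sqr_ge0.
have I20 : 0 <= I2 by apply: integral_ge0 => y _; rewrite lee_fin sumr_ge0 // => j _;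
  exact: sqr_ge0.
clearbody I1 I2; rewrite ge0_muleDr //; apply: leeD; apply: lee_wpmul2r => //; rewrite lee_fin.
  apply: ler_wpM2r; first exact: sqr_ge0.
  by rewrite ler_pMr // exprn_ege1 // ler1n.
by rewrite !mulrA (mulrC 2%R) -(mulrA _ 2%R) -exprS.
Qed.

End tensor_poincare.

(** * Power weights and the regularised coordinate *)

Section power_weights.
Variable R : realType.
Local Notation bipow := (@Defs.bipow R).

(** In this product form, monotonicity, doubling and continuity can be checked factor by factor,
    without comparing the two sides of 1. *)
Lemma bipow_min_max (a al al' : R) :
  bipow a al al' = Num.min a 1 `^ al * Num.max a 1 `^ al'.
Proof.
rewrite /Defs.bipow; case: leP => a1; rewrite ?powR1 ?mul1r ?mulr1 //.
Qed.

Lemma powR_le (r x y : R) : 0 <= r -> 0 <= x -> x <= y -> x `^ r <= y `^ r.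
Proof. by move=> r0 x0 xy; apply: ge0_ler_powR => //; rewrite nnegrE // (le_trans x0). Qed.

Lemma powR_sqr (x r : R) : 0 <= x -> (x ^+ 2) `^ (r / 2) = x `^ r.
Proof.
move=> x0; rewrite -powR_mulrn // -powRrM.
by congr (_ `^ _); rewrite mulrCA divff ?mulr1 // pnatr_eq0.
Qed.

Lemma powR2 (x r : R) : x `^ (2 * r) = (x `^ r) ^+ 2.
Proof. by rewrite mulrC powRrM powR_mulrn // powR_ge0. Qed.

Lemma derivable1_cvg (f : R -> R) (x : R) : derivable f x 1 -> f @ x --> f x.
Proof. by move=> /derivable1_diffP/differentiable_continuous; apply. Qed.

Lemma continuous_pt_comp (T : topologicalType) (f : T -> R) (g : R -> R) (x : T) :
  f @ x --> f x -> g @ f x --> g (f x) -> (fun t => g (f t)) @ x --> g (f x).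
Proof. exact: cvg_comp. Qed.

Lemma continuous_powR_pos (r x : R) : 0 < x -> (fun t : R => t `^ r) @ x --> x `^ r.
Proof.
move=> x0; apply: derivable1_cvg.
by apply: derivable_powR; rewrite in_itv /= x0.
Qed.

Lemma continuous_norm_powR (r : R) : 0 <= r -> continuous (fun s : R => `|s| `^ r).
Proof.
rewrite le_eqVlt => /predU1P[<-|r0].
  rewrite (_ : (fun s => _) = cst 1); first by move=> s; exact: cst_continuous.
  by apply/funext => s; rewrite powRr0.
move=> s.
have [->|s0] := eqVneq s 0; last first.
  apply: (@continuous_pt_comp _ (fun s : R => `|s|) (fun t => t `^ r)).
    exact: norm_continuous.
  by apply: continuous_powR_pos; rewrite normr_gt0.
change ((fun t : R => `|t| `^ r) @ (0 : R) --> `|(0 : R)| `^ r).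
rewrite normr0 powR0 ?gt_eqF //; apply/cvgrPdist_lt => e e0.
have d0 : 0 < e `^ r^-1 by rewrite powR_gt0.
have : nbhs (0 : R) (ball (0 : R) (e `^ r^-1)) by exact: nbhsx_ballx.
apply: filterS => t; rewrite /ball /= !sub0r !normrN (ger0_norm (powR_ge0 _ _)) => td.
apply: (@lt_le_trans _ _ ((e `^ r^-1) `^ r)).
  by apply: gt0_ltr_powR => //; rewrite nnegrE // powR_ge0.
by rewrite -powRrM mulVf ?gt_eqF // powRr1 // ltW.
Qed.

Section bipow_weight.
Variables al al' : R.
Hypotheses (al0 : 0 <= al) (al'0 : 0 <= al').

Definition wt (s : R) := bipow `|s| al al'.

Lemma wt_ge0 s : 0 <= wt s.
Proof. by rewrite /wt bipow_min_max mulr_ge0 // powR_ge0. Qed.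

Lemma wt_gt0 s : s != 0 -> 0 < wt s.
Proof.
move=> s0; rewrite /wt bipow_min_max; apply: mulr_gt0; apply: powR_gt0.
  by rewrite lt_min normr_gt0 s0 ltr01.
by rewrite lt_max ltr01 orbT.
Qed.

Lemma wt_le s t : `|s| <= `|t| -> wt s <= wt t.
Proof.
move=> st; rewrite /wt !bipow_min_max; apply: ler_pM; rewrite ?powR_ge0 //.
  by apply: powR_le => //; rewrite le_min !ge_min st lexx orbT.
apply: powR_le => //.
by rewrite ge_max !le_max st lexx orbT.
Qed.

Lemma wt_doubling s t : `|s| <= 2 * `|t| -> wt s <= 2 `^ (al + al') * wt t.
Proof.
move=> st; rewrite /wt !bipow_min_max.
rewrite powRD; last by rewrite pnatr_eq0 implybT.
rewrite mulrACA; apply: ler_pM; rewrite ?powR_ge0 // -powRM //.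
- apply: powR_le => //.
  by rewrite minr_pMr // mulr1 le_min !ge_min st /= ler1n orbT.
- apply: powR_le => //.
  by rewrite maxr_pMr // mulr1 ge_max !le_max st /= ler1n orbT.
Qed.

Lemma continuous_wt : continuous wt.
Proof.
have -> : wt = (fun s => `|Num.min `|s| 1| `^ al * `|Num.max `|s| 1| `^ al').
  apply/funext => s; rewrite /wt bipow_min_max (@ger0_norm _ (Num.min _ _)).
    by rewrite (@ger0_norm _ (Num.max _ _)) // le_max ler01 orbT.
  by rewrite le_min normr_ge0 ler01.
apply: continuous_mul => s.
  apply: (@continuous_comp _ _ _ (fun s : R => Num.min `|s| 1) (fun t => `|t| `^ al)).
    by apply: (@continuous_min _ _ (fun s : R => `|s|) (fun=> 1));
      [exact: norm_continuous|exact: cst_continuous].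
  exact: continuous_norm_powR.
apply: (@continuous_comp _ _ _ (fun s : R => Num.max `|s| 1) (fun t => `|t| `^ al')).
  by apply: (@continuous_max _ _ (fun s : R => `|s|) (fun=> 1));
    [exact: norm_continuous|exact: cst_continuous].
exact: continuous_norm_powR.
Qed.

End bipow_weight.

Section regularized_power.
Variables eta b : R.

(** A regularisation of |s|^(2b); hence the halved exponents in [Den] and the exponent -d1 for
    |s|^(-2 d1). *)
Definition rpow (s : R) := (s ^+ 2 + eta) `^ b.

Lemma is_derive_rpow s : 0 < s ^+ 2 + eta ->
  is_derive s 1 rpow (b * rpow s / (s ^+ 2 + eta) * (2 * s)).
Proof.
move=> A0.
have dA : is_derive s 1 (fun t : R => t ^+ 2 + eta) (2 * s).
  have d := is_deriveD (is_deriveM (is_derive_id s (1 : R)) (is_derive_id s (1 : R)))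
    (is_derive_cst eta s (1 : R)).
  rewrite (_ : (fun t : R => _) = (id * id + cst eta : R -> R)); last first.
    by apply/funext => t; rewrite !fctE expr2.
  suff <- : s *: (1 : R) + s *: (1 : R) + 0 = 2 * s by [].
  by rewrite -[s *: _]/(s * _) mulr1 addr0 mulr_natl.
have dP := is_derive1_powR b A0.
have := @is_derive1_comp _ (fun t : R => t `^ b) (fun t : R => t ^+ 2 + eta) s _ _ dP dA.
move=> d; refine (eq_ind _ (fun z : R => is_derive s 1 rpow z) d _ _).
congr (_ * _); rewrite -mulrA; congr (_ * _).
by rewrite powRB ?powRr1 ?(ltW A0) // (gt_eqF A0) implybT.
Qed.

Lemma continuous_rpow_pt s : 0 < s ^+ 2 + eta -> rpow @ s --> rpow s.
Proof.
move=> A0; apply: derivable1_cvg.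
have d := is_derive_rpow A0; exact: ex_derive.
Qed.

End regularized_power.

Lemma is_derive_scale (k s : R) : is_derive s 1 (fun t : R => k * t) k.
Proof.
have d := is_deriveM (is_derive_cst k s (1 : R)) (is_derive_id s (1 : R)).
refine (eq_ind _ (fun z : R => is_derive s 1 (fun t : R => k * t) z) d _ _).
by rewrite -![_ *: _]/(_ * _) mulr1 mulr0 addr0.
Qed.

(** * The regularised horizontal coordinate *)

Section radial.
Variables (d1 d1' : R).
Hypotheses (d10 : 0 <= d1) (d1d1' : d1 <= d1') (d1'1 : d1' < 1) (d1'0 : 0 < d1').

(** Comparable to the square root of the horizontal weight when [eta] is 0. A sum of the two powers,
    instead of a switch at |s| = 1, stays differentiable there. *)
Definition Den eta s := rpow eta (d1 / 2) s + rpow eta (d1' / 2) s.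
(* [Gr 0] is comparable to the signed horizontal distance from [0]; [eta > 0] makes it C^1
   across [s = 0]. *)
Definition Gr eta s := s / Den eta s.
Definition dGr eta s := (Den eta s)^-1 -
  s * ((d1 / 2 * rpow eta (d1 / 2) s + d1' / 2 * rpow eta (d1' / 2) s)
        / (s ^+ 2 + eta) * (2 * s)) / Den eta s ^+ 2.

Lemma Den_ge0 eta s : 0 <= Den eta s.
Proof. by rewrite addr_ge0 // powR_ge0. Qed.

Lemma Den_gt0 eta s : 0 < s ^+ 2 + eta -> 0 < Den eta s.
Proof. by move=> A0; rewrite addr_gt0 // powR_gt0. Qed.

Lemma is_derive_Gr (eta s : R) : 0 < s ^+ 2 + eta -> is_derive s 1 (Gr eta) (dGr eta s).
Proof.
move=> A0; have D0 := Den_gt0 A0.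
have dD := is_deriveD (is_derive_rpow (d1 / 2) A0) (is_derive_rpow (d1' / 2) A0).
have dV := @is_deriveV _ (Den eta) s _ 1 _ dD.
have d := is_deriveM (is_derive_id s (1 : R)) (dV (lt0r_neq0 D0)).
refine (eq_ind _ (fun z : R => is_derive s 1 (Gr eta) z) d _ _).
rewrite /dGr -![_ *: _]/(_ * _) mulr1 addrC; congr (_ + _).
by field; rewrite !lt0r_neq0.
Qed.

(** Here dGr = (1 - t) / Den, where t = s Den' / Den is a weighted mean of d1 and d1' multiplied by
    s^2 / (s^2 + eta); thus 0 <= t <= d1' < 1. *)
Lemma dGr_bounds (eta s : R) : 0 <= eta -> 0 < s ^+ 2 + eta ->
  (1 - d1') / Den eta s <= dGr eta s <= (Den eta s)^-1.
Proof.
move=> eta0 A0; have D0 := Den_gt0 A0.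
rewrite /dGr; set P1 := rpow _ _ _; set P2 := rpow _ _ _.
have P10 : 0 <= P1 by exact: powR_ge0.
have P20 : 0 <= P2 by exact: powR_ge0.
pose u := s ^+ 2 / (s ^+ 2 + eta).
have u0 : 0 <= u by rewrite divr_ge0 ?sqr_ge0 // ltW.
have u1 : u <= 1 by rewrite ler_pdivrMr // mul1r lerDl.
have -> : s * ((d1 / 2 * P1 + d1' / 2 * P2) / (s ^+ 2 + eta) * (2 * s)) / Den eta s ^+ 2
   = u * (d1 * P1 + d1' * P2) / Den eta s / Den eta s.
  by rewrite /u; field; rewrite !gt_eqF.
set t := u * (d1 * P1 + d1' * P2) / Den eta s.
have m0 : 0 <= d1 * P1 + d1' * P2 by rewrite addr_ge0 // mulr_ge0 // ltW.
have t0 : 0 <= t by apply: divr_ge0; [exact: mulr_ge0|exact: ltW].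
have t1 : t <= d1'.
  rewrite ler_pdivrMr //; apply: (@le_trans _ _ (d1 * P1 + d1' * P2)).
    by rewrite ler_piMl.
  by rewrite /Den mulrDr lerD2r ler_wpM2r.
have -> : (Den eta s)^-1 - t / Den eta s = (1 - t) / Den eta s by rewrite mulrBl mul1r.
rewrite -[X in _ <= _ <= X]mul1r !ler_pM2r ?invr_gt0 //.
by rewrite lerD2l lerN2 t1 /= gerBl.
Qed.

Lemma derive1_Gr (eta s : R) : 0 < s ^+ 2 + eta -> derive1 (Gr eta) s = dGr eta s.
Proof. by move=> A0; apply: is_derive_derive1; exact: is_derive_Gr. Qed.

Lemma derivable_Gr (eta s : R) : 0 < s ^+ 2 + eta -> derivable (Gr eta) s 1.
Proof. by move=> A0; have d := is_derive_Gr A0; exact: ex_derive. Qed.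

Lemma continuous_dGr eta : 0 < eta -> continuous (dGr eta).
Proof.
move=> eta0 s.
have A0 : 0 < s ^+ 2 + eta by rewrite ltr_wpDl // sqr_ge0.
have D0 := Den_gt0 A0.
have c1 := continuous_rpow_pt (b := d1 / 2) A0.
have c2 := continuous_rpow_pt (b := d1' / 2) A0.
have cD : Den eta @ s --> Den eta s by exact: cvgD.
have cA : (fun t : R => t ^+ 2 + eta) @ s --> s ^+ 2 + eta.
  by apply: cvgD; [exact: exprn_continuous|exact: cst_continuous].
apply: cvgB; first by apply: cvgV => //; rewrite gt_eqF.
apply: cvgM; last first.
  apply: cvgV; first by rewrite gt_eqF // exprn_gt0.
  by apply: (@continuous_comp _ _ _ (Den eta) (fun y => y ^+ 2));
    [exact: cD|exact: exprn_continuous].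
apply: cvgM; first exact: cvg_id.
apply: cvgM; last by apply: cvgM; [exact: cst_continuous|exact: cvg_id].
apply: cvgM; last by apply: cvgV => //; rewrite gt_eqF.
by apply: cvgD; apply: cvgM => //; exact: cst_continuous.
Qed.

Lemma Den0E s : Den 0 s = `|s| `^ d1 + `|s| `^ d1'.
Proof. by rewrite /Den /rpow addr0 -real_normK ?num_real // !powR_sqr. Qed.

Lemma Den0_le s t : `|s| <= `|t| -> Den 0 s <= Den 0 t.
Proof. by move=> st; rewrite !Den0E lerD // powR_le // ?(le_trans d10) // ltW. Qed.

Lemma Den_ge_Den0 eta s : 0 <= eta -> Den 0 s <= Den eta s.
Proof.
move=> eta0; rewrite /Den /rpow addr0 lerD // powR_le ?sqr_ge0 ?lerDl // divr_ge0 //.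
exact: ltW.
Qed.

(** On each side of |s| = 1 the weight is the square of the larger of the two powers, and their sum
    lies between the larger one and its double. *)
Lemma wt_Den0 s : wt (2 * d1) (2 * d1') s <= Den 0 s ^+ 2 <= 4 * wt (2 * d1) (2 * d1') s.
Proof.
rewrite Den0E /wt /Defs.bipow !powR2.
have a0 := powR_ge0 `|s| d1; have b0 := powR_ge0 `|s| d1'.
case: (leP `|s| 1) => s1.
  have : `|s| `^ d1' <= `|s| `^ d1.
    have [->|s0] := eqVneq s 0; first by rewrite normr0 (@powR0 _ d1') ?gt_eqF ?powR_ge0.
    by apply: ger_powR => //; rewrite normr_gt0 s0 s1.
  move: (_ `^ d1) (_ `^ d1') a0 b0 => a b a0 b0 ab; apply/andP; split; nra.
have : `|s| `^ d1 <= `|s| `^ d1' by apply: ler_powR => //; exact: ltW.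
move: (_ `^ d1) (_ `^ d1') a0 b0 => a b a0 b0 ab; apply/andP; split; nra.
Qed.

Lemma wt_ge_powR s : (s ^+ 2) `^ d1 <= wt (2 * d1) (2 * d1') s.
Proof.
have -> : (s ^+ 2) `^ d1 = `|s| `^ (2 * d1).
  by rewrite -(real_normK (num_real s)) -powR_mulrn // -powRrM.
rewrite /wt /Defs.bipow; case: (leP `|s| 1) => s1 //.
by apply: (@ler_powR _ `|s| (ltW s1)); rewrite ler_pM2l.
Qed.

Lemma Gr0_odd s : Gr 0 (- s) = - Gr 0 s.
Proof. by rewrite /Gr !Den0E normrN mulNr. Qed.

Lemma sqrD0_gt0 (s : R) : s != 0 -> 0 < s ^+ 2 + 0.
Proof. by move=> s0; rewrite addr0 lt_neqAle eq_sym sqrf_eq0 s0 sqr_ge0. Qed.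

(** At the singular point 0 continuity comes from |Gr 0 t| <= |t|^(1 - d1). *)
Lemma continuous_Gr0 : continuous (Gr 0).
Proof.
move=> s; have [->|s0] := eqVneq s 0; last first.
  by apply: derivable1_cvg; exact/derivable_Gr/sqrD0_gt0.
have E : Gr 0 0 = 0 by rewrite /Gr mul0r.
change (Gr 0 @ (0 : R) --> Gr 0 0); rewrite E.
have h : (fun s : R => `|s| `^ (1 - d1)) @ (0 : R) --> (0 : R).
  have d11 : d1 < 1 by exact: le_lt_trans d1'1.
  have e1 : 0 <= 1 - d1 by rewrite subr_ge0 ltW.
  have -> : (0 : R) = `|(0 : R)| `^ (1 - d1).
    by rewrite normr0 powR0 // subr_eq0 gt_eqF.
  by rewrite {1}normr0 {1}powR0 ?subr_eq0 ?gt_eqF //; exact: continuous_norm_powR.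
apply/cvgrPdist_lt => e e0.
move/cvgrPdist_lt : h => /(_ _ e0); apply: filterS => t.
rewrite !sub0r !normrN (ger0_norm (powR_ge0 _ _)); apply: le_lt_trans.
have [->|t0] := eqVneq t 0; first by rewrite /Gr mul0r normr0 powR_ge0.
have tp : 0 < `|t| by rewrite normr_gt0.
rewrite /Gr normrM normfV (ger0_norm (Den_ge0 _ _)) Den0E.
rewrite ler_pdivrMr; last by rewrite addr_gt0 // powR_gt0.
rewrite mulrDr -powRD; last by rewrite (gt_eqF tp) implybT.
by rewrite subrK powRr1 // lerDl mulr_ge0 // powR_ge0.
Qed.

Lemma Gr0_unbounded (T : R) : 0 <= T -> exists2 s, 0 <= s & T <= Gr 0 s.
Proof.
move=> T0; have e0 : 0 < 1 - d1' by rewrite subr_gt0.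
(* For s >= 1 the denominator is at most 2 s^d1', so Gr 0 s >= s^(1 - d1') / 2, and here s^(1 - d1')
   = 2 T + 1. *)
pose s := (2 * T + 1) `^ (1 - d1')^-1.
have s1 : 1 <= s.
  have -> : 1 = 1 `^ (1 - d1')^-1 :> R by rewrite powR1.
  by apply: powR_le; rewrite ?invr_ge0 ?(ltW e0) // lerDr mulr_ge0.
have s0 : 0 < s by exact: lt_le_trans s1.
exists s; first exact: ltW.
rewrite /Gr ler_pdivlMr; last exact/Den_gt0/sqrD0_gt0/lt0r_neq0.
rewrite Den0E gtr0_norm //.
have h : s = s `^ (1 - d1') * s `^ d1'.
  by rewrite -powRD ?subrK ?powRr1 ?(ltW s0) // gt_eqF ?implybT.
have h2 : s `^ (1 - d1') = 2 * T + 1.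
  by rewrite /s -powRrM mulVf ?gt_eqF // powRr1 // addr_ge0 // mulr_ge0.
have h3 : s `^ d1 <= s `^ d1' by exact: ler_powR.
have h4 := powR_ge0 s d1; rewrite [leRHS]h h2.
move: (s `^ d1) (s `^ d1') h3 h4 => u v uv u0; nra.
Qed.

(** Provides the end points p and q at prescribed horizontal distance from x_1. *)
Lemma Gr0_surj y : exists s, Gr 0 s = y.
Proof.
have [s s0 sT] := Gr0_unbounded (normr_ge0 y).
have ss : - s <= s by rewrite (le_trans _ s0) // oppr_le0.
have [|c _ cE] := @IVT R (Gr 0) (- s) s y ss (continuous_subspaceT continuous_Gr0).
  rewrite Gr0_odd; apply/andP; split.
    rewrite ge_min; apply/orP; left; rewrite lerNl (le_trans _ sT) //.
    by rewrite -normrN ler_norm.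
  by rewrite le_max; apply/orP; right; rewrite (le_trans _ sT) // ler_norm.
by exists c.
Qed.

Lemma Gr0_expand p q L : p <= q -> (forall s, p <= s <= q -> Den 0 s <= L) -> 0 < L ->
  (1 - d1') / L * (q - p) <= Gr 0 q - Gr 0 p.
Proof.
move=> pq DL L0; have c0 : 0 < 1 - d1' by rewrite subr_gt0.
pose k := (1 - d1') / L.
suff : (Gr 0 - (fun t : R => k * t)) p <= (Gr 0 - (fun t : R => k * t)) q.
  by rewrite !fctE -/k mulrBr; lra.
apply: ger0_derive_le_off0 => //.
  apply: continuous_subspaceT => x; apply: cvgB; first exact: continuous_Gr0.
  by apply: cvgM; [exact: cst_continuous|exact: cvg_id].
move=> s /andP[ps sq] s0.
have d := is_deriveB (is_derive_Gr (sqrD0_gt0 s0)) (is_derive_scale k s).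
split; first exact: ex_derive.
rewrite (is_derive_derive1 d) subr_ge0.
have /andP[+ _] := dGr_bounds (lexx 0) (sqrD0_gt0 s0); apply: le_trans.
rewrite ler_pM2l // lef_pV2 ?posrE //; last exact/Den_gt0/sqrD0_gt0.
by apply: DL; rewrite !ltW.
Qed.

Lemma continuous_Gr eta : 0 <= eta -> continuous (Gr eta).
Proof.
rewrite le_eqVlt => /predU1P[<-|eta0]; first exact: continuous_Gr0.
by move=> s; apply: derivable1_cvg; apply: derivable_Gr; rewrite ltr_wpDl // sqr_ge0.
Qed.

Lemma Gr_nondecreasing (eta s t : R) : 0 <= eta -> s <= t -> Gr eta s <= Gr eta t.
Proof.
move=> eta0 st; apply: ger0_derive_le_off0 => //.
  by apply: continuous_subspaceT; exact: continuous_Gr.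
move=> x _ x0; have A0 : 0 < x ^+ 2 + eta.
  by rewrite ltr_wpDr // -(addr0 (x ^+ 2)) sqrD0_gt0.
split; first exact: derivable_Gr.
rewrite derive1_Gr //; have /andP[+ _] := dGr_bounds eta0 A0; apply: le_trans.
by rewrite divr_ge0 ?Den_ge0 // subr_ge0 ltW.
Qed.

(** Pointwise convergence suffices, because a cut-off is compared with its limit only at p, x_1 and
    q. *)
Lemma Gr_eta_cvg s e : 0 < e -> \forall eta \near 0^'+, `|Gr eta s - Gr 0 s| < e.
Proof.
move=> e0; have [->|s0] := eqVneq s 0.
  by near=> eta; rewrite /Gr !mul0r subrr normr0.
have A0 := sqrD0_gt0 s0.
have cP b : (fun eta => (s ^+ 2 + eta) `^ b) @ (0 : R) --> (s ^+ 2 + 0) `^ b.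
  apply: (@continuous_comp _ _ _ (fun eta => s ^+ 2 + eta) (fun t : R => t `^ b)).
    by apply: cvgD; [exact: cst_continuous|exact: cvg_id].
  exact: continuous_powR_pos.
have cG : (fun eta => Gr eta s) @ (0 : R) --> Gr 0 s.
  apply: cvgM; first exact: cst_continuous.
  apply: cvgV; first by rewrite gt_eqF // Den_gt0.
  by apply: cvgD; exact: cP.
have /cvgrPdist_lt/(_ _ e0) := cvg_at_right_filter cG.
by apply: filterS => eta; rewrite distrC.
Unshelve. all: by end_near. Qed.

End radial.
End power_weights.

(** * Lengths and weights of horizontal intervals *)

Section intervals.
Variable R : realType.

(** The quarter touches the end point of larger modulus. Since q - p is at most twice that modulus,
    a quarter of the length takes away at most half of it. *)
Lemma far_quarter (p q : R) : p < q ->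
  exists g0 g1, [/\ p <= g0, g0 < g1, g1 <= q, g1 - g0 = (q - p) / 4 &
    forall s, g0 <= s <= g1 -> Num.max `|p| `|q| <= 2 * `|s|].
Proof.
move=> pq; have [pq'|qp'] := leP `|p| `|q|.
  have q0 : 0 < q.
    rewrite ltNge; apply/negP => q0; have p0 : p < 0 by exact: lt_le_trans q0.
    by move: pq'; rewrite (ltr0_norm p0) (ler0_norm q0) lerN2 leNgt pq.
  have qp : - q <= p by move: pq'; rewrite (gtr0_norm q0) ler_norml => /andP[].
  exists (q - (q - p) / 4), q; split; try lra.
  move=> s /andP[s0 s1]; have sp : 0 < s by lra.
  by rewrite (gtr0_norm q0) (gtr0_norm sp); lra.
have p0 : p < 0.
  rewrite ltNge; apply/negP => p0; have q0 : 0 < q by exact: le_lt_trans pq.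
  by move: qp'; rewrite (ger0_norm p0) (gtr0_norm q0) ltNge ltW.
have qp : q <= - p by move: (ltW qp'); rewrite (ltr0_norm p0) ler_norml => /andP[].
exists p, (p + (q - p) / 4); split; try lra.
move=> s /andP[s0 s1]; have sp : s < 0 by lra.
by rewrite (ltr0_norm p0) (ltr0_norm sp); lra.
Qed.

Section weight.
Variables (d1 d1' : R).
Hypotheses (d10 : 0 <= d1) (d1h : d1 < 2^-1) (d1'h : 2^-1 <= d1') (d1'1 : d1' < 1).
Local Notation F := (Gr d1 d1' 0).
Local Notation D := (Den d1 d1' 0).
Local Notation U := (wt (2 * d1) (2 * d1')).

Let d1d1' : d1 <= d1'. Proof. exact: le_trans (ltW d1h) d1'h. Qed.
Let d1'0 : 0 < d1'. Proof. by apply: lt_le_trans d1'h; rewrite invr_gt0. Qed.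

Lemma interval_length (p q rho : R) : p < q -> F q - F p = 2 * rho ->
  q - p <= 2 / (1 - d1') * rho * D (Num.max `|p| `|q|).
Proof.
move=> pq Fpq; set M := Num.max _ _.
have e0 : 0 < 1 - d1' by rewrite subr_gt0.
have M0 : 0 < M.
  rewrite /M lt_max !normr_gt0; case: eqVneq => //= p0; case: eqVneq => //= q0.
  by move: pq; rewrite p0 q0 ltxx.
have DM : 0 < D M by apply/Den_gt0/sqrD0_gt0/lt0r_neq0.
have := @Gr0_expand _ d1 d1' d10 d1d1' d1'1 d1'0 p q (D M) (ltW pq) _ DM.
rewrite Fpq => /(_ _)H.
have {}H : (1 - d1') / D M * (q - p) <= 2 * rho.
  apply: H => s /andP[ps sq]; apply: Den0_le => //; rewrite (gtr0_norm M0) /M.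
  rewrite le_max; apply/orP; have [s0|s0] := leP 0 s.
    by right; rewrite (ger0_norm s0) (le_trans sq) // ler_norm.
  by left; rewrite (ltr0_norm s0) -(normrN p) (le_trans _ (ler_norm _)) // lerN2.
have -> : 2 / (1 - d1') * rho * D M = 2 * rho * (D M / (1 - d1')) by ring.
rewrite -ler_pdivrMr ?divr_gt0 // invf_div mulrC; exact: H.
Qed.

(* The odd function with derivative [(1 - 2 d1) |s|^(-2 d1)]. *)
Definition apow (s : R) := s * rpow 0 (- d1) s.

Lemma apow_odd s : apow (- s) = - apow s.
Proof. by rewrite /apow /rpow sqrrN mulNr. Qed.

Lemma apowE s : 0 < s -> apow s = s `^ (1 - 2 * d1).
Proof.
move=> s0; rewrite /apow /rpow addr0 -powR_mulrn ?(ltW s0) // -powRrM mulrN.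
by rewrite -{1}(powRr1 (ltW s0)) -powRD // (gt_eqF s0) implybT.
Qed.

Lemma is_derive_apow (s : R) : s != 0 ->
  is_derive s 1 apow ((1 - 2 * d1) * rpow 0 (- d1) s).
Proof.
move=> s0; have A0 := sqrD0_gt0 s0.
have d := is_deriveM (is_derive_id s (1 : R)) (is_derive_rpow (- d1) A0).
refine (eq_ind _ (fun z : R => is_derive s 1 apow z) d _ _).
rewrite -![_ *: _]/(_ * _) mulr1 addr0; by field.
Qed.

Lemma continuous_apow : continuous apow.
Proof.
move=> s; have [->|s0] := eqVneq s 0; last first.
  by apply: derivable1_cvg; have d := is_derive_apow s0; exact: ex_derive.
have E : apow 0 = 0 by rewrite /apow mul0r.
change (apow @ (0 : R) --> apow 0); rewrite E.
have e1 : 0 < 1 - 2 * d1 by have := d1h; lra.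
have h : (fun s : R => `|s| `^ (1 - 2 * d1)) @ (0 : R) --> (0 : R).
  have -> : (0 : R) = `|(0 : R)| `^ (1 - 2 * d1) by rewrite normr0 powR0 // gt_eqF.
  by rewrite {1}normr0 {1}powR0 ?gt_eqF //; exact: (continuous_norm_powR (ltW e1)).
apply/cvgrPdist_lt => e e0.
move/cvgrPdist_lt : h => /(_ _ e0); apply: filterS => t.
rewrite !sub0r !normrN (ger0_norm (powR_ge0 _ _)); apply: le_lt_trans.
have [->|t0] := eqVneq t 0; first by rewrite /apow mul0r normr0 powR_ge0.
have tp : 0 < `|t| by rewrite normr_gt0.
rewrite -apowE //.
have [t1|t1] := leP 0 t; first by rewrite (ger0_norm t1) ger0_norm // mulr_ge0 // powR_ge0.
by rewrite (ltr0_norm t1) apow_odd -normrN ger0_norm // -apow_odd mulr_ge0 ?powR_ge0 // oppr_ge0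
  ltW.
Qed.

(** With c = M^(-2 d1) one has c s <= apow s <= c M for 0 <= s <= M. When 0 is not strictly between
    p and q, this bounds the increment by c (q - p). Otherwise each side of 0 contributes at most c
    M, and M <= q - p, whence the factor 2. *)
Lemma apow_increment p q : p < q ->
  apow q - apow p <= 2 * (q - p) * rpow 0 (- d1) (Num.max `|p| `|q|).
Proof.
move=> pq; set M := Num.max _ _; set c := rpow _ _ M.
have c0 : 0 <= c by exact: powR_ge0.
have lower s : 0 <= s -> s <= M -> c * s <= apow s.
  move=> s0 sM; have [->|sn0] := eqVneq s 0; first by rewrite /apow mulr0 mul0r.
  have sp : 0 < s by rewrite lt_neqAle eq_sym sn0.
  rewrite /apow mulrC ler_wpM2l // /c /rpow !addr0 !powRN lef_pV2 ?posrE ?powR_gt0 ?exprn_gt0 //;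
    last exact: lt_le_trans sM.
  by apply: powR_le; rewrite ?sqr_ge0 // lerXn2r ?nnegrE // (le_trans s0).
have upper s : 0 <= s -> s <= M -> apow s <= c * M.
  move=> s0 sM; have [->|sn0] := eqVneq s 0.
    by rewrite /apow mul0r mulr_ge0 // (le_trans s0).
  have sp : 0 < s by rewrite lt_neqAle eq_sym sn0.
  have Mp : 0 < M by exact: lt_le_trans sM.
  rewrite mulrC -/(apow M) !apowE //; apply: powR_le => //.
  by have := d1h; lra.
have pM : `|p| <= M by rewrite le_max lexx.
have qM : `|q| <= M by rewrite le_max lexx orbT.
have [p0|p0] := leP 0 p.
  have q0 : 0 <= q by exact: le_trans (ltW pq).
  have ME : M = q by rewrite /M !ger0_norm //; apply/max_idPr/ltW.
  have := lower p p0 (le_trans (ler_norm _) pM).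
  have := upper q q0 (le_trans (ler_norm _) qM); rewrite ME => h1 h2.
  have := mulr_ge0 c0 (_ : 0 <= q - p); rewrite subr_ge0 => /(_ (ltW pq)); lra.
have [q0|q0] := leP q 0.
  have ME : M = - p by rewrite /M ltr0_norm // ler0_norm //; apply/max_idPl; rewrite lerN2 ltW.
  have qM' : - q <= M by rewrite ME lerN2 ltW.
  have := lower (- q); rewrite oppr_ge0 apow_odd => /(_ q0 qM') h1.
  have := upper (- p); rewrite oppr_ge0 apow_odd => /(_ (ltW p0)); rewrite {1}ME => /(_ (lexx _)).
  rewrite ME => h2.
  have := mulr_ge0 c0 (_ : 0 <= q - p); rewrite subr_ge0 => /(_ (ltW pq)); lra.
have h1 := upper q (ltW q0) (le_trans (ler_norm _) qM).
have := upper (- p); rewrite oppr_ge0 apow_odd => /(_ (ltW p0)) h2.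
have {}h2 : - apow p <= c * M by apply: h2; rewrite -(ltr0_norm p0).
have h3 : M <= q - p.
  by rewrite /M ge_max (ltr0_norm p0) (gtr0_norm q0); apply/andP; split; lra.
have := ler_wpM2l c0 h3; lra.
Qed.

(** For 0 < M <= S one has M^d1' <= S M^d1, so D M <= 2 S M^d1. This loss in [S] is what makes the
    final constant depend on the largest radius. *)
Lemma Den0_le_small S M : 1 <= S -> 0 < M -> M <= S ->
  D M ^+ 2 * rpow 0 (- d1) M <= 4 * S ^+ 2.
Proof.
move=> S1 M0 MS; rewrite Den0E // (gtr0_norm M0).
have MSd : M `^ d1' <= S * M `^ d1.
  have [M1|M1] := leP M 1.
    apply: (@le_trans _ _ (M `^ d1)); first by apply: ger_powR; rewrite ?M0.
    by rewrite ler_peMl // powR_ge0.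
  apply: (@le_trans _ _ M); first by apply: ler1_powR; [exact: ltW|exact: ltW].
  rewrite (le_trans MS) // ler_peMr ?(le_trans ler01 S1) //.
  have -> : 1 = M `^ 0 :> R by rewrite powRr0.
  by apply: ler_powR => //; exact: ltW.
have a0 : 0 < M `^ d1 by exact: powR_gt0.
have -> : rpow 0 (- d1) M = (M `^ d1) ^- 2.
  by rewrite /rpow addr0 powRN -powR_mulrn ?(ltW M0) // -powRrM mulrC powRrM powR_mulrn // ltW.
rewrite ler_pdivrMr ?exprn_gt0 //.
have -> : (4 : R) = 2 ^+ 2 by ring.
rewrite -!exprMn lerXn2r ?nnegrE //.
- by rewrite addr_ge0 // powR_ge0.
- by apply: mulr_ge0; [apply: mulr_ge0 => //; exact: le_trans S1|exact: ltW].
have := ler_wpM2r (ltW a0) S1; lra.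
Qed.

(** The product (q - p) (W q - W p) is the constant that [tensor_poincare] puts before the
    horizontal energy, and it must scale like rho^2. *)
Lemma interval_weight (rmax : R) : 0 < rmax -> exists2 K, 0 < K &
  forall p q rho, p < q -> 0 < rho <= rmax -> F q - F p = 2 * rho ->
  exists W : R -> R, [/\ continuous W,
    forall x, p < x < q -> x != 0 -> derivable W x 1 /\ 1 <= U x * derive1 W x &
    (q - p) * (W q - W p) <= K * rho ^+ 2].
Proof.
move=> rmax0; have e0 : 0 < 1 - d1' by rewrite subr_gt0.
have e1 : 0 < 1 - 2 * d1 by have := d1h; lra.
pose k := 2 / (1 - d1'); have k0 : 0 < k by rewrite divr_gt0.
(* For M > S, q - p <= k rho D(M) <= 2 k rmax M^d1', while 4 k rmax <= M^(1 - d1'). Hence q - p <= M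
   / 2 and the interval stays away from 0. *)
pose S := Num.max 1 ((4 * k * rmax) `^ (1 - d1')^-1).
have S1 : 1 <= S by rewrite le_max lexx.
pose c2 : R := 2 `^ (2 * d1 + 2 * d1'); have c20 : 0 < c2 by rewrite powR_gt0.
pose K1 := 8 * k ^+ 2 * S ^+ 2 / (1 - 2 * d1).
pose K2 := 4 * c2 * k ^+ 2.
have S0 : 0 < S by exact: lt_le_trans S1.
have K10 : 0 < K1.
  apply: divr_gt0 => //; apply: mulr_gt0; last exact: exprn_gt0.
  by apply: mulr_gt0 => //; exact: exprn_gt0.
have K20 : 0 < K2 by apply: mulr_gt0; [exact: mulr_gt0|exact: exprn_gt0].
exists (K1 + K2); first exact: addr_gt0.
move=> p q rho pq /andP[rho0 rhom] Fpq.
have := interval_length pq Fpq; rewrite -/k; set M := Num.max _ _ => lenM.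
have qp0 : 0 < q - p by rewrite subr_gt0.
have M0 : 0 < M.
  rewrite /M lt_max !normr_gt0; case: eqVneq => //= p0; case: eqVneq => //= q0.
  by move: pq; rewrite p0 q0 ltxx.
have D0 : 0 <= D M by exact: Den_ge0.
have len2 : (q - p) ^+ 2 <= k ^+ 2 * rho ^+ 2 * D M ^+ 2.
  rewrite -!exprMn lerXn2r ?nnegrE ?(ltW qp0) //.
  by apply: mulr_ge0 => //; apply: mulr_ge0; exact: ltW.
have rho2 : 0 < rho ^+ 2 by exact: exprn_gt0.
have [MS|MS] := leP M S.
  (* Near regime: the weight is at least |x|^(2 d1) on the whole line, so a primitive of |x|^(-2 d1)
     is allowed as [W]. *)
  exists (fun x => (1 - 2 * d1)^-1 * apow x); split.
  - by move=> x; apply: cvgM; [exact: cst_continuous|exact: continuous_apow].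
  - move=> x _ x0.
    have d := is_deriveM (is_derive_cst (1 - 2 * d1)^-1 x (1 : R)) (is_derive_apow x0).
    have {}d : is_derive x 1 (fun x => (1 - 2 * d1)^-1 * apow x) (rpow 0 (- d1) x).
      refine (eq_ind _ (fun z : R => is_derive x 1 (fun x => (1 - 2 * d1)^-1 * apow x) z) d _ _).
      by rewrite -![_ *: _]/(_ * _) mulr0 addr0 mulKf // gt_eqF.
    split; first exact: ex_derive.
    rewrite (is_derive_derive1 d) /rpow addr0 powRN ler_pdivlMr ?mul1r.
      exact: wt_ge_powR.
    by apply: powR_gt0; rewrite -(addr0 (x ^+ 2)); exact: sqrD0_gt0.
  rewrite -mulrBr.
  have h1 := apow_increment pq; rewrite -/M in h1.
  have c0 : 0 <= rpow 0 (- d1) M by exact: powR_ge0.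
  have h2 := Den0_le_small S1 M0 MS.
  apply: (@le_trans _ _ (K1 * rho ^+ 2)); last by rewrite ler_pM2r // lerDl ltW.
  have -> : (q - p) * ((1 - 2 * d1)^-1 * (apow q - apow p)) =
    (q - p) * (apow q - apow p) / (1 - 2 * d1) by ring.
  have -> : K1 * rho ^+ 2 = (8 * k ^+ 2 * S ^+ 2 * rho ^+ 2) / (1 - 2 * d1) by rewrite /K1; ring.
  rewrite ler_pM2r ?invr_gt0 //.
  apply: (le_trans (ler_wpM2l (ltW qp0) h1)).
  have h3 := ler_wpM2r c0 len2.
  have h4 := ler_wpM2l (ltW (mulr_gt0 (exprn_gt0 2 k0) rho2)) h2.
  rewrite -/(rpow 0 (- d1) M) in h3 *.
  move: (rpow 0 (- d1) M) (D M) h3 h4 => c d h3 h4; lra.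
have MSk : 4 * k * rmax <= M `^ (1 - d1').
  have : (4 * k * rmax) `^ (1 - d1')^-1 <= M.
    by apply: le_trans (ltW MS); rewrite le_max lexx orbT.
  have kr0 : 0 < 4 * k * rmax by apply: mulr_gt0 => //; exact: mulr_gt0.
  move=> h; have := @powR_le _ (1 - d1') _ _ (ltW e0) (powR_ge0 _ _) h.
  by rewrite -powRrM mulVf ?gt_eqF // powRr1 // ltW.
have M1 : 1 <= M by exact: le_trans (ltW MS).
have DM : D M <= 2 * M `^ d1'.
  rewrite Den0E // (gtr0_norm M0); have := @ler_powR _ M M1 d1 d1' d1d1'; lra.
have half : q - p <= M / 2.
  apply: (le_trans lenM).
  have h : M = M `^ (1 - d1') * M `^ d1'.
    by rewrite -powRD ?subrK ?powRr1 ?(ltW M0) // gt_eqF ?implybT.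
  have P0 : 0 < M `^ d1' by exact: powR_gt0.
  apply: (@le_trans _ _ (k * rmax * (2 * M `^ d1'))).
    apply: ler_pM => //; first by rewrite mulr_ge0 // ltW.
    by rewrite ler_pM2l.
  rewrite [in leRHS]h; have := ler_wpM2r (ltW P0) MSk; lra.
have Mx x : p < x < q -> M <= 2 * `|x|.
  move=> /andP[px xq].
  have : M <= `|x| + (q - p).
    rewrite /M ge_max; apply/andP; split.
      have := ler_normD x (p - x); rewrite addrC subrK => /le_trans -> //.
      by rewrite lerD2l distrC ger0_norm; lra.
    have := ler_normD x (q - x); rewrite addrC subrK => /le_trans -> //.
    by rewrite lerD2l ger0_norm; lra.
  lra.
have UM0 : 0 < U M by apply: wt_gt0; exact: lt0r_neq0.
(* Far regime: by doubling, U x >= U M / c2 on the interval, so a linear [W] is enough. *)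
exists (fun x => c2 / U M * x); split.
- by move=> x; apply: cvgM; [exact: cst_continuous|exact: cvg_id].
- move=> x xI _; have d := is_derive_scale (c2 / U M) x.
  split; first exact: ex_derive.
  rewrite (is_derive_derive1 d) mulrA ler_pdivlMr // mul1r [leRHS]mulrC.
  apply: wt_doubling; rewrite ?mulr_ge0 // ?(ltW d1'0) //.
  by rewrite (gtr0_norm M0); exact: Mx.
rewrite -mulrBr.
apply: (@le_trans _ _ (K2 * rho ^+ 2)); last by rewrite ler_pM2r // lerDr ltW.
have -> : (q - p) * (c2 / U M * (q - p)) = c2 * (q - p) ^+ 2 / U M by ring.
rewrite ler_pdivrMr //.
have /andP[_ h1] : U M <= D M ^+ 2 <= 4 * U M by exact: wt_Den0.
have h2 := ler_wpM2l (ltW c20) len2.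
have h3 := ler_wpM2l (ltW (mulr_gt0 c20 (mulr_gt0 (exprn_gt0 2 k0) rho2))) h1.
rewrite /K2; lra.
Qed.

End weight.
End intervals.

(** * Test functions and balls *)

Section separable.
Variable R : realType.
Local Notation C1 := (@Defs.C1 R _).
Local Notation partial := (@Defs.partial R _).
Variables (n : nat) (theta : R -> R) (g : 'I_n -> R -> R).
Hypotheses (dtheta : forall t : R, derivable theta t (1 : R)) (ctheta : continuous (derive1 theta)).
Hypotheses (dg : forall i (t : R), derivable (g i) t (1 : R))
  (cg : forall i, continuous (derive1 (g i))).

Let s (z : V R n) := \sum_i g i (z ord0 i).
Let f (z : V R n) := theta (s z).

Let rest (z : V R n) i := \sum_(j | j != i) g j (z ord0 j).

Lemma separable_line (z : V R n) i (h : R) :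
  f (h *: delta_mx ord0 i + z) = theta (rest z i + g i (h + z ord0 i)).
Proof.
rewrite /f /s (bigD1 i) //= addrC !mxE !eqxx mulr1; congr (theta (_ + _)).
by apply: eq_bigr => j ji; rewrite !mxE eqxx (negbTE ji) mulr0 add0r.
Qed.

Lemma separable_pt (z : V R n) i : f z = theta (rest z i + g i (z ord0 i)).
Proof. by rewrite -[z in LHS]add0r -(scale0r (delta_mx ord0 i)) separable_line add0r. Qed.

Let line (z : V R n) i t := theta (rest z i + g i t).

Let is_derive_line (z : V R n) i (t : R) :
  is_derive t 1 (line z i) (derive1 theta (rest z i + g i t) * derive1 (g i) t).
Proof.
have d := is_deriveD (is_derive_cst (rest z i) t (1 : R)) (derivable_is_derive (@dg i t)).
rewrite add0r in d.
exact: (@is_derive1_comp _ theta (cst (rest z i) + g i) t _ _ (derivable_is_derive (@dtheta _)) d).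
Qed.

Lemma separable_derivable (z : V R n) i : derivable f z (delta_mx ord0 i : V R n).
Proof.
have d := is_derive_line z i (z ord0 i).
have := @ex_derive _ _ _ _ _ _ _ d; rewrite /derivable.
rewrite (_ : (fun h : R => _) =
  fun h : R => h^-1 *: ((f \o shift z) (h *: delta_mx ord0 i) - f z)) //.
apply/funext => h; rewrite /= separable_line (separable_pt z i) /line.
by rewrite -[h *: 1]/(h * 1) mulr1.
Qed.

Lemma separable_partial (z : V R n) i :
  partial i f z = derive1 theta (s z) * derive1 (g i) (z ord0 i).
Proof.
have d := is_derive_line z i (z ord0 i).
have := @derive_val _ _ _ _ _ _ _ d.
rewrite (_ : rest z i + g i (z ord0 i) = s z); last by rewrite /s (bigD1 i) //= addrC.
move=> <-; rewrite /Defs.partial /derive; apply: (f_equal (fun F : R -> R => lim (F @ 0^'))).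
apply/funext => h; rewrite /= separable_line (separable_pt z i) /line.
by rewrite -[h *: 1]/(h * 1) mulr1.
Qed.

Lemma separable_C1 : C1 f.
Proof.
move=> i; split; first by move=> z; exact: separable_derivable.
rewrite (_ : partial i f = fun z => derive1 theta (s z) * derive1 (g i) (z ord0 i)); last first.
  by apply/funext => z; exact: separable_partial.
have cs : continuous s.
  apply: (@continuous_sum R _ n (fun j (z : V R n) => g j (z ord0 j))) => j z.
  apply: (@continuous_pt_comp _ _ (fun z : V R n => z ord0 j) (g j)).
    exact: coord_continuous.
  exact: derivable1_cvg.
apply: continuous_mul => z.
  apply: (@continuous_pt_comp _ _ s (derive1 theta)); first exact: cs.
  exact: ctheta.
apply: (@continuous_pt_comp _ _ (fun z : V R n => z ord0 i) (derive1 (g i))).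
  exact: coord_continuous.
exact: cg.
Qed.

End separable.

(** * A continuously differentiable cut-off profile *)

Section cutoff.
Variable R : realType.

(** The square removes the corner of the positive part at t = 1. *)
Definition cutoff (c t : R) := c * Num.max (1 - t) 0 ^+ 2.

(** Avoids one-sided limits at the junction t = 1: the squared positive part has a remainder of at
    most h^2 everywhere. *)
Lemma is_derive_quadratic (f : R -> R) (t d : R) :
  (forall h, `|f (h + t) - f t - d * h| <= h ^+ 2) -> is_derive t 1 f d.
Proof.
move=> H.
have L : (fun h => h^-1 *: ((f \o shift t) (h *: (1 : R)) - f t)) @ 0^' --> d.
  apply/cvgrPdist_lt => e e0.
  have hb : nbhs (0 : R) (ball (0 : R) e) by exact: nbhsx_ballx.
  apply: (filterS _ hb) => h; rewrite /ball /= sub0r normrN => he h0.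
  rewrite distrC -[h *: 1]/(h * 1) mulr1 -[_ *: _]/(_ * _).
  have -> : h^-1 * (f (h + t) - f t) - d = h^-1 * (f (h + t) - f t - d * h).
    by rewrite [RHS]mulrBr (mulrC d) mulKf.
  rewrite normrM normfV mulrC ltr_pdivrMr ?normr_gt0 //.
  apply: (le_lt_trans (H h)); rewrite -(real_normK (num_real h)) expr2.
  by rewrite ltr_pM2r // normr_gt0.
apply: DeriveDef; first exact: (cvgP _ L).
exact: cvg_lim L.
Qed.

Lemma is_derive_sqr_pos (t : R) :
  is_derive t 1 (fun t : R => Num.max (1 - t) 0 ^+ 2) (- 2 * Num.max (1 - t) 0).
Proof.
apply: is_derive_quadratic => h.
have -> : 1 - (h + t) = (1 - t) - h by ring.
move: (1 - t) => u; rewrite ler_norml.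
case: (leP (u - h) 0) => uh; case: (leP u 0) => u0; apply/andP; split; nra.
Qed.

Lemma is_derive_cutoff (c t : R) :
  is_derive t 1 (cutoff c) (c * (- 2 * Num.max (1 - t) 0)).
Proof.
have d := is_deriveM (is_derive_cst c t (1 : R)) (is_derive_sqr_pos t).
refine (eq_ind _ (fun z : R => is_derive t 1 (cutoff c) z) d _ _).
by rewrite -![_ *: _]/(_ * _) mulr0 addr0.
Qed.

Lemma continuous_max1 : continuous (fun t : R => Num.max (1 - t) 0).
Proof.
move=> t; apply: (@continuous_max _ _ (fun t : R => 1 - t) (fun=> 0)).
  by apply: cvgB; [exact: cst_continuous|exact: cvg_id].
exact: cst_continuous.
Qed.

Lemma derive1_cutoff c t : derive1 (cutoff c) t = c * (- 2 * Num.max (1 - t) 0).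
Proof. by apply: is_derive_derive1; exact: is_derive_cutoff. Qed.

Lemma continuous_derive1_cutoff c : continuous (derive1 (cutoff c)).
Proof.
rewrite (_ : derive1 _ = fun t => c * (- 2 * Num.max (1 - t) 0)); last first.
  by apply/funext => t; exact: derive1_cutoff.
apply: continuous_mul; first by move=> t; exact: cst_continuous.
by apply: continuous_mul; [move=> t; exact: cst_continuous|exact: continuous_max1].
Qed.

End cutoff.

Lemma continuous_csub (R : realType) (T : topologicalType) (c : R) (f : T -> R) :
  continuous f -> continuous (fun x => c - f x).
Proof. by move=> fc x; apply: cvgB; [exact: cst_continuous|exact: fc]. Qed.

(** * From almost everywhere to everywhere; measurability of balls *)

Section density.
Variables (R : realType) (k : nat).
Local Notation n := k.+1.

(** The set where g > c is open. A point in it would give a box of positive volume inside a null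
    set. *)
Lemma ae_le_continuous (g : V R n -> R) (c : R) : continuous g ->
  Defs.ae R n (fun z => g z <= c) -> forall z, g z <= c.
Proof.
move=> gc [N [N0 NP]] z; rewrite leNgt; apply/negP => cz.
have oU : open (g @^-1` [set t | c < t]).
  by apply: open_comp; [move=> x _; exact: gc|exact: open_gt].
have UN : g @^-1` [set t | c < t] `<=` N.
  by move=> x /= cx; apply: contrapT => /NP; rewrite leNgt cx.
have [a [b [P UE]]] := open_boxes oU.
have : (g @^-1` [set t | c < t]) z by [].
rewrite UE => -[i Pi zi].
have bN : Defs.box R n (a i) (b i) `<=` N.
  by apply: subset_trans UN; rewrite UE => x xi; exists i.
have := @le_outer_measure _ _ (Defs.lebo R n) _ _ bN.
rewrite /= N0 lebo_box lee_fin leNgt => /negP; apply.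
apply: prodr_gt0 => j _; rewrite lt_max subr_gt0.
by have /andP[h1 h2] := zi j; rewrite (le_lt_trans h1 h2).
Qed.

(** As a supremum of continuous functions of y, the distance is lower semicontinuous; this already
    makes balls Borel. *)
Lemma closed_dist_le (C : V R n -> 'M[R]_n) x (t : \bar R) :
  closed [set y | (Defs.dist R n C x y <= t)%E].
Proof.
have -> : [set y | (Defs.dist R n C x y <= t)%E] =
  \bigcap_(psi in [set psi : V R n -> R |
      Defs.C1 R n psi /\ Defs.ae R n (fun z => Defs.Gam R n C psi z <= 1)])
     [set y | ((psi x - psi y)%:E <= t)%E].
  apply/seteqP; split=> y /=.
    by move=> h psi Hp; apply: le_trans h; apply: ereal_sup_ubound; exists psi.
  by move=> h; apply: ge_ereal_sup => _ [psi Hp <-]; exact: h.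
apply: closed_bigI => psi [pC _].
have c : continuous (fun y => (psi x - psi y)).
  exact: (@continuous_csub R 'rV[R]_n (psi x) psi (C1_continuous pC)).
case: t => [t| |].
- apply: (@preimage_closed _ _ (fun y => psi x - psi y) [set s | s <= t]).
    by move=> y _; exact: c.
  exact: closed_le.
- rewrite (_ : mkset _ = setT); first exact: closedT.
  by apply/seteqP; split=> // y _ /=; rewrite leey.
rewrite (_ : mkset _ = set0); first exact: closed0.
by apply/seteqP; split=> // y /=; rewrite leeNy_eq.
Qed.

Lemma measurable_Ball (C : V R n -> 'M[R]_n) x (r : R) :
  measurable (Defs.Ball R n C x r : set (Bo R n)).
Proof.
have -> : Defs.Ball R n C x r =
  \bigcup_(i in [set: nat]) [set y | (Defs.dist R n C x y <= (r - i.+1%:R^-1)%:E)%E].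
  apply/seteqP; split=> y; rewrite /Defs.Ball /=.
    case E: (Defs.dist R n C x y) => [d| |].
    - rewrite lte_fin => /ltr_add_invr[i ir]; exists i => //.
      by rewrite /= E lee_fin lerBrDr ltW.
    - by rewrite ltNge leey.
    - by move=> _; exists 0%N => //; rewrite /= E; exact: leNye.
  move=> [i _] /= h; apply: (le_lt_trans h); rewrite lte_fin gtrBl invr_gt0.
  by rewrite ltr0n.
apply: bigcupT_measurable => i; apply: closed_measurable_Bo; exact: closed_dist_le.
Qed.

End density.

(** * Upper bound for the distance *)

Section energy.
Variables (R : realType) (m : nat) (d1 d1' d2 d2' a a' : R).
Variable C : V R (1 + m) -> 'M[R]_(1 + m).
Hypotheses (d10 : 0 <= d1) (d1h : d1 < 2^-1) (d1'h : 2^-1 <= d1') (d1'1 : d1' < 1).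
Hypotheses (d20 : 0 <= d2) (d2'0 : 0 <= d2') (a0 : 0 < a) (a'0 : 0 < a').
Local Notation n := m.+1.
Local Notation C1 := (@Defs.C1 R _).
Local Notation partial := (@Defs.partial R _).
Local Notation F := (Gr d1 d1' 0).
Local Notation D := (Den d1 d1' 0).
Local Notation U := (wt (2 * d1) (2 * d1')).
Local Notation Vt := (wt (2 * d2) (2 * d2')).
Local Notation ae := (Defs.ae R n).

Let d1d1' : d1 <= d1'. Proof. exact: le_trans (ltW d1h) d1'h. Qed.
Let d1'0 : 0 < d1'. Proof. by apply: lt_le_trans d1'h; rewrite invr_gt0. Qed.
Let al0 : 0 <= 2 * d1. Proof. by rewrite mulr_ge0. Qed.
Let al'0 : 0 <= 2 * d1'. Proof. by rewrite mulr_ge0 // ltW. Qed.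
Let be0 : 0 <= 2 * d2. Proof. by rewrite mulr_ge0. Qed.
Let be'0 : 0 <= 2 * d2'. Proof. by rewrite mulr_ge0. Qed.

Definition vgrad2 (f : V R n -> R) (z : V R n) :=
  \sum_(j < m) partial (lift ord0 j) f z ^+ 2.

(** The form Gamma of the model matrix [Cdelta], a continuous substitute for [Gam]. *)
Definition energy (f : V R n -> R) (z : V R n) :=
  U (z ord0 ord0) * partial ord0 f z ^+ 2 + Vt (z ord0 ord0) * vgrad2 f z.

Lemma qf_Cdelta z xi : Defs.qf R (1 + m) (Defs.Cdelta R m d1 d1' d2 d2' z) xi =
  U (z ord0 ord0) * xi ord0 ^+ 2 +
  Vt (z ord0 ord0) * \sum_(j < m) xi (lift ord0 j) ^+ 2.
Proof.
rewrite /Defs.qf.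
have diag i : \sum_(j < 1 + m) xi i * Defs.Cdelta R m d1 d1' d2 d2' z i j * xi j =
    (if (i : nat) == 0%N then U (z ord0 ord0) else Vt (z ord0 ord0)) * xi i ^+ 2.
  rewrite (bigD1 i) //= big1 ?addr0; last first.
    by move=> j ji; rewrite mxE eq_sym (negbTE ji) mulr0 mul0r.
  by rewrite mxE eqxx expr2 mulrA (mulrC (xi i)) /wt; case: ifP.
under eq_bigr do rewrite diag.
rewrite big_ord_recl /=; congr (_ + _).
by rewrite mulr_sumr; apply: eq_bigr => j _.
Qed.

Lemma Gam_qf f z : Defs.Gam R (1 + m) C f z = Defs.qf R (1 + m) (C z) (fun i => partial i f z).
Proof.
by apply: eq_bigr => i _; apply: eq_bigr => j _; rewrite (mulrC (C z i j)).
Qed.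

Hypothesis HC : ae (fun x => forall xi : 'I_(1 + m) -> R,
      a * Defs.qf R (1 + m) (Defs.Cdelta R m d1 d1' d2 d2' x) xi <= Defs.qf R (1 + m) (C x) xi /\
      Defs.qf R (1 + m) (C x) xi <= a' * Defs.qf R (1 + m) (Defs.Cdelta R m d1 d1' d2 d2' x) xi).

Lemma Gam_energy : ae (fun z => forall f,
  a * energy f z <= Defs.Gam R (1 + m) C f z <= a' * energy f z).
Proof.
case: HC => N [N0 H]; exists N; split=> // z /H h f.
have [] := h (fun i => partial i f z).
by rewrite -Gam_qf qf_Cdelta => -> ->.
Qed.

Lemma continuous_energy f : C1 f -> continuous (energy f).
Proof.
move=> fC.
have h1 : continuous (fun z : 'rV[R]_n => U (z ord0 ord0) * partial ord0 f z ^+ 2).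
  apply: continuous_mul; first by apply: continuous_coord0; exact: continuous_wt.
  by apply: continuous_sqr; exact: (fC _).2.
have h2 : continuous (fun z : 'rV[R]_n => Vt (z ord0 ord0) * vgrad2 f z).
  apply: continuous_mul; first by apply: continuous_coord0; exact: continuous_wt.
  by apply: continuous_sum => j; apply: continuous_sqr; exact: (fC _).2.
by move=> z; exact: (cvgD (h1 z) (h2 z)).
Qed.

Lemma admissible_energy f z : C1 f -> ae (fun z => Defs.Gam R (1 + m) C f z <= 1) ->
  a * energy f z <= 1.
Proof.
move=> fC [N1 [N10 H1]]; have [N2 [N20 H2]] := Gam_energy.
rewrite -ler_pdivlMl // mulr1; move: z; apply: ae_le_continuous.
  exact: continuous_energy.
exists (N1 `|` N2); split.
  apply/eqP; rewrite eq_le (outer_measure_ge0 (Defs.lebo R n)) andbT.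
  have := outer_measureU2 (Defs.lebo R n) N1 N2.
  by rewrite /= N10 N20 adde0.
move=> z /not_orP[/H1 h1 /H2 /(_ f) /andP[h2 _]].
by rewrite -(mulr1 a^-1) ler_pdivlMl // (le_trans h2).
Qed.

Lemma vgrad2_ge0 f z : 0 <= vgrad2 f z.
Proof. by apply: sumr_ge0 => j _; exact: sqr_ge0. Qed.

Lemma sqr_le_bound (x K : R) : 0 <= K -> x ^+ 2 <= K ^+ 2 -> `|x| <= K.
Proof.
move=> K0; rewrite -(real_normK (num_real x)).
by rewrite ler_sqr ?nnegrE.
Qed.

Let sa0 : 0 < Num.sqrt a. Proof. by rewrite sqrtr_gt0. Qed.

Section admissible.
Variable psi : V R n -> R.
Hypothesis psiC : C1 psi.
Hypothesis psiE : forall z, a * energy psi z <= 1.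

(** The energy bounds the first partial derivative by 1 / sqrt(a U), hence by 2 / (sqrt(a) D) since
    D^2 <= 4 U, whereas F' >= (1 - d1') / D. *)
Lemma admissible_horizontal y s t :
  `|psi (consv t y) - psi (consv s y)| <= 2 / (Num.sqrt a * (1 - d1')) * `|F t - F s|.
Proof.
have e0 : 0 < 1 - d1' by rewrite subr_gt0.
wlog st : s t / s <= t.
  move=> H; have [st|ts] := orP (le_total s t); first exact: H.
  by rewrite distrC (distrC (F t)); exact: H.
set k := 2 / _.
have k0 : 0 < k by rewrite divr_gt0 // mulr_gt0.
rewrite (ger0_norm (x := F t - F s)) ?subr_ge0; last exact: Gr_nondecreasing.
have [dg cg] := C1_slice0 y psiC.
rewrite mulrBr.
apply: (@derive_dominated_le R (fun s => psi (consv s y)) (fun s => k * F s) s t st).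
- exact: (continuous_subspaceT (derivable1_continuous dg)).
- apply: continuous_subspaceT => x; apply: cvgM; first exact: cst_continuous.
  exact: continuous_Gr0.
move=> x _ x0; have A0 := sqrD0_gt0 x0.
have d := is_deriveM (is_derive_cst k x (1 : R)) (is_derive_Gr d1 d1' A0).
have {}d : is_derive x 1 (fun s => k * F s) (k * dGr d1 d1' 0 x).
  refine (eq_ind _ (fun z : R => is_derive x 1 (fun s => k * F s) z) d _ _).
  by rewrite -![_ *: _]/(_ * _) mulr0 addr0.
split; [exact: dg|exact: ex_derive|].
rewrite (is_derive_derive1 d) derive1_slice0.
have D0 : 0 < D x by exact: Den_gt0.
have /andP[h1 _] : (1 - d1') / D x <= dGr d1 d1' 0 x <= (D x)^-1 by exact: dGr_bounds.
apply: (@le_trans _ _ (k * ((1 - d1') / D x))); last by rewrite ler_pM2l.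
have -> : k * ((1 - d1') / D x) = 2 / (Num.sqrt a * D x).
  by rewrite /k; field; rewrite !gt_eqF.
apply: sqr_le_bound; first by rewrite divr_ge0 // mulr_ge0 // ltW.
rewrite expr_div_n exprMn sqr_sqrtr ?(ltW a0) // ler_pdivlMr ?mulr_gt0 ?exprn_gt0 //.
have /andP[_ h2] : U x <= D x ^+ 2 <= 4 * U x by exact: wt_Den0.
have := psiE (consv x y); rewrite /energy consv0.
have h3 := mulr_ge0 (ltW a0) (mulr_ge0 (wt_ge0 (2 * d2) (2 * d2') x) (vgrad2_ge0 psi (consv x y))).
have := ler_wpM2l (mulr_ge0 (ltW a0) (sqr_ge0 (partial ord0 psi (consv x y)))) h2.
lra.
Qed.

Lemma admissible_vertical s y y' : 0 < Vt s ->
  `|psi (consv s y) - psi (consv s y')| <=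
    (Num.sqrt a * Num.sqrt (Vt s))^-1 * \sum_(j < m) `|y ord0 j - y' ord0 j|.
Proof.
move=> V0; apply: (C1_lipschitz _ _ (C1_slice s psiC)) => j z.
rewrite partial_sliceS.
apply: sqr_le_bound; first by rewrite invr_ge0 mulr_ge0 // sqrtr_ge0.
rewrite exprVn exprMn sqr_sqrtr ?(ltW a0) // sqr_sqrtr ?(ltW V0) //.
rewrite -[leRHS]mul1r ler_pdivlMr ?mulr_gt0 //.
have := psiE (consv s z); rewrite /energy consv0.
have h3 : 0 <= a * (U s * partial ord0 psi (consv s z) ^+ 2).
  by rewrite mulr_ge0 ?(ltW a0) // mulr_ge0 ?sqr_ge0 // wt_ge0.
have h4 : partial (lift ord0 j) psi (consv s z) ^+ 2 <= vgrad2 psi (consv s z).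
  by rewrite /vgrad2 (bigD1 j) //= lerDl sumr_ge0 // => i _; exact: sqr_ge0.
have := ler_wpM2l (ltW (mulr_gt0 a0 V0)) h4.
lra.
Qed.

End admissible.

(** The path goes horizontally from x to the end slice e with |e| = M, vertically there, and
    horizontally to y. Each horizontal leg costs at most 2 rho times the constant of
    [admissible_horizontal]; m counts the vertical coordinates, each moved by at most the side
    length. *)
Lemma dist_le_box p q rho (x y : V R n) : p < q -> 0 < rho -> F q - F p = 2 * rho ->
  p <= x ord0 ord0 <= q -> p <= y ord0 ord0 <= q ->
  (forall j : 'I_m, `|x ord0 (lift ord0 j) - y ord0 (lift ord0 j)| <=
     rho * Num.sqrt (Vt (Num.max `|p| `|q|))) ->
  (Defs.dist R (1 + m) C x y <=
    ((8 / (Num.sqrt a * (1 - d1')) + m%:R / Num.sqrt a) * rho)%:E)%E.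
Proof.
move=> pq rho0 Fpq xI yI xyL; set M := Num.max _ _ in xyL.
have e0 : 0 < 1 - d1' by rewrite subr_gt0.
set K := 2 / (Num.sqrt a * (1 - d1')).
have K0 : 0 < K by rewrite divr_gt0 // mulr_gt0.
have M0 : 0 < M.
  rewrite /M lt_max !normr_gt0; case: eqVneq => //= p0; case: eqVneq => //= q0.
  by move: pq; rewrite p0 q0 ltxx.
have [e eI eM] : exists2 e, p <= e <= q & `|e| = M.
  rewrite /M; case: leP => _; [exists q|exists p] => //; rewrite lexx ltW //.
have VE : Vt e = Vt M by rewrite /wt eM (gtr0_norm M0).
have V0 : 0 < Vt e by rewrite VE; apply: wt_gt0; exact: lt0r_neq0.
have FI s t : p <= s <= q -> p <= t <= q -> `|F s - F t| <= 2 * rho.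
  move=> /andP[ps sq] /andP[pt tq].
  have h1 : F p <= F s by exact: Gr_nondecreasing.
  have h2 : F s <= F q by exact: Gr_nondecreasing.
  have h3 : F p <= F t by exact: Gr_nondecreasing.
  have h4 : F t <= F q by exact: Gr_nondecreasing.
  by rewrite ler_norml; apply/andP; split; lra.
apply: ge_ereal_sup => _ [psi [psiC psiA] <-]; rewrite lee_fin.
have psiE z := admissible_energy z psiC psiA.
rewrite -(consvK x) -(consvK y).
set s := x ord0 ord0 in xI *; set t := y ord0 ord0 in yI *.
have h1 := admissible_horizontal psiC psiE (tailv x) e s.
have h2 := admissible_vertical psiC psiE (tailv x) (tailv y) V0.
have h3 := admissible_horizontal psiC psiE (tailv y) t e.
have S : \sum_(j < m) `|tailv x ord0 j - tailv y ord0 j| <= m%:R * (rho * Num.sqrt (Vt e)).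
  rewrite VE -[m%:R](_ : \sum_(j < m) (1 : R) = _); last by rewrite sumr_const card_ord.
  by rewrite mulr_suml; apply: ler_sum => j _; rewrite mul1r !tailvE; exact: xyL.
have sV : 0 < Num.sqrt (Vt e) by rewrite sqrtr_gt0.
have {}h2 : `|psi (consv e (tailv x)) - psi (consv e (tailv y))| <= m%:R / Num.sqrt a * rho.
  apply: (le_trans h2).
  rewrite mulrC ler_pdivrMr ?mulr_gt0 //; apply: (le_trans S).
  by rewrite le_eqVlt; apply/orP; left; apply/eqP; field; rewrite !gt_eqF.
have {}h1 := le_trans h1 (ler_wpM2l (ltW K0) (FI _ _ xI eI)).
have {}h3 := le_trans h3 (ler_wpM2l (ltW K0) (FI _ _ eI yI)).
have -> : 8 / (Num.sqrt a * (1 - d1')) = 4 * K by rewrite /K; ring.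
move: h1 h2 h3; rewrite !ler_norml => /andP[_ h1] /andP[_ h2] /andP[_ h3].
lra.
Qed.

End energy.

(** * Lower bound for the distance *)

Section lower.
Variables (R : realType) (m : nat) (d1 d1' d2 d2' a a' : R).
Variable C : V R (1 + m) -> 'M[R]_(1 + m).
Hypotheses (d10 : 0 <= d1) (d1h : d1 < 2^-1) (d1'h : 2^-1 <= d1') (d1'1 : d1' < 1).
Hypotheses (d20 : 0 <= d2) (d2'0 : 0 <= d2') (a0 : 0 < a) (a'0 : 0 < a').
Local Notation n := m.+1.
Local Notation C1 := (@Defs.C1 R _).
Local Notation partial := (@Defs.partial R _).
Local Notation F := (Gr d1 d1' 0).
Local Notation D := (Den d1 d1' 0).
Local Notation U := (wt (2 * d1) (2 * d1')).
Local Notation Vt := (wt (2 * d2) (2 * d2')).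
Local Notation ae := (Defs.ae R n).
Local Notation energy := (energy d1 d1' d2 d2').

Let d1d1' : d1 <= d1'. Proof. exact: le_trans (ltW d1h) d1'h. Qed.
Let d1'0 : 0 < d1'. Proof. by apply: lt_le_trans d1'h; rewrite invr_gt0. Qed.
Let be0 : 0 <= 2 * d2. Proof. by rewrite mulr_ge0. Qed.
Let be'0 : 0 <= 2 * d2'. Proof. by rewrite mulr_ge0. Qed.

Hypothesis HC : ae (fun x => forall xi : 'I_(1 + m) -> R,
      a * Defs.qf R (1 + m) (Defs.Cdelta R m d1 d1' d2 d2' x) xi <= Defs.qf R (1 + m) (C x) xi /\
      Defs.qf R (1 + m) (C x) xi <= a' * Defs.qf R (1 + m) (Defs.Cdelta R m d1 d1' d2 d2' x) xi).

Definition sqdev (f : R -> R) (c k t : R) := (k * (f t - c)) ^+ 2.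

Lemma is_derive_sqdev f (c k t : R) : derivable f t 1 ->
  is_derive t 1 (sqdev f c k) (2 * k ^+ 2 * (f t - c) * derive1 f t).
Proof.
move=> df; have d := is_deriveB (derivable_is_derive df) (is_derive_cst c t (1 : R)).
have dk := is_deriveM (is_derive_cst k t (1 : R)) d.
have dd := is_deriveM dk dk.
rewrite (_ : sqdev f c k = (cst k * (f - cst c)) * (cst k * (f - cst c))); last first.
  by apply/funext => s; rewrite /sqdev !fctE expr2.
refine (eq_ind _ (fun z : R => is_derive t 1 _ z) dd _ _).
rewrite !fctE -![_ *: _]/(_ * _); ring.
Qed.

Lemma derive1_sqdev f (c k t : R) : derivable f t 1 ->
  derive1 (sqdev f c k) t = 2 * k ^+ 2 * (f t - c) * derive1 f t.
Proof. by move=> df; apply: is_derive_derive1; exact: is_derive_sqdev. Qed.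

Lemma continuous_derive1_sqdev f c k : (forall t : R, derivable f t (1 : R)) ->
  continuous (derive1 f) -> continuous (derive1 (sqdev f c k)).
Proof.
move=> df cf; rewrite (_ : derive1 _ = fun t => 2 * k ^+ 2 * (f t - c) * derive1 f t); last first.
  by apply/funext => t; exact: derive1_sqdev.
apply: continuous_mul => //; apply: continuous_mul; first by move=> t; exact: cst_continuous.
by move=> t; apply: cvgB; [exact: derivable1_cvg|exact: cst_continuous].
Qed.

(** With tolerance rho / 4 at both ends, a horizontal distance rho remains at least rho / 2 after
    regularisation. *)
Lemma regularization_near (p x q rho : R) : 0 < rho -> exists2 eta, 0 < eta &
  [/\ `|Gr d1 d1' eta p - F p| < rho / 4, `|Gr d1 d1' eta x - F x| < rho / 4 &
      `|Gr d1 d1' eta q - F q| < rho / 4].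
Proof.
move=> rho0; have e0 : 0 < rho / 4 by rewrite divr_gt0.
have h1 := Gr_eta_cvg d1 d1' p e0.
have h2 := Gr_eta_cvg d1 d1' x e0.
have h3 := Gr_eta_cvg d1 d1' q e0.
have : \forall eta \near (0 : R)^'+, 0 < eta /\
  [/\ `|Gr d1 d1' eta p - F p| < rho / 4, `|Gr d1 d1' eta x - F x| < rho / 4 &
      `|Gr d1 d1' eta q - F q| < rho / 4].
  near=> eta; split; first by near: eta; exact: nbhs_right_gt.
  by split; near: eta; [exact: h1|exact: h2|exact: h3].
by move=> /filter_ex[eta [eta0 H]]; exists eta.
Unshelve. all: by end_near.
Qed.

(** Uniform in [eta]: dGr is at most 1 / Den eta, and (Den eta)^2 >= (Den 0)^2 >= U. *)
Lemma wt_dGr_le1 eta s : 0 < eta -> U s * dGr d1 d1' eta s ^+ 2 <= 1.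
Proof.
move=> eta0; have A0 : 0 < s ^+ 2 + eta by rewrite ltr_wpDl // sqr_ge0.
have /andP[h1 h2] : (1 - d1') / Den d1 d1' eta s <= dGr d1 d1' eta s <= (Den d1 d1' eta s)^-1.
  by apply: dGr_bounds => //; exact: ltW.
have D0 : 0 < Den d1 d1' eta s by exact: Den_gt0.
have g0 : 0 <= dGr d1 d1' eta s.
  by apply: le_trans h1; rewrite divr_ge0 ?(ltW D0) // subr_ge0 ltW.
have UD : U s <= Den d1 d1' eta s ^+ 2.
  have /andP[h _] : U s <= D s ^+ 2 <= 4 * U s by exact: wt_Den0.
  apply: (le_trans h); rewrite lerXn2r ?nnegrE ?Den_ge0 //.
  by apply: Den_ge_Den0 => //; exact: ltW.
apply: (@le_trans _ _ (Den d1 d1' eta s ^+ 2 * (Den d1 d1' eta s)^-1 ^+ 2)).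
  apply: ler_pM; rewrite ?sqr_ge0 ?wt_ge0 //.
  by rewrite lerXn2r ?nnegrE // invr_ge0 ltW.
by rewrite -exprMn divff ?expr1n // gt_eqF.
Qed.

Section bump.
Variables (x : V R n) (p q rho kappa eta : R).
Local Notation x1 := (x ord0 ord0).
Local Notation M := (Num.max `|p| `|q|).
Local Notation h := (Gr d1 d1' eta).
Let L := rho * Num.sqrt (Vt M).
Hypotheses (rho0 : 0 < rho) (pq : p < q) (kappa0 : 0 < kappa)
  (kappa1 : 80 * a' * kappa ^+ 2 <= 1) (eta0 : 0 < eta).
Hypotheses (hp : h x1 - h p >= rho / 2) (hq : h q - h x1 >= rho / 2).

(** The factors 2 / rho and [L^-1] bring a summand to 1 once the regularised coordinate has moved by
    rho / 2, or a vertical one by [L]. *)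
Let coordfun (i : 'I_n) : R -> R :=
  if unlift ord0 i is Some j then sqdev id (x ord0 (lift ord0 j)) L^-1
  else sqdev h (h x1) (2 / rho).

Let S (z : V R n) := \sum_i coordfun i (z ord0 i).
Definition bump (z : V R n) := cutoff (kappa * rho) (S z).

Let dh t : derivable h t 1.
Proof. by apply: derivable_Gr; rewrite ltr_wpDl // sqr_ge0. Qed.

Let dhE : derive1 h = dGr d1 d1' eta.
Proof. by apply/funext => t; apply: derive1_Gr; rewrite ltr_wpDl // sqr_ge0. Qed.

Let ch : continuous (derive1 h).
Proof. by rewrite dhE; exact: continuous_dGr. Qed.

Let did t : derivable (@id R) t 1. Proof. exact: derivable_id. Qed.

Let did1 : derive1 (@id R) = cst 1.
Proof. by apply/funext => t; rewrite derive1E derive_id. Qed.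

Let cid1 : continuous (derive1 (@id R)).
Proof. by rewrite did1 => t; exact: cst_continuous. Qed.

Let coordfun_derivable i (t : R) : derivable (coordfun i) t (1 : R).
Proof.
rewrite /coordfun; case: unlift => [j|].
  have d := is_derive_sqdev (x ord0 (lift ord0 j)) L^-1 (@did t); exact: ex_derive.
have d := is_derive_sqdev (h x1) (2 / rho) (@dh t); exact: ex_derive.
Qed.

Let coordfun_C1 i : continuous (derive1 (coordfun i)).
Proof.
rewrite /coordfun; case: unlift => [j|].
  exact: (@continuous_derive1_sqdev id (x ord0 (lift ord0 j)) L^-1 did cid1).
exact: (@continuous_derive1_sqdev h (h x1) (2 / rho) dh ch).
Qed.

Let cutoff_derivable (t : R) : derivable (cutoff (kappa * rho)) t (1 : R).
Proof. have d := is_derive_cutoff (kappa * rho) t; exact: ex_derive. Qed.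

Lemma bump_C1 : C1 bump.
Proof.
exact: (separable_C1 cutoff_derivable (@continuous_derive1_cutoff R _)
  coordfun_derivable coordfun_C1).
Qed.

Let T z := kappa * rho * (- 2 * Num.max (1 - S z) 0).

Lemma bump_partial0 z : partial ord0 bump z =
  T z * (2 * (2 / rho) ^+ 2 * (h (z ord0 ord0) - h x1) * dGr d1 d1' eta (z ord0 ord0)).
Proof.
rewrite /bump (separable_partial cutoff_derivable coordfun_derivable) derive1_cutoff.
by congr (_ * _); rewrite /coordfun unlift_none derive1_sqdev // dhE.
Qed.

Lemma bump_partialS z j : partial (lift ord0 j) bump z =
  T z * (2 * L^-1 ^+ 2 * (z ord0 (lift ord0 j) - x ord0 (lift ord0 j))).
Proof.
rewrite /bump (separable_partial cutoff_derivable coordfun_derivable) derive1_cutoff.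
by congr (_ * _); rewrite /coordfun liftK derive1_sqdev // did1 mulr1.
Qed.

Let SE z : S z = (2 / rho * (h (z ord0 ord0) - h x1)) ^+ 2 +
  \sum_(j < m) (L^-1 * (z ord0 (lift ord0 j) - x ord0 (lift ord0 j))) ^+ 2.
Proof.
rewrite /S big_ord_recl /coordfun unlift_none; congr (_ + _).
by apply: eq_bigr => j _; rewrite liftK.
Qed.

Let M0 : 0 < M.
Proof.
rewrite lt_max !normr_gt0; case: eqVneq => //= p0; case: eqVneq => //= q0.
by move: pq; rewrite p0 q0 ltxx.
Qed.

Let VM0 : 0 < Vt M. Proof. by apply: wt_gt0; exact: lt0r_neq0. Qed.

Let L0 : 0 < L. Proof. by rewrite mulr_gt0 // sqrtr_gt0. Qed.

Let hnd s t : s <= t -> h s <= h t.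
Proof. by move=> st; apply: Gr_nondecreasing => //; exact: ltW. Qed.

(** The constant is 80 = 64 + 16. The derivative of the cut-off is at most 2 kappa rho. The
    horizontal term then gives 64 by [wt_dGr_le1]; the vertical one gives 16, because the factor Vt
    M in L^2 absorbs the vertical weight. *)
Lemma bump_energy z : energy bump z <= 80 * kappa ^+ 2.
Proof.
set z1 := z ord0 ord0.
set A := (2 / rho * (h z1 - h x1)) ^+ 2.
set B := \sum_(j < m) (L^-1 * (z ord0 (lift ord0 j) - x ord0 (lift ord0 j))) ^+ 2.
have A0 : 0 <= A by exact: sqr_ge0.
have B0 : 0 <= B by apply: sumr_ge0 => j _; exact: sqr_ge0.
have k2 : 0 <= kappa ^+ 2 by exact: sqr_ge0.
have E1 : partial ord0 bump z ^+ 2 = T z ^+ 2 * (16 / rho ^+ 2) * A * dGr d1 d1' eta z1 ^+ 2.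
  by rewrite bump_partial0 /A -/z1; field; rewrite gt_eqF.
have E2 : vgrad2 bump z = T z ^+ 2 * (4 * L^-1 ^+ 2) * B.
  rewrite /vgrad2 /B mulr_sumr; apply: eq_bigr => j _; rewrite bump_partialS.
  by field; rewrite gt_eqF.
rewrite /energy -/z1 E1 E2.
have [S1|S1] := leP 1 (S z).
  have T0 : T z = 0 by rewrite /T (max_idPr _) ?mulr0 // subr_le0.
  by rewrite T0 expr0n /= !mul0r !mulr0 addr0 mulr_ge0.
have SAB : A + B < 1 by rewrite -SE.
have T2 : T z ^+ 2 <= 4 * kappa ^+ 2 * rho ^+ 2.
  rewrite /T (max_idPl _) ?subr_ge0 ?(ltW S1) // SE -/A -/B.
  have -> : (kappa * rho * (- 2 * (1 - (A + B)))) ^+ 2 =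
    4 * kappa ^+ 2 * rho ^+ 2 * (1 - (A + B)) ^+ 2 by ring.
  apply: ler_piMr; first by rewrite mulr_ge0 ?sqr_ge0 // mulr_ge0.
  by rewrite expr_le1 //; lra.
have A1 : A < 1 by lra.
(* A < 1 keeps h z1 within rho / 2 of h x1, so z1 stays in [p, q] by monotonicity of h. *)
have zI : `|z1| <= M.
  have : `|2 / rho * (h z1 - h x1)| < 1.
    by rewrite -(@expr_lt1 _ 2) // -normrX ger0_norm.
  rewrite normrM (gtr0_norm (divr_gt0 _ rho0)) // mulrC mulrA ltr_pdivrMr // mul1r => hz.
  have {}hz : `|h z1 - h x1| < rho / 2 by lra.
  move: hz; rewrite ltr_norml => /andP[z2 z3].
  have pz : p <= z1 by rewrite leNgt; apply/negP => /ltW/hnd; have := hp; lra.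
  have zq : z1 <= q by rewrite leNgt; apply/negP => /ltW/hnd; have := hq; lra.
  rewrite le_max; apply/orP; have [s0|s0] := leP 0 z1.
    by right; rewrite (ger0_norm s0) (le_trans zq) // ler_norm.
  by left; rewrite (ltr0_norm s0) -(normrN p) (le_trans _ (ler_norm _)) // lerN2.
have Vz : Vt z1 <= Vt M by apply: wt_le => //; rewrite (gtr0_norm M0).
have part1 : U z1 * (T z ^+ 2 * (16 / rho ^+ 2) * A * dGr d1 d1' eta z1 ^+ 2) <= 64 * kappa ^+ 2.
  have -> : U z1 * (T z ^+ 2 * (16 / rho ^+ 2) * A * dGr d1 d1' eta z1 ^+ 2) =
    (T z ^+ 2 * (16 / rho ^+ 2)) * (A * (U z1 * dGr d1 d1' eta z1 ^+ 2)) by ring.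
  have h1 : A * (U z1 * dGr d1 d1' eta z1 ^+ 2) <= 1.
    have h2 := wt_dGr_le1 z1 eta0.
    have h3 : 0 <= U z1 * dGr d1 d1' eta z1 ^+ 2 by rewrite mulr_ge0 ?sqr_ge0 ?wt_ge0.
    by apply: mulr_ile1 => //; exact: ltW.
  have r0 : 0 < 16 / rho ^+ 2 by rewrite divr_gt0 // exprn_gt0.
  have h4 := ler_wpM2r (ltW r0) T2.
  have h5 : 0 <= T z ^+ 2 * (16 / rho ^+ 2) by rewrite mulr_ge0 ?sqr_ge0 // ltW.
  have := ler_wpM2l h5 h1; rewrite mulr1 => h6; apply: (le_trans h6); apply: (le_trans h4).
  by rewrite le_eqVlt; apply/orP; left; apply/eqP; field; rewrite gt_eqF.
have part2 : Vt z1 * (T z ^+ 2 * (4 * L^-1 ^+ 2) * B) <= 16 * kappa ^+ 2.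
  apply: (@le_trans _ _ (Vt M * (4 * kappa ^+ 2 * rho ^+ 2 * (4 * L^-1 ^+ 2) * 1))).
    have t1 : 0 <= T z ^+ 2 by exact: sqr_ge0.
    have t2 : 0 <= 4 * L^-1 ^+ 2 by apply: mulr_ge0 => //; exact: sqr_ge0.
    have t3 := mulr_ge0 t1 t2.
    apply: ler_pM => //; [exact: wt_ge0|exact: mulr_ge0|].
    by apply: ler_pM => //; [exact: ler_wpM2r|lra].
  rewrite le_eqVlt; apply/orP; left; apply/eqP.
  rewrite exprVn /L exprMn sqr_sqrtr ?(ltW VM0) //.
  by field; rewrite !gt_eqF.
lra.
Qed.

Lemma bump_admissible : ae (fun z => Defs.Gam R (1 + m) C bump z <= 1).
Proof.
have [N [N0 H]] := Gam_energy HC; exists N; split=> // z /H /(_ bump) /andP[_ h1].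
apply: (le_trans h1); have := ler_wpM2l (ltW a'0) (bump_energy z); have := kappa1; lra.
Qed.

Lemma bump_center : bump x = kappa * rho.
Proof.
rewrite /bump /cutoff SE subrr mulr0 expr0n /= add0r big1 ?subr0.
  by rewrite (max_idPl _) // expr1n mulr1.
by move=> j _; rewrite subrr mulr0 expr0n.
Qed.

Lemma bump_outside y : ~ slab p q (cube (tailv x) L) y -> bump y = 0.
Proof.
move=> yQ; rewrite /bump /cutoff (max_idPr _) ?expr0n ?mulr0 // subr_le0 SE.
set A := (_ * (h _ - _)) ^+ 2; set B := \sum_(_ < _) _.
have A0 : 0 <= A by exact: sqr_ge0.
have B0 : 0 <= B by apply: sumr_ge0 => j _; exact: sqr_ge0.
have r2 : 0 < 2 / rho by rewrite divr_gt0.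
have half t : rho / 2 <= t -> 1 <= 2 / rho * t.
  by move=> ht; have := ler_wpM2l (ltW r2) ht; rewrite mulrA divfK ?gt_eqF // divff.
have [yI|yI] := boolP (p <= y ord0 ord0 <= q); last first.
  suff : 1 <= A by lra.
  rewrite /A -(real_normK (num_real _)) expr_ge1 // normrM (gtr0_norm r2); apply: half.
  move: yI; rewrite negb_and -!ltNge => /orP[/ltW/hnd yp|/ltW/hnd yq].
    by rewrite distrC; apply: le_trans (ler_norm _); have := hp; lra.
  by apply: le_trans (ler_norm _); have := hq; lra.
have [j yj] : exists j : 'I_m, L < `|y ord0 (lift ord0 j) - x ord0 (lift ord0 j)|.
  apply: contrapT => nj; apply: yQ; split=> // j; rewrite !tailvE.
  have : `|y ord0 (lift ord0 j) - x ord0 (lift ord0 j)| <= L.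
    by rewrite leNgt; apply/negP => yj; apply: nj; exists j.
  by rewrite ler_norml => /andP[? ?]; apply/andP; split; lra.
suff : 1 <= B by lra.
rewrite /B (bigD1 j) //= -[1]addr0 lerD //; last by apply: sumr_ge0 => i _; exact: sqr_ge0.
rewrite -(real_normK (num_real _)) expr_ge1 // normrM normfV (gtr0_norm L0) mulrC ler_pdivlMr //.
by rewrite mul1r ltW.
Qed.

End bump.

Lemma dist_ge_box (x y : V R n) p q rho kappa : 0 < rho -> p < q -> 0 < kappa ->
  80 * a' * kappa ^+ 2 <= 1 ->
  F q - F (x ord0 ord0) = rho -> F (x ord0 ord0) - F p = rho ->
  ~ slab p q (cube (tailv x) (rho * Num.sqrt (Vt (Num.max `|p| `|q|)))) y ->
  ((kappa * rho)%:E <= Defs.dist R (1 + m) C x y)%E.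
Proof.
move=> rho0 pq kappa0 kappa1 Fq Fp yQ.
have [eta eta0 []] := regularization_near p (x ord0 ord0) q rho0.
rewrite !ltr_norml => /andP[? ?] /andP[? ?] /andP[? ?].
have hp : Gr d1 d1' eta (x ord0 ord0) - Gr d1 d1' eta p >= rho / 2 by lra.
have hq : Gr d1 d1' eta q - Gr d1 d1' eta (x ord0 ord0) >= rho / 2 by lra.
apply: ereal_sup_ubound; exists (bump x p q rho kappa eta).
  by split; [exact: bump_C1|exact: bump_admissible].
by rewrite bump_center // bump_outside // subr0.
Qed.

End lower.

(** * Variance and energy integrals *)

Section variance.
Context d (T : measurableType d) (R : realType) (mu : {measure set T -> \bar R}).
Variables (D : set T) (f : T -> R) (M : R).
Hypotheses (mD : measurable D) (muD : (mu D < +oo)%E) (mf : measurable_fun D f).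
Hypothesis fM : forall x, D x -> `|f x| <= M.
Local Open Scope ereal_scope.

Let bounded_integrable (g : T -> R) (K : R) : measurable_fun D g ->
  (forall x, D x -> (`|g x| <= K)%R) -> mu.-integrable D (EFin \o g).
Proof.
move=> mg gK; apply: measurable_bounded_integrable => //.
exists K; split; first exact: num_real.
by move=> x Kx y Dy; exact: le_trans (gK y Dy) (ltW Kx).
Qed.

Let If : mu.-integrable D (EFin \o f).
Proof. exact: bounded_integrable fM. Qed.

Let If2 : mu.-integrable D (EFin \o (fun x => f x ^+ 2)%R).
Proof.
apply: (@bounded_integrable _ (M ^+ 2)%R); first exact: measurable_funX.
move=> x Dx; rewrite normrX lerXn2r ?nnegrE //; last exact: fM.
exact: le_trans (fM Dx).
Qed.

Lemma integral_sqr_sub (c : R) :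
  \int[mu]_(x in D) ((f x - c) ^+ 2)%:E =
  (fine (\int[mu]_(x in D) (f x ^+ 2)%:E) - 2 * c * fine (\int[mu]_(x in D) (f x)%:E)
    + c ^+ 2 * fine (mu D))%:E.
Proof.
have muDf : mu D \is a fin_num by rewrite ge0_fin_numE.
have Ic : mu.-integrable D (EFin \o (fun x => (- (2 * c)) * f x)%R).
  rewrite (_ : EFin \o _ = fun x => (- (2 * c))%:E * (EFin \o f) x).
    exact: integrableZl.
  by apply/funext => x /=; rewrite EFinM.
have Icc : mu.-integrable D (EFin \o (fun=> c ^+ 2)%R).
  apply: (@bounded_integrable _ (`|c ^+ 2|)%R) => //; exact: measurable_cst.
transitivity (\int[mu]_(x in D)
    (((EFin \o (fun x => f x ^+ 2)%R) x + (EFin \o (fun x => (- (2 * c)) * f x)%R) x)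
     + (EFin \o (fun=> c ^+ 2)%R) x)).
  by apply: eq_integral => x _ /=; rewrite -!EFinD; congr EFin; ring.
rewrite integralD //; last exact: integrableD.
rewrite integralD //.
have -> : \int[mu]_(x in D) (EFin \o (fun x => (- (2 * c)) * f x)%R) x =
    (- (2 * c))%:E * \int[mu]_(x in D) (f x)%:E.
  by rewrite -integralZl //; apply: eq_integral => x _ /=; rewrite EFinM.
have -> : \int[mu]_(x in D) (EFin \o (fun=> c ^+ 2)%R) x = (c ^+ 2)%:E * mu D.
  exact: integral_cst.
rewrite -[X in X + _ + _](fineK (integrable_fin_num mD If2)).
rewrite -[X in _ + _ * X + _](fineK (integrable_fin_num mD If)).
rewrite -{1}[mu D](fineK muDf) -!EFinM -!EFinD /=; congr EFin.
by rewrite mulNr.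
Qed.

Lemma variance_le (c : R) :
  \int[mu]_(x in D) ((f x - fine (\int[mu]_(x in D) (f x)%:E) / fine (mu D)) ^+ 2)%:E <=
  \int[mu]_(x in D) ((f x - c) ^+ 2)%:E.
Proof.
have muDf : mu D \is a fin_num by rewrite ge0_fin_numE.
rewrite !integral_sqr_sub lee_fin.
(* On a null set the quotient is 0 by convention, and both sides reduce to the integral of f^2. *)
have [D0|D0] := eqVneq (mu D) 0.
  have -> : \int[mu]_(x in D) (f x)%:E = 0.
    by apply: null_set_integral => //; apply/measurable_EFinP.
  by rewrite D0 /= !mulr0.
have b0 : (0 < fine (mu D))%R.
  by rewrite fine_gt0 // lt_neqAle eq_sym D0 measure_ge0 /= ltey_eq muDf.
move: b0; set b := fine (mu D); set I1 := fine (\int[mu]_(x in D) (f x)%:E).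
set I2 := fine (\int[mu]_(x in D) (f x ^+ 2)%:E) => b0.
rewrite -subr_ge0.
have -> : (I2 - 2 * c * I1 + c ^+ 2 * b - (I2 - 2 * (I1 / b) * I1 + (I1 / b) ^+ 2 * b) =
  b * (c - I1 / b) ^+ 2)%R by field; rewrite gt_eqF.
by rewrite mulr_ge0 ?sqr_ge0 // ltW.
Qed.

End variance.

Section slab_bounds.
Variables (R : realType) (m : nat) (p q L : R) (y : V R m).
Local Notation n := m.+1.

Let lo (i : 'I_n) := if unlift ord0 i is Some j then y ord0 j - L else p.
Let hi (i : 'I_n) := if unlift ord0 i is Some j then y ord0 j + L else q.

Let slab_lohi (z : V R n) : slab p q (cube y L) z -> forall i, lo i <= z ord0 i <= hi i.
Proof.
move=> [z0 zS] i; case: (unliftP ord0 i) => [j|] ->; rewrite /lo /hi ?liftK ?unlift_none //.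
by have := zS j; rewrite tailvE.
Qed.

Lemma lebo_slab_lty (B : set (V R n)) : B `<=` slab p q (cube y L) ->
  (Defs.lebo R n B < +oo)%E.
Proof.
(* The upper corner grows by 1 because boxes are half-open and slabs closed. *)
move=> BQ; have BB : B `<=` Defs.box R n lo (fun i => hi i + 1).
  by move=> z /BQ/slab_lohi H i; have /andP[-> h] := H i; rewrite (le_lt_trans h) // ltrDl.
apply: le_lt_trans (le_outer_measure (Defs.lebo R n) _ _ BB) _.
by rewrite /= lebo_box ltry.
Qed.

Lemma continuous_bounded_slab (f : 'rV[R]_n -> R) : continuous f ->
  exists M, forall z, slab p q (cube y L) z -> `|f z| <= M.
Proof.
move=> fc; have cK := @rV_compact R n (fun i => `[lo i, hi i]%classic)
  (fun i => @segment_compact R (lo i) (hi i)).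
have := @continuous_compact _ _ f _ (continuous_subspaceT fc) cK.
move=> /compact_bounded[M [_ HM]]; exists (`|M| + 1) => z zQ.
apply: (HM (`|M| + 1)); first by rewrite (le_lt_trans (ler_norm M)) // ltrDl.
exists z => // i; have := slab_lohi zQ i; by rewrite /= in_itv.
Qed.

End slab_bounds.

(** * Comparison of the integral of Gamma with the energy integral *)

Section Gam_integral.
Variables (R : realType) (m : nat) (d1 d1' d2 d2' a a' : R).
Variable C : V R (1 + m) -> 'M[R]_(1 + m).
Hypotheses (d10 : 0 <= d1) (d1h : d1 < 2^-1) (d1'h : 2^-1 <= d1') (d1'1 : d1' < 1).
Hypotheses (d20 : 0 <= d2) (d2'0 : 0 <= d2') (a0 : 0 < a) (a'0 : 0 < a').
Local Notation n := m.+1.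
Local Notation C1 := (@Defs.C1 R _).
Local Notation partial := (@Defs.partial R _).
Local Notation energy := (@energy R m d1 d1' d2 d2').

Hypothesis mC : forall i j, measurable_fun setT (fun x : Defs.Leb R (1 + m) => C x i j).
Hypothesis HC : Defs.ae R n (fun x => forall xi : 'I_(1 + m) -> R,
      a * Defs.qf R (1 + m) (Defs.Cdelta R m d1 d1' d2 d2' x) xi <= Defs.qf R (1 + m) (C x) xi /\
      Defs.qf R (1 + m) (C x) xi <= a' * Defs.qf R (1 + m) (Defs.Cdelta R m d1 d1' d2 d2' x) xi).

Lemma energy_ge0 f z : 0 <= energy f z.
Proof. by rewrite addr_ge0 // mulr_ge0 ?wt_ge0 ?sqr_ge0 ?vgrad2_ge0. Qed.

Lemma continuous_measurable_Leb (f : V R n -> R) : continuous f ->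
  measurable_fun setT (f : Defs.Leb R n -> R).
Proof.
by move=> fc; apply: measurable_Bo_Leb => //; exact: continuous_measurable_Bo.
Qed.

Lemma measurable_Gam f : C1 f ->
  measurable_fun setT (Defs.Gam R n C f : Defs.Leb R n -> R).
Proof.
move=> fC; rewrite /Defs.Gam.
apply: (@measurable_sum _ (Defs.Leb R n)) => i.
apply: (@measurable_sum _ (Defs.Leb R n)) => j.
apply: measurable_funM; last by apply: continuous_measurable_Leb; exact: (fC j).2.
apply: measurable_funM; last by apply: continuous_measurable_Leb; exact: (fC i).2.
exact: mC.
Qed.

(** The passage from [Leb] to the Borel measure [nu]: only the continuous energy has to cross it. *)
Lemma Lint_Gam_ge (B : set (V R n)) f : measurable (B : set (Bo R n)) -> C1 f ->
  (a%:E * \int[@nu R n]_(z in B) (energy f z)%:E <=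
   Defs.Lint R n B (fun z => (Defs.Gam R n C f z)%:E))%E.
Proof.
move=> mB fC.
have cE : continuous (energy f) by apply: continuous_energy.
have mB' := Bo_Leb mB.
have mG : measurable_fun (B : set (Defs.Leb R n)) (Defs.Gam R n C f : Defs.Leb R n -> R).
  by apply: measurable_funTS; exact: measurable_Gam.
have mE : measurable_fun (B : set (Defs.Leb R n)) ((fun z => a * energy f z) : Defs.Leb R n -> R).
  apply: measurable_funTS; apply: measurable_funM; first exact: measurable_cst.
  exact: continuous_measurable_Leb.
have E0 z : 0 <= a * energy f z by rewrite mulr_ge0 ?energy_ge0 // ltW.
(* [Gam] is nonnegative only almost everywhere, so it is replaced by a maximum. *)
pose G' z := Num.max (Defs.Gam R n C f z) (a * energy f z).
have mG' : measurable_fun (B : set (Defs.Leb R n)) (G' : Defs.Leb R n -> R).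
  exact: measurable_maxr.
have -> : Defs.Lint R n B (fun z => (Defs.Gam R n C f z)%:E) =
    Defs.Lint R n B (fun z => (G' z)%:E).
  apply: (@ae_eq_integral _ _ _ (Defs.lebo R n : set (Defs.Leb R n) -> \bar R)) => //.
  - exact/measurable_EFinP.
  - exact/measurable_EFinP.
  have [N [N0 H]] := Gam_energy HC.
  exists N; split=> //; first exact: lebo_null_measurable.
  move=> z /= nz; apply: contrapT => /H /(_ f) /andP[h _]; apply: nz => _.
  by rewrite /G' (max_idPl h).
apply: (@le_trans _ _ (Defs.Lint R n B (fun z => (a * energy f z)%:E))).
  rewrite Lint_nu //.
  - rewrite le_eqVlt; apply/orP; left; apply/eqP; rewrite -ge0_integralZl_EFin ?(ltW a0) //.
    + by move=> z _; rewrite lee_fin energy_ge0.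
    + by apply: measurable_funTS; exact: measurable_EFin_continuous.
  - apply: measurable_funTS; apply: measurable_EFin_continuous.
    apply: (@continuous_mul R 'rV[R]_n (fun=> a)) => // z; exact: cst_continuous.
  - by move=> z _; rewrite lee_fin E0.
apply: (@ge0_le_integral _ _ _ (Defs.lebo R n : set (Defs.Leb R n) -> \bar R)) => //.
- by move=> z _; rewrite lee_fin.
- exact/measurable_EFinP.
- exact/measurable_EFinP.
by move=> z _; rewrite lee_fin /G' le_max lexx orbT.
Qed.

End Gam_integral.

(** * The inequality on boxes and on balls *)

Section box_poincare.
Variables (R : realType) (m : nat) (d1 d1' d2 d2' : R).
Hypotheses (d10 : 0 <= d1) (d1h : d1 < 2^-1) (d1'h : 2^-1 <= d1') (d1'1 : d1' < 1).
Hypotheses (d20 : 0 <= d2) (d2'0 : 0 <= d2').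
Local Notation n := m.+1.
Local Notation C1 := (@Defs.C1 R _).
Local Notation nu := (@nu R n).
Local Notation F := (Gr d1 d1' 0).
Local Notation U := (wt (2 * d1) (2 * d1')).
Local Notation Vt := (wt (2 * d2) (2 * d2')).
Local Notation energy := (@energy R m d1 d1' d2 d2').
Local Notation Q p q rho y := (slab p q (cube y (rho * Num.sqrt (Vt (Num.max `|p| `|q|))))).

Let be0 : 0 <= 2 * d2. Proof. by rewrite mulr_ge0. Qed.
Let be'0 : 0 <= 2 * d2'. Proof. by rewrite mulr_ge0. Qed.
Let al0 : 0 <= 2 * d1. Proof. by rewrite mulr_ge0. Qed.
Let al'0 : 0 <= 2 * d1'.
Proof. by rewrite mulr_ge0 // (le_trans _ d1'h) // invr_ge0. Qed.

(** Both terms of [tensor_poincare] scale like rho^2: the horizontal one by [interval_weight],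
    through which alone rmax enters, the vertical one because L^2 = rho^2 Vt M. *)
Lemma box_poincare (rmax : R) : 0 < rmax -> exists2 K, 0 < K &
  forall p q rho (y : V R m) (f : V R n -> R), p < q -> 0 < rho <= rmax ->
  F q - F p = 2 * rho -> C1 f ->
  exists c, (\int[nu]_(z in Q p q rho y) ((f z - c) ^+ 2)%:E <=
    (K * rho ^+ 2)%:E * \int[nu]_(z in Q p q rho y) (energy f z)%:E)%E.
Proof.
move=> rmax0; have [KW KW0 HW] := interval_weight d10 d1h d1'h d1'1 rmax0.
pose c3 : R := 2 `^ (2 * d2 + 2 * d2'); have c30 : 0 < c3 by exact: powR_gt0.
(* One factor 8 is 2 (q - p) / (g1 - g0), the other is that of [cube_poincare]; [c3] compares Vt M
   with the vertical weight on the far quarter. *)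
pose KV : R := 64 * 2 ^+ m * c3.
have KV0 : 0 < KV by apply: mulr_gt0 => //; apply: mulr_gt0 => //; exact: exprn_gt0.
exists (2 * KW + KV); first by rewrite addr_gt0 // mulr_gt0.
move=> p q rho y f pq rhoI Fpq fC; have /andP[rho0 _] := rhoI.
have [W [Wc dW WK]] := HW p q rho pq rhoI Fpq.
have [g0 [g1 [pg0 g01 g1q g01E far]]] := far_quarter pq.
set M := Num.max _ _ in far *; set L := rho * _; set J := cube y L.
have M0 : 0 < M.
  rewrite /M lt_max !normr_gt0; case: eqVneq => //= p0; case: eqVneq => //= q0.
  by move: pq; rewrite p0 q0 ltxx.
have VM0 : 0 < Vt M by apply: wt_gt0; exact: lt0r_neq0.
have L0 : 0 < L by rewrite mulr_gt0 // sqrtr_gt0.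
have L2 : L ^+ 2 = rho ^+ 2 * Vt M by rewrite exprMn sqr_sqrtr // ltW.
pose B : R := 8 * 2 ^+ m * L ^+ 2.
have B0 : 0 <= B.
  by apply: mulr_ge0; [apply: mulr_ge0 => //; exact: exprn_ge0|exact: sqr_ge0].
have mJ : measurable (J : set (Bo R m)) by exact: measurable_cube.
have [c Hc] := tensor_poincare mJ pg0 g01 g1q B0 (continuous_wt al0 al'0)
  (wt_ge0 _ _) Wc dW fC (fun f' f'C => cube_poincare y L0 f'C).
exists c; apply: (le_trans Hc).
have qp0 : 0 < q - p by rewrite subr_gt0.
have -> : 2 * B * (q - p) / (g1 - g0) = 8 * B by rewrite g01E; field; rewrite gt_eqF.
have A0 : 0 <= W q - W p.
  rewrite subr_ge0; apply: (ger0_derive_le_off0 (ltW pq)); first exact: continuous_subspaceT.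
  move=> x xI x0; have [//|//|? H] := dW x.
  split=> //; rewrite leNgt; apply/negP => W0.
  by have := mulr_ge0_le0 (wt_ge0 (2 * d1) (2 * d1') x) (ltW W0); rewrite leNgt (lt_le_trans ltr01).
have mQ : measurable (slab p q J : set (Bo R n)) by exact: measurable_slab.
have mQ' : measurable (slab g0 g1 J : set (Bo R n)) by exact: measurable_slab.
have QQ : slab g0 g1 J `<=` slab p q J.
  by move=> z [/andP[z0 z1] zJ]; split=> //; rewrite (le_trans pg0) // (le_trans z1).
pose e1 (z : V R n) := U (z ord0 ord0) * Defs.partial R n ord0 f z ^+ 2.
pose e2 (z : V R n) := Vt (z ord0 ord0) * vgrad2 f z.
have e10 z : 0 <= e1 z by rewrite mulr_ge0 ?wt_ge0 ?sqr_ge0.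
have e20 z : 0 <= e2 z by rewrite mulr_ge0 ?wt_ge0 ?vgrad2_ge0.
have ce1 : continuous (e1 : 'rV[R]_n -> R).
  apply: continuous_mul; first by apply: continuous_coord0; exact: continuous_wt.
  by apply: continuous_sqr; exact: (fC _).2.
have cv : continuous (vgrad2 f : 'rV[R]_n -> R).
  by apply: continuous_sum => j; apply: continuous_sqr; exact: (fC _).2.
have ce2 : continuous (e2 : 'rV[R]_n -> R).
  by apply: continuous_mul => //; apply: continuous_coord0; exact: continuous_wt.
have me D (g : V R n -> R) : continuous (g : 'rV[R]_n -> R) ->
    measurable_fun (D : set (Bo R n)) (EFin \o g : Bo R n -> \bar R).
  by move=> gc; apply: measurable_funTS; exact: measurable_EFin_continuous.
have I1 : (0 <= \int[nu]_(z in slab p q J) (e1 z)%:E)%E.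
  by apply: integral_ge0 => z _; rewrite lee_fin.
have I2 : (0 <= \int[nu]_(z in slab p q J) (e2 z)%:E)%E.
  by apply: integral_ge0 => z _; rewrite lee_fin.
have EE : (\int[nu]_(z in slab p q J) (energy f z)%:E =
    \int[nu]_(z in slab p q J) (e1 z)%:E + \int[nu]_(z in slab p q J) (e2 z)%:E)%E.
  rewrite -ge0_integralD //.
  - by move=> z _; rewrite lee_fin.
  - exact: me.
  - by move=> z _; rewrite lee_fin.
  - exact: me.
have V2 : ((8 * B)%:E * \int[nu]_(z in slab g0 g1 J) (vgrad2 f z)%:E <=
    (KV * rho ^+ 2)%:E * \int[nu]_(z in slab p q J) (e2 z)%:E)%E.
  rewrite -!ge0_integralZl_EFin //; first last.
  - by rewrite mulr_ge0.
  - exact: me.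
  - by move=> z _; rewrite lee_fin vgrad2_ge0.
  - by rewrite mulr_ge0 ?sqr_ge0 // ltW.
  - exact: me.
  - by move=> z _; rewrite lee_fin.
  have mc (k : R) (g : V R n -> R) D : continuous (g : 'rV[R]_n -> R) ->
      measurable_fun (D : set (Bo R n)) ((fun z => k%:E * (g z)%:E)%E : Bo R n -> \bar R).
    by move=> gc; apply: measurable_funeM; exact: me.
  apply: (@le_trans _ _ (\int[nu]_(z in slab g0 g1 J) ((KV * rho ^+ 2)%:E * (e2 z)%:E))%E).
    apply: ge0_le_integral => //.
    - by move=> z _; rewrite -EFinM lee_fin mulr_ge0 ?vgrad2_ge0 // mulr_ge0.
    - exact: mc.
    - exact: mc.
    move=> z [zI _]; rewrite -!EFinM lee_fin /e2 [leRHS]mulrA.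
    apply: ler_wpM2r; first exact: vgrad2_ge0.
    have h : Vt M <= c3 * Vt (z ord0 ord0).
      by apply: wt_doubling => //; rewrite (gtr0_norm M0); exact: far.
    have k0 : 0 <= 64 * 2 ^+ m * rho ^+ 2.
      by apply: mulr_ge0; [apply: mulr_ge0 => //; exact: exprn_ge0|exact: sqr_ge0].
    have := ler_wpM2l k0 h; rewrite /B L2 /KV; lra.
  apply: ge0_subset_integral => //; first exact: mc.
  move=> z _; rewrite -EFinM lee_fin; apply: mulr_ge0 (e20 z).
  by apply: mulr_ge0; [exact: ltW|exact: sqr_ge0].
rewrite EE.
apply: (@le_trans _ _ ((2 * KW * rho ^+ 2)%:E * \int[nu]_(z in slab p q J) (e1 z)%:E
   + (KV * rho ^+ 2)%:E * \int[nu]_(z in slab p q J) (e2 z)%:E)%E).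
  apply: leeD => //; apply: lee_wpmul2r => //; rewrite lee_fin.
  by have := WK; lra.
move: I1 I2; move: (\int[_]_(_ in _) (e1 _)%:E)%E (\int[_]_(_ in _) (e2 _)%:E)%E => X Y X0 Y0.
have r20 : 0 <= rho ^+ 2 by exact: sqr_ge0.
rewrite ge0_muleDr //; apply: leeD; apply: lee_wpmul2r => //; rewrite lee_fin.
  by apply: ler_wpM2r => //; rewrite lerDl ltW.
by apply: ler_wpM2r => //; rewrite lerDr mulr_ge0 // ltW.
Qed.

End box_poincare.

Unset Implicit Arguments.

Theorem theorem5p1 (R : realType) (m : nat) (d1 d1' d2 d2' a a' : R)
  (C : V R (1 + m) -> 'M[R]_(1 + m)) :
  (1 <= m)%N ->
  0 <= d1 < 2^-1 -> 2^-1 <= d1' < 1 -> 0 <= d2 -> 0 <= d2' ->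
  0 < a -> 0 < a' ->
  (forall x i j, C x i j = C x j i) ->
  (forall i j, measurable_fun setT (fun x : Leb R (1 + m) => C x i j)) ->
  ae R (1 + m) (fun x => forall xi : 'I_(1 + m) -> R,
      a * qf R (1 + m) (Cdelta R m d1 d1' d2 d2' x) xi <= qf R (1 + m) (C x) xi /\
      qf R (1 + m) (C x) xi <= a' * qf R (1 + m) (Cdelta R m d1 d1' d2 d2' x) xi) ->
  exists kappa : R, 0 < kappa <= 1 /\
    forall Rad : R, 0 < Rad ->
      exists lambda : R, 0 < lambda /\
        forall (x : V R (1 + m)) (r : R) (phi : V R (1 + m) -> R),
          0 < r <= Rad -> C1 R (1 + m) phi ->
          ((lambda / r ^+ 2)%:E *
             Lint R (1 + m) (Ball R (1 + m) C x (kappa * r))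
               (fun y => ((phi y - avg R (1 + m) (Ball R (1 + m) C x (kappa * r)) phi) ^+ 2)%:E)
           <= Lint R (1 + m) (Ball R (1 + m) C x r) (fun y => (Gam R (1 + m) C phi y)%:E))%E.
Proof.
move=> _ /andP[d10 d1h] /andP[d1'h d1'1] d20 d2'0 a0 a'0 _ mC HC.
have d1d1' : d1 <= d1' by exact: le_trans (ltW d1h) d1'h.
have d1'0 : 0 < d1' by apply: lt_le_trans d1'h; rewrite invr_gt0.
have e0 : 0 < 1 - d1' by rewrite subr_gt0.
have sa0 : 0 < Num.sqrt a by rewrite sqrtr_gt0.
pose Kup := 8 / (Num.sqrt a * (1 - d1')) + m%:R / Num.sqrt a.
have Kup0 : 0 < Kup.
  apply: ltr_wpDr; first by rewrite divr_ge0 // ltW.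
  by apply: divr_gt0 => //; exact: mulr_gt0.
(* Then Kup rho = r / 2, strictly below r as the open ball requires. *)
pose c := (2 * Kup)^-1.
have c0 : 0 < c by rewrite invr_gt0 mulr_gt0.
(* The largest factor for which the cut-off of [dist_ge_box] is admissible: 80 a' k0^2 = 1. *)
pose k0 := Num.sqrt (80 * a')^-1.
have ka0 : 0 < (80 * a')^-1 by rewrite invr_gt0 mulr_gt0.
have k00 : 0 < k0 by rewrite sqrtr_gt0.
have k01 : 80 * a' * k0 ^+ 2 <= 1.
  by rewrite sqr_sqrtr ?(ltW ka0) // divff // gt_eqF // mulr_gt0.
have kc0 : 0 < k0 * c by exact: mulr_gt0.
exists (Num.min 1 (k0 * c)); split.
  by rewrite lt_min ltr01 kc0 /= ge_min lexx.
move=> Rad Rad0.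
have [K K0 HK] := @box_poincare R m d1 d1' d2 d2' d10 d1h d1'h d1'1 d20 d2'0 _ (mulr_gt0 c0 Rad0).
(* With rho = c r this is the value for which (lambda / r^2) K rho^2 = a. *)
exists (a / (K * c ^+ 2)); split.
  by apply: divr_gt0 => //; apply: mulr_gt0 => //; exact: exprn_gt0.
move=> x r phi /andP[r0 rRad] phiC.
set kappa := Num.min _ _.
pose rho := c * r; have rho0 : 0 < rho by exact: mulr_gt0.
have [p Fp] := Gr0_surj d1d1' d1'1 (Gr d1 d1' 0 (x ord0 ord0) - rho).
have [q Fq] := Gr0_surj d1d1' d1'1 (Gr d1 d1' 0 (x ord0 ord0) + rho).
have Fnd s t : s <= t -> Gr d1 d1' 0 s <= Gr d1 d1' 0 t by exact: Gr_nondecreasing.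
have px : p < x ord0 ord0 by rewrite ltNge; apply/negP => /Fnd; rewrite Fp; lra.
have xq : x ord0 ord0 < q by rewrite ltNge; apply/negP => /Fnd; rewrite Fq; lra.
have pq : p < q by exact: lt_trans xq.
have Fpq : Gr d1 d1' 0 q - Gr d1 d1' 0 p = 2 * rho by rewrite Fp Fq; ring.
pose L := rho * Num.sqrt (wt (2 * d2) (2 * d2') (Num.max `|p| `|q|)).
pose Q := slab p q (cube (tailv x) L).
have mQ : measurable (Q : set (Bo R m.+1)) by apply: measurable_slab; exact: measurable_cube.
pose Bk := Ball R (1 + m) C x (kappa * r).
have BkQ : Bk `<=` Q.
  move=> y yB; apply: contrapT => yQ.
  have := @dist_ge_box R m d1 d1' d2 d2' a a' C d10 d1h d1'h d1'1 d20 d2'0 a'0 HC x y p q rho k0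
    rho0 pq k00 k01.
  rewrite Fp Fq => /(_ _ _ yQ) h.
  have {}h : ((k0 * rho)%:E <= dist R (1 + m) C x y)%E by apply: h; ring.
  have : (kappa * r <= k0 * rho).
    by rewrite /rho mulrA ler_wpM2r ?(ltW r0) // ge_min lexx orbT.
  rewrite -lee_fin => /le_trans/(_ h); rewrite leNgt => /negP; apply.
  exact: yB.
have QB : Q `<=` Ball R (1 + m) C x r.
  move=> y [yI yJ]; apply: (@le_lt_trans _ _ (Kup * rho)%:E); last first.
    rewrite lte_fin /rho /c; have -> : Kup * ((2 * Kup)^-1 * r) = r / 2.
      by field; rewrite gt_eqF.
    by lra.
  apply: (@dist_le_box R m d1 d1' d2 d2' a a' C d10 d1h d1'h d1'1 d20 d2'0 a0 HC p q) => //.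
    by rewrite !ltW.
  move=> j; have := yJ j; rewrite !tailvE -/L => /andP[h1 h2].
  by rewrite ler_norml; apply/andP; split; lra.
have mBk : measurable (Bk : set (Bo R m.+1)) by exact: measurable_Ball.
have rhoI : 0 < rho <= c * Rad by rewrite rho0 ler_pM2l.
have [c1 Hc1] := HK p q rho (tailv x) phi pq rhoI Fpq phiC.
have cphi := C1_continuous phiC.
have [M HM] := continuous_bounded_slab p q L (tailv x) cphi.
(* The inclusion of the small ball in the bounded box supplies the finite measure and the bound on
   phi. *)
have var := @variance_le _ (Leb R m.+1) R (lebo R m.+1 : set (Leb R m.+1) -> \bar R) Bk phi M
  (Bo_Leb mBk) (lebo_slab_lty BkQ)
  (measurable_funTS (continuous_measurable_Leb cphi)) (fun z zB => HM z (BkQ z zB)) c1.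
have sq0 z : (0 <= ((phi z - c1) ^+ 2)%:E)%E by rewrite lee_fin sqr_ge0.
have msq D : measurable_fun (D : set (Bo R m.+1))
    ((fun z => ((phi z - c1) ^+ 2)%:E) : Bo R m.+1 -> \bar R).
  by apply: measurable_funTS; apply: measurable_EFin_continuous; exact: continuous_sqr_sub.
set X := Lint R (1 + m) _ _.
have X0 : (0 <= X)%E by apply: integral_ge0 => z _; rewrite lee_fin sqr_ge0.
have XE : (X <= (K * rho ^+ 2)%:E * \int[@nu R m.+1]_(z in Q) (energy d1 d1' d2 d2' phi z)%:E)%E.
  apply: (le_trans var).
  have -> : (\int[lebo R m.+1 : set (Leb R m.+1) -> \bar R]_(z in Bk) ((phi z - c1) ^+ 2)%:E =
      \int[@nu R m.+1]_(z in Bk) ((phi z - c1) ^+ 2)%:E)%E.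
    exact: (@Lint_nu R m Bk (fun z => ((phi z - c1) ^+ 2)%:E)).
  by apply: le_trans Hc1; exact: ge0_subset_integral.
have mBr : measurable (Ball R (1 + m) C x r : set (Bo R m.+1)) by exact: measurable_Ball.
have YE := Lint_Gam_ge d10 d1'h d20 d2'0 a0 mC HC mBr phiC.
apply: le_trans YE.
have EQ : (\int[@nu R m.+1]_(z in Q) (energy d1 d1' d2 d2' phi z)%:E <=
   \int[@nu R m.+1]_(z in Ball R (1 + m) C x r) (energy d1 d1' d2 d2' phi z)%:E)%E.
  apply: ge0_subset_integral => //.
  - apply: measurable_funTS; apply: measurable_EFin_continuous.
    exact: continuous_energy.
  - by move=> z _; rewrite lee_fin; exact: energy_ge0.
suff fin (Y E1 E2 : \bar R) : (Y <= (K * rho ^+ 2)%:E * E1 -> E1 <= E2 ->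
    (a / (K * c ^+ 2) / r ^+ 2)%:E * Y <= a%:E * E2)%E by exact: fin XE EQ.
move=> YE E12.
apply: (@le_trans _ _ (a%:E * E1)%E); last by apply: lee_wpmul2l => //; rewrite lee_fin ltW.
have -> : a%:E = ((a / (K * c ^+ 2) / r ^+ 2)%:E * (K * rho ^+ 2)%:E)%E.
  by rewrite -EFinM /rho; congr (_%:E); field; rewrite !gt_eqF.
rewrite -muleA; apply: lee_wpmul2l => //.
rewrite lee_fin divr_ge0 ?sqr_ge0 // divr_ge0 ?(ltW a0) // mulr_ge0 ?(ltW K0) //.
exact: sqr_ge0.
Qed.
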